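(* Let $d\ge 2$, $a>0$, $b>0$, $h\in\mathbb{R}$, and let $\mathbf e=(e_x)_{x\in\mathbb{Z}^d}$ be an i.i.d. family of real random variables with $\mathbb{E}(e_x)=0$, $\mathrm{Var}(e_x)=1$ and $\mathbb{E}(e^{b e_x+h})<\infty$. Then $$f^{\mathbf q}(\mathbf e)<f^{\mathbf a}(\mathbf e)\quad\text{whenever}\quad f^{\mathbf a}(\mathbf e)>0.$$ Moreover, let $\ell(\mathbf e):=\log \mathbb{E}(e^{b e_0+h})$ and $\gamma:=\exp(b e_0+h-\ell(\mathbf e))$. Then, whenever $f^{\mathbf a}(\mathbf e)>0$, the following quantitative bounds hold. (a) For $d\ge 3$, $$f^{\mathbf q}(\mathbf e)-f^{\mathbf a}(\mathbf e)\le \mathbb{E}\log(\lambda\gamma+1-\lambda),$$ where $\lambda:=\frac{C_1\ell(\mathbf e)}{1+C_1\ell(\mathbf e)}$ for some constant $C_1=C_1(a)>0$. (b) For $d=2$, $$f^{\mathbf q}(\mathbf e)-f^{\mathbf a}(\mathbf e)\le \mathbb{E}\log\Big(\frac{\lambda}{|\log\lambda|}\gamma+1-\frac{\lambda}{|\log\lambda|}\Big),$$ for some $\lambda=\lambda(\ell(\mathbf e))>0$ which is equal to $\frac{C_2\ell(\mathbf e)}{\sqrt{|\log \ell(\mathbf e)|}}$, with $C_2=C_2(a)>0$ a constant, for $\ell(\mathbf e)$ small enough.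
   Context: For a finite set $\Lambda\subset\mathbb{Z}^d$ and $\varphi\in\mathbb{R}^{\mathbb{Z}^d}$, let $$\mathcal H_\Lambda(\varphi)=\frac1{4d}\sum_{\{x,y\}\cap\Lambda\neq\varnothing,\ x\sim y}(\varphi_x-\varphi_y)^2,$$ where the sum is over nearest-neighbour edges $\{x,y\}$ of $\mathbb{Z}^d$ with at least one endpoint in $\Lambda$. The partition function (with zero boundary conditions and inverse temperature $1$) is $$Z_\Lambda^{\mathbf e}=\int \exp\Big(-\mathcal H_\Lambda(\varphi)+\sum_{x\in\Lambda}(b e_x+h)\mathbf 1_{[\varphi_x\in[-a,a]]}\Big)\prod_{x\in\Lambda}d\varphi_x\prod_{y\in\Lambda^c}\delta_0(d\varphi_y).$$ $Z_\Lambda^0$ denotes the partition function of the model with no potential (the Gaussian free field), i.e. the same integral with the sum $\sum_{x\in\Lambda}(b e_x+h)\mathbf 1_{[\varphi_x\in[-a,a]]}$ replaced by $0$. The finite-volume quenched and annealed free energies are $$f^{\mathbf q}_\Lambda(\mathbf e)=|\Lambda|^{-1}\log\big(Z_\Lambda^{\mathbf e}/Z_\Lambda^0\big),\qquad f^{\mathbf a}_\Lambda(\mathbf e)=|\Lambda|^{-1}\log\big(\mathbb{E}Z_\Lambda^{\mathbf e}/Z_\Lambda^0\big),$$ with $\mathbb{E}$ the expectation over the environment $\mathbf e$. The infinite-volume free energies are $f^{\mathbf q}(\mathbf e)=\lim_{\Lambda\uparrow\mathbb{Z}^d}f^{\mathbf q}_\Lambda(\mathbf e)$ (the limit exists almost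 surely and in $L^2$ and is a deterministic real number) and $f^{\mathbf a}(\mathbf e)=\lim_{\Lambda\uparrow\mathbb{Z}^d}f^{\mathbf a}_\Lambda(\mathbf e)$ (the limit exists in $\mathbb{R}$), both independent of the sequence of finite sets $\Lambda\uparrow\mathbb{Z}^d$ (increasing with union $\mathbb{Z}^d$) provided $|\partial\Lambda|/|\Lambda|\to0$, where $\partial\Lambda$ is the set of sites outside $\Lambda$ having a nearest neighbour in $\Lambda$; for instance along the boxes $\Lambda=\{0,\dots,n-1\}^d$ (up to translation). *)

(* Defs.v *)
From HB Require Import structures.
From mathcomp Require Export all_boot all_order all_algebra.
From mathcomp Require Export finmap.
From mathcomp Require Export all_classical all_reals all_analysis.
Export numFieldNormedType.Exports.
Export Order.TTheory GRing.Theory Num.Theory.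

Set Implicit Arguments.
Unset Strict Implicit.
Unset Printing Implicit Defensive.

Global Open Scope classical_set_scope.
Global Open Scope ring_scope.

Notation site d := 'rV[int]_d.

Definition unitv (d : nat) (i : 'I_d) : site d := delta_mx 0 i.

Definition neighbours (d : nat) (x : site d) : {fset site d} :=
  ([fset (x + unitv i)%R | i in 'I_d] `|` [fset (x - unitv i)%R | i in 'I_d])%fset.

Definition boundary (d : nat) (L : {fset site d}) : {fset site d} :=
  ((\bigcup_(x <- L) neighbours x) `\` L)%fset.

Definition van_hove (R : realType) (d : nat) (L : nat -> {fset site d}) : Prop :=
  [/\ forall m n, (m <= n)%N -> (L m `<=` L n)%fset,
      forall x, exists n, x \in L n &
      (#|` boundary (L n)|%:R / #|` L n|%:R : R) @[n --> \oo] --> 0].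

(* Each edge is written {x, x + unitv i} in exactly one way; it meets [L] iff
   x is in [L] or in the translate of [L] by - unitv i. *)
Definition hamiltonian (R : realType) (d : nat) (L : {fset site d})
    (phi : site d -> R) : R :=
  (4 * d)%:R^-1 *
  \sum_(i < d) \sum_(x <- (L `|` [fset (y - unitv i)%R | y in L])%fset)
    (phi x - phi (x + unitv i)) ^+ 2.

Definition upd (R : realType) (d : nat) (phi : site d -> R) (x : site d) (t : R) :
    site d -> R :=
  fun y => if y == x then t else phi y.

(* Integral of [F] against the product over x in s of Lebesgue measures d phi_x,
   the other coordinates being frozen at their value in [phi]. It is
   written as an iterated integral; by Tonelli the order of the sites is
   irrelevant for nonnegative measurable [F]. *)
Fixpoint field_integral (R : realType) (d : nat) (s : seq (site d))
    (F : (site d -> R) -> \bar R) (phi : site d -> R) {struct s} : \bar R :=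
  if s is x :: s' then
    (\int[@lebesgue_measure R]_t field_integral s' F (upd phi x t))%E
  else F phi.

(* Partition function with potential [v x] at site x of [L]; starting
   from the zero field imposes phi = 0 outside of [L]. *)
Definition partition_fun (R : realType) (d : nat) (a : R) (v : site d -> R)
    (L : {fset site d}) : R :=
  fine (field_integral L
    (fun phi => (expR (- hamiltonian L phi +
                       \sum_(x <- L) v x * \1_(`[- a, a]) (phi x)))%:E)
    (fun=> 0)).

Definition Z_disorder (R : realType) (d : nat) (a b h : R) (e : site d -> R)
    (L : {fset site d}) : R :=
  partition_fun a (fun x => b * e x + h) L.

Definition Z_free (R : realType) (d : nat) (L : {fset site d}) : R :=
  fine (field_integral L
    (fun phi : site d -> R => (expR (- hamiltonian L phi))%:E) (fun=> 0)).

Definition mutually_independent (R : realType) (disp : measure_display)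
    (T : measurableType disp) (P : probability T R) (d : nat)
    (e : site d -> {RV P >-> R}) : Prop :=
  forall (J : {fset site d}) (B : site d -> set R),
    (forall x, measurable (B x)) ->
    (P (\bigcap_(x in [set` J]) (e x @^-1` B x)) =
     \prod_(x <- J) P (e x @^-1` B x))%E.

Definition identically_distributed (R : realType) (disp : measure_display)
    (T : measurableType disp) (P : probability T R) (d : nat)
    (e : site d -> {RV P >-> R}) : Prop :=
  forall (x y : site d) (B : set R), measurable B ->
    distribution P (e x) B = distribution P (e y) B.

Definition log_mgf (R : realType) (disp : measure_display)
    (T : measurableType disp) (P : probability T R) (d : nat) (b h : R)
    (e : site d -> {RV P >-> R}) : R :=
  ln (fine 'E_P[fun w => expR (b * e 0 w + h)%R]%E).

Definition tilt (R : realType) (disp : measure_display)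
    (T : measurableType disp) (P : probability T R) (d : nat) (b h : R)
    (e : site d -> {RV P >-> R}) (w : T) : R :=
  expR (b * e 0 w + h - log_mgf b h e).

Definition quenched_fe (R : realType) (d : nat) (a b h : R) (e : site d -> R)
    (L : {fset site d}) : R :=
  #|` L|%:R^-1 * ln (Z_disorder a b h e L / Z_free R L).

Definition annealed_fe (R : realType) (disp : measure_display)
    (T : measurableType disp) (P : probability T R) (d : nat) (a b h : R)
    (e : site d -> {RV P >-> R}) (L : {fset site d}) : R :=
  #|` L|%:R^-1 *
  ln (fine 'E_P[fun w => Z_disorder a b h (fun x => e x w) L]%E / Z_free R L).

Definition is_quenched_limit (R : realType) (disp : measure_display)
    (T : measurableType disp) (P : probability T R) (d : nat) (a b h : R)
    (e : site d -> {RV P >-> R}) (L : nat -> {fset site d}) (fq : R) : Prop :=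
  {ae P, forall w,
     quenched_fe a b h (fun x => e x w) (L n) @[n --> \oo] --> fq} /\
  'E_P[fun w => ((quenched_fe a b h (fun x => e x w) (L n) - fq) ^+ 2)%R]%E
     @[n --> \oo] --> 0%E.

Definition is_annealed_limit (R : realType) (disp : measure_display)
    (T : measurableType disp) (P : probability T R) (d : nat) (a b h : R)
    (e : site d -> {RV P >-> R}) (L : nat -> {fset site d}) (fa : R) : Prop :=
  annealed_fe a b h e (L n) @[n --> \oo] --> fa.

(* Main.v *)
(* Expanding the product of 1 + (exp (v x) - 1) 1_[-a, a] writes the partition
   function as a polynomial, affine in each exp (v x), whose coefficients are the
   weights of the sets of sites pinned in [-a, a].  The annealed model has weight
   exp l = Q ^ 2 at every site, the quenched one Q ^ 2 gamma.  By concavity of the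
   logarithm the mean of ln Z increases when Q ^ 2 gamma is replaced by
   Q + (Q ^ 2 - Q) gamma.  The deterministic part Q then keeps every site pinned
   with odds bounded below, whatever the disorder, because the Gaussian field
   conditioned to vanish at the other pinned sites has bounded variance (d >= 3),
   or variance logarithmic in the typical distance to these sites (d = 2).
   Replacing the remaining disorder by its mean, one site at a time, therefore
   gains at least - E ln (p gamma + 1 - p) per site, which is positive by strict
   concavity.

   The variance bounds are inequalities f(x)^2 <= V H(f), obtained by comparing
   f(x) with averages of f over growing boxes; inserting a pinned site shifts the
   field by a multiple of the corresponding harmonic potential. *)

From HB Require Import structures.
Require Import Defs.
From mathcomp Require Import measurable_realfun ring lra zify.

Set Implicit Arguments.
Unset Strict Implicit.
Unset Printing Implicit Defensive.

(** The statement fixes C1, C2 and lambda before d and before the law of the disorder, so every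
    constant must come from [a] alone. Cauchy-Schwarz bounds the mean of a gradient over a box of
    volume v by b / sqrt v, where b^2 bounds the energy; enlarging a box of side m moves the average
    of f by order m^(-3/2) in three dimensions, which is summable, and by order 1 / m in the plane,
    which sums to a logarithm. In the plane this bounds |f| by a logarithm, hence V by its square
    and the insertion rate from below by 1 / log. Far-away pinned sites are excluded by entropy: an
    empty square of side n can receive one more pinned site in n^2 ways, each at a factor (Q - 1) /
    log n, so a scale of order l^(-2) is enough. The admissible p, of order l / |log l|, dominates
    lambda / |log lambda|, of order l / |log l|^(3/2). The square root Q of exp l serves the
    factorisation Q + (Q^2 - Q) gamma = Q (1 + (Q - 1) gamma): expanding the second factor leaves
    homogeneous models with reward Q, in which the disorder is only a nonnegative coefficient. *)

Section Averages.
Context {R : realType}.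
Implicit Types (g : nat -> R) (b : R).

(** * Functions of bounded gradient energy, compared with their averages over boxes *)

Definition avg (m : nat) g : R := m.+1%:R^-1 * \sum_(i < m.+1) g i.

Lemma ler_avg m g g' : (forall i, (i <= m)%N -> g i <= g' i) -> avg m g <= avg m g'.
Proof.
by move=> gg'; apply: ler_wpM2l; rewrite ?invr_ge0// ler_sum// => i _; apply: gg'; rewrite -ltnS.
Qed.

Lemma avgB m g g' : avg m g - avg m g' = avg m (fun i => g i - g' i).
Proof. by rewrite /avg -mulrBr sumrB. Qed.

Lemma ler_norm_avg m g : `|avg m g| <= avg m (fun i => `|g i|).
Proof.
rewrite /avg normrM ger0_norm ?invr_ge0//.
by rewrite ler_wpM2l ?invr_ge0// ler_norm_sum.
Qed.

Lemma avg_cst m (c : R) : avg m (fun=> c) = c.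
Proof. by rewrite /avg sumr_const card_ord -[c *+ _]mulr_natl mulKf// pnatr_eq0. Qed.

Lemma sqr_avg_le m g : (avg m g) ^+ 2 <= avg m (fun i => g i ^+ 2).
Proof.
set c := avg m g.
have : 0 <= avg m (fun i => (g i - c) ^+ 2).
  by rewrite mulr_ge0 ?invr_ge0// sumr_ge0// => i _; exact: sqr_ge0.
have -> : avg m (fun i => (g i - c) ^+ 2) = avg m (fun i => g i ^+ 2) - c ^+ 2.
  have -> : avg m (fun i => (g i - c) ^+ 2) =
      avg m (fun i => g i ^+ 2) - c *+ 2 * avg m g + avg m (fun=> c ^+ 2).
    rewrite /avg; under eq_bigr do rewrite sqrrB.
    rewrite big_split/= sumrB mulrDr mulrBr; congr (_ - _ + _).
    rewrite mulrCA; congr (_ * _); rewrite mulr_sumr; apply: eq_bigr => i _; ring.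
  by rewrite avg_cst -/c; ring.
by rewrite subr_ge0.
Qed.

(* The difference of consecutive averages is a flow of Polya-urn type, spreading
   the uniform law on m.+1 points to the uniform law on m.+2 points. *)
Lemma avgS_le m g : `|avg m g - avg m.+1 g| <= avg m (fun i => `|g i - g i.+1|).
Proof.
have flow n : \sum_(i < n) i.+1%:R * (g i - g i.+1) = \sum_(i < n) g i - n%:R * g n.
  elim: n => [|n IH]; first by rewrite !big_ord0 mul0r subrr.
  by rewrite !big_ord_recr/= IH -!natr1; ring.
have -> : avg m g - avg m.+1 g =
    (m.+1%:R * m.+2%:R)^-1 * \sum_(i < m.+1) i.+1%:R * (g i - g i.+1).
  rewrite flow /avg [\sum_(i < m.+2) _]big_ord_recr/= -[m.+2%:R]natr1.
  have m0 : 1 + m%:R != 0 :> R by rewrite nat1r pnatr_eq0.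
  have m1 : 1 + m%:R + 1 != 0 :> R by rewrite nat1r natr1 pnatr_eq0.
  by field; rewrite m1 m0.
rewrite normrM ger0_norm ?invr_ge0// /avg invfM -mulrA ler_wpM2l ?invr_ge0//.
rewrite ler_pdivrMl// mulr_sumr (le_trans (ler_norm_sum _ _ _))// ler_sum// => i _.
by rewrite normrM ler_wpM2r// ger0_norm// ler_nat ltnW// ltnS.
Qed.

(** Jensen in each variable. The square root of the volume in the denominator is what makes the
    telescoping sums below logarithmic, and convergent in the three-dimensional version. *)
Lemma avg_avg_le m n (G : nat -> nat -> R) b : 0 <= b ->
  \sum_(i < m.+1) \sum_(j < n.+1) G i j ^+ 2 <= b ^+ 2 ->
  avg m (fun i => avg n (fun j => `|G i j|)) <= b / Num.sqrt (m.+1 * n.+1)%:R.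
Proof.
move=> b0 Gb.
have mn0 : 0 < (m.+1 * n.+1)%:R :> R by rewrite ltr0n.
have A0 : 0 <= avg m (fun i => avg n (fun j => `|G i j|)).
  by rewrite mulr_ge0 ?invr_ge0// sumr_ge0// => i _; rewrite mulr_ge0 ?invr_ge0// sumr_ge0.
rewrite -(@ler_pXn2r _ 2)// ?nnegrE//; last by rewrite divr_ge0// sqrtr_ge0.
rewrite expr_div_n (sqr_sqrtr (ltW mn0)) ler_pdivlMr//.
apply: le_trans Gb.
rewrite mulrC -ler_pdivlMl// (le_trans (sqr_avg_le _ _))//.
apply: (@le_trans _ _ (avg m (fun i => avg n (fun j => G i j ^+ 2)))).
  apply: ler_avg => i _; apply: (le_trans (sqr_avg_le _ _)).
  by apply: ler_avg => j _; rewrite real_normK ?num_real.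
rewrite /avg -mulr_sumr mulrA ler_wpM2r//.
  by apply: sumr_ge0 => i _; apply: sumr_ge0 => j _; exact: sqr_ge0.
by rewrite natrM invfM.
Qed.

Lemma avg_avg_avg_le m n l (G : nat -> nat -> nat -> R) b : 0 <= b ->
  \sum_(i < m.+1) \sum_(j < n.+1) \sum_(k < l.+1) G i j k ^+ 2 <= b ^+ 2 ->
  avg m (fun i => avg n (fun j => avg l (fun k => `|G i j k|))) <=
  b / Num.sqrt (m.+1 * n.+1 * l.+1)%:R.
Proof.
move=> b0 Gb.
have mn0 : 0 < (m.+1 * n.+1 * l.+1)%:R :> R by rewrite ltr0n.
have A0 : 0 <= avg m (fun i => avg n (fun j => avg l (fun k => `|G i j k|))).
  do 3 (rewrite mulr_ge0 ?invr_ge0// sumr_ge0// => ? _).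
rewrite -(@ler_pXn2r _ 2)// ?nnegrE//; last by rewrite divr_ge0// sqrtr_ge0.
rewrite expr_div_n (sqr_sqrtr (ltW mn0)) ler_pdivlMr//.
apply: le_trans Gb.
rewrite mulrC -ler_pdivlMl// (le_trans (sqr_avg_le _ _))//.
apply: (@le_trans _ _ (avg m (fun i => avg n (fun j => avg l (fun k => G i j k ^+ 2))))).
  apply: ler_avg => i _; apply: (le_trans (sqr_avg_le _ _)).
  apply: ler_avg => j _; apply: (le_trans (sqr_avg_le _ _)).
  by apply: ler_avg => k _; rewrite real_normK ?num_real.
rewrite /avg; under eq_bigr do rewrite -mulr_sumr mulrA.
rewrite -mulr_sumr mulrA ler_wpM2r//.
  by do 3 (apply: sumr_ge0 => ? _); exact: sqr_ge0.
by rewrite !natrM !invfM mulrA.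
Qed.

(** The n-th harmonic number, unrelated to the harmonic functions used later. *)
Definition harm (n : nat) : R := \sum_(m < n) m.+1%:R^-1.

Lemma harm_ge0 n : 0 <= harm n.
Proof. by apply: sumr_ge0 => i _; rewrite invr_ge0. Qed.

Section TwoDim.
Variables (F : nat -> nat -> R) (b : R).
Hypothesis b_ge0 : 0 <= b.
Hypothesis energy1 : forall p q m n,
  \sum_(i < m) \sum_(j < n) (F (p + i) (q + j) - F (p + i).+1 (q + j)) ^+ 2 <= b ^+ 2.
Hypothesis energy2 : forall p q m n,
  \sum_(i < m) \sum_(j < n) (F (p + i) (q + j) - F (p + i) (q + j).+1) ^+ 2 <= b ^+ 2.

Let s p q m n := avg m (fun i => avg n (fun j => F (p + i) (q + j))).

Let s_step1 p q m n : `|s p q m n - s p q m.+1 n| <= b / Num.sqrt (m.+1 * n.+1)%:R.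
Proof.
apply: le_trans (avgS_le _ _) _. 
apply: (le_trans _ (avg_avg_le (G := fun i j => F (p + i) (q + j) - F (p + i).+1 (q + j))
  b_ge0 (energy1 p q m.+1 n.+1))).
apply: ler_avg => i _; rewrite avgB; apply: le_trans (ler_norm_avg _ _) _.
by apply: ler_avg => j _; rewrite addnS.
Qed.

Let s_step2 p q m n : `|s p q m n - s p q m n.+1| <= b / Num.sqrt (m.+1 * n.+1)%:R.
Proof.
rewrite /s avgB; apply: le_trans (ler_norm_avg _ _) _.
apply: (le_trans _ (avg_avg_le (G := fun i j => F (p + i) (q + j) - F (p + i) (q + j).+1)
  b_ge0 (energy2 p q m.+1 n.+1))).
apply: ler_avg => i _; apply: le_trans (avgS_le _ _) _.
by apply: ler_avg => j _; rewrite addnS.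
Qed.

Let sqrtSS m : Num.sqrt (m.+1 * m.+1)%:R = m.+1%:R :> R.
Proof. by rewrite natrM -expr2 sqrtr_sqr ger0_norm. Qed.

(** The square grows first in one direction, then in the other, at a cost of at most b / (m + 1)
    each time. *)
Let s_diag p q m : `|s p q m m - s p q m.+1 m.+1| <= 2 * b / m.+1%:R.
Proof.
rewrite -(subrKA (s p q m.+1 m)); apply: le_trans (ler_normD _ _) _.
have -> : 2 * b / m.+1%:R = b / m.+1%:R + b / m.+1%:R by ring.
apply: lerD; first by rewrite -[leRHS]mulr1 mulr1 -(sqrtSS m); exact: s_step1.
apply: (le_trans (s_step2 _ _ _ _)); rewrite ler_wpM2l// lef_pV2 ?posrE ?sqrtr_gt0 ?ltr0n//.
by rewrite -sqrtSS ler_wsqrtr// ler_nat leq_mul.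
Qed.

Let s_conv p q m : `|F p q - s p q m m| <= 2 * b * harm m.
Proof.
elim: m => [|m IH].
  rewrite /s /avg !big_ord1/= !invr1 !mul1r !addn0 subrr normr0 mulr_ge0 ?harm_ge0//.
  by rewrite mulr_ge0.
rewrite -(subrKA (s p q m m)); apply: le_trans (ler_normD _ _) _.
rewrite /harm big_ord_recr/= mulrDr lerD//; exact: s_diag.
Qed.

Let s_shift1 p q m : `|s p q m m - s p.+1 q m m| <= b / m.+1%:R.
Proof.
rewrite -(sqrtSS m) /s avgB; apply: le_trans (ler_norm_avg _ _) _.
apply: (le_trans _ (avg_avg_le (G := fun i j => F (p + i) (q + j) - F (p + i).+1 (q + j))
  b_ge0 (energy1 p q m.+1 m.+1))).
apply: ler_avg => i _; rewrite avgB; apply: le_trans (ler_norm_avg _ _) _.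
by apply: ler_avg => j _; rewrite addSn.
Qed.

Let s_shift2 p q m : `|s p q m m - s p q.+1 m m| <= b / m.+1%:R.
Proof.
rewrite -(sqrtSS m) /s avgB; apply: le_trans (ler_norm_avg _ _) _.
apply: (le_trans _ (avg_avg_le (G := fun i j => F (p + i) (q + j) - F (p + i) (q + j).+1)
  b_ge0 (energy2 p q m.+1 m.+1))).
apply: ler_avg => i _; rewrite avgB; apply: le_trans (ler_norm_avg _ _) _.
by apply: ler_avg => j _; rewrite addSn.
Qed.

(** Moving the corner by one unit costs b / (m + 1), and there are at most m moves in each
    direction, so the total does not grow with the scale. *)
Let s_center p q m : (p <= m)%N -> (q <= m)%N ->
  `|s 0 0 m m - s p q m m| <= 2 * b.
Proof.
move=> pm qm.
have bm0 : 0 <= b / m.+1%:R by rewrite divr_ge0.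
have h1 : `|s 0 0 m m - s p 0 m m| <= p%:R * (b / m.+1%:R).
  elim: (p) => [|k IH]; first by rewrite subrr normr0 mul0r.
  rewrite -(subrKA (s k 0 m m)) (le_trans (ler_normD _ _))//.
  by rewrite -natr1 mulrDl mul1r lerD.
have h2 : `|s p 0 m m - s p q m m| <= q%:R * (b / m.+1%:R).
  elim: (q) => [|k IH]; first by rewrite subrr normr0 mul0r.
  rewrite -(subrKA (s p k m m)) (le_trans (ler_normD _ _))//.
  by rewrite -natr1 mulrDl mul1r lerD.
rewrite -(subrKA (s p 0 m m)) (le_trans (ler_normD _ _))//.
have -> : 2 * b = b + b by ring.
by apply: lerD; [apply: le_trans h1 _|apply: le_trans h2 _];
  rewrite mulrCA ler_piMr// ler_pdivrMr// mul1r ler_nat ltnW.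
Qed.

(** Each point is compared with the square of scale n having its corner there, and both squares with
    the one at the origin. *)
Lemma planar_oscillation n p q p' q' :
  (p <= n)%N -> (q <= n)%N -> (p' <= n)%N -> (q' <= n)%N ->
  `|F p q - F p' q'| <= (harm n + 1) *+ 4 * b.
Proof.
move=> pn qn pn' qn'.
have h1 := s_conv p q n; have h2 := s_conv p' q' n.
have h3 := s_center pn qn; have h4 := s_center pn' qn'.
move: h1 h2 h3 h4; rewrite !ler_norml => /andP[? ?] /andP[? ?] /andP[? ?] /andP[? ?].
by apply/andP; split; lra.
Qed.
End TwoDim.

(** Comparison with the telescoping series of 4 (1 / sqrt n - 1 / sqrt (n + 1)). The exponent 3/2
    occurs twice: for the three-dimensional boxes, with D = 0, and for the planar shells beyond
    scale D. *)
Lemma sum_inv_sqrt3_le D n :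
  \sum_(D <= m < D + n) (m.+1%:R * Num.sqrt m.+1%:R)^-1 <= 4 / Num.sqrt D.+1%:R :> R.
Proof.
suff : \sum_(D <= m < D + n) (m.+1%:R * Num.sqrt m.+1%:R)^-1 <=
   4 * ((Num.sqrt D.+1%:R)^-1 - (Num.sqrt (D + n).+1%:R)^-1) :> R.
  by move/le_trans; apply; rewrite ler_wpM2l// gerBl invr_ge0 sqrtr_ge0.
elim: n => [|n IH]; first by rewrite addn0 big_geq// subrr mulr0.
rewrite addnS big_nat_recr ?leq_addr//=; set N := (D + n)%N in IH *.
suff h : (N.+1%:R * Num.sqrt N.+1%:R)^-1 <=
    4 * ((Num.sqrt N.+1%:R)^-1 - (Num.sqrt N.+2%:R)^-1) :> R.
  by rewrite (le_trans (lerD IH h))// -mulrDr subrKA.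
set x := Num.sqrt N.+1%:R; set y := Num.sqrt N.+2%:R.
have x0 : 0 < x by rewrite sqrtr_gt0.
have y0 : 0 < y by rewrite sqrtr_gt0.
have x2 : x ^+ 2 = N.+1%:R by rewrite sqr_sqrtr.
have y2 : y ^+ 2 = x ^+ 2 + 1 by rewrite x2 sqr_sqrtr// natr1.
have x1 : 1 <= x ^+ 2 by rewrite x2 ler1n.
rewrite -x2.
have -> : 4 * (x^-1 - y^-1) = 4 * (y ^+ 2 - x ^+ 2) / (x * y * (x + y)).
  by field; rewrite !gt_eqF// addr_gt0.
rewrite y2 addrAC subrr add0r mulr1 ler_pdivlMr ?mulr_gt0 ?addr_gt0//.
rewrite mulrC ler_pdivrMr ?mulr_gt0//.
have xy : x <= y by rewrite ler_wsqrtr// ler_nat.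
have : y * (x + y) <= 4 * x ^+ 2.
  by have := sqr_ge0 (x - y); lra.
by move/(ler_wpM2l (ltW x0)); lra.
Qed.

Section ThreeDim.
Variables (F : nat -> nat -> nat -> R) (b S : R).
Hypothesis b_ge0 : 0 <= b.
Hypothesis energy1 : forall m n l, \sum_(i < m) \sum_(j < n) \sum_(k < l)
  (F i j k - F i.+1 j k) ^+ 2 <= b ^+ 2.
Hypothesis energy2 : forall m n l, \sum_(i < m) \sum_(j < n) \sum_(k < l)
  (F i j k - F i j.+1 k) ^+ 2 <= b ^+ 2.
Hypothesis energy3 : forall m n l, \sum_(i < m) \sum_(j < n) \sum_(k < l)
  (F i j k - F i j k.+1) ^+ 2 <= b ^+ 2.
Hypothesis square_summable : forall m n l, \sum_(i < m) \sum_(j < n) \sum_(k < l)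
  F i j k ^+ 2 <= S ^+ 2.
Hypothesis S_ge0 : 0 <= S.

Let s m n l := avg m (fun i => avg n (fun j => avg l (fun k => F i j k))).

Let s_step1 m n l : `|s m n l - s m.+1 n l| <= b / Num.sqrt (m.+1 * n.+1 * l.+1)%:R.
Proof.
apply: le_trans (avgS_le _ _) _; apply: (le_trans _ (avg_avg_avg_le (G := fun i j k => F i j k - F i.+1 j k)
  b_ge0 (energy1 m.+1 n.+1 l.+1))).
apply: ler_avg => i _; rewrite avgB; apply: le_trans (ler_norm_avg _ _) _.
apply: ler_avg => j _; rewrite avgB; exact: ler_norm_avg.
Qed.

Let s_step2 m n l : `|s m n l - s m n.+1 l| <= b / Num.sqrt (m.+1 * n.+1 * l.+1)%:R.
Proof.
rewrite /s avgB; apply: le_trans (ler_norm_avg _ _) _.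
apply: (le_trans _ (avg_avg_avg_le (G := fun i j k => F i j k - F i j.+1 k)
  b_ge0 (energy2 m.+1 n.+1 l.+1))).
apply: ler_avg => i _; apply: le_trans (avgS_le _ _) _.
apply: ler_avg => j _; rewrite avgB; exact: ler_norm_avg.
Qed.

Let s_step3 m n l : `|s m n l - s m n l.+1| <= b / Num.sqrt (m.+1 * n.+1 * l.+1)%:R.
Proof.
rewrite /s avgB; apply: le_trans (ler_norm_avg _ _) _.
apply: (le_trans _ (avg_avg_avg_le (G := fun i j k => F i j k - F i j k.+1)
  b_ge0 (energy3 m.+1 n.+1 l.+1))).
apply: ler_avg => i _; rewrite avgB; apply: le_trans (ler_norm_avg _ _) _.
apply: ler_avg => j _; exact: avgS_le.
Qed.

Let s_diag m : `|s m m m - s m.+1 m.+1 m.+1| <= 3 * b * (m.+1%:R * Num.sqrt m.+1%:R)^-1.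
Proof.
have sE : Num.sqrt (m.+1 * m.+1 * m.+1)%:R = m.+1%:R * Num.sqrt m.+1%:R :> R.
  by rewrite natrM sqrtrM// natrM -expr2 sqrtr_sqr ger0_norm.
have le_b N : (m.+1 * m.+1 * m.+1 <= N)%N ->
    b / Num.sqrt N%:R <= b * (m.+1%:R * Num.sqrt m.+1%:R)^-1.
  move=> mN; have N0 : (0 < N)%N by apply: leq_trans mN; rewrite muln_gt0.
  by rewrite ler_wpM2l// -sE lef_pV2 ?posrE ?sqrtr_gt0 ?ltr0n// ler_wsqrtr// ler_nat.
have h1 := le_trans (s_step1 m m m) (le_b _ (leqnn _)).
have h2 : `|s m.+1 m m - s m.+1 m.+1 m| <= b * (m.+1%:R * Num.sqrt m.+1%:R)^-1.
  by apply: (le_trans (s_step2 _ _ _)); apply: le_b; rewrite !leq_mul.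
have h3 : `|s m.+1 m.+1 m - s m.+1 m.+1 m.+1| <= b * (m.+1%:R * Num.sqrt m.+1%:R)^-1.
  by apply: (le_trans (s_step3 _ _ _)); apply: le_b; rewrite !leq_mul.
move: h1 h2 h3; set c := b * _; rewrite -mulrA -/c.
rewrite !ler_norml => /andP[? ?] /andP[? ?] /andP[? ?].
by apply/andP; split; lra.
Qed.

(** Telescoping gives 12 b = 3 b * 4, one b per direction times the bound on the series. Square
    summability makes the averages themselves tend to 0, so S disappears from the conclusion. *)
Lemma spatial_bound : `|F 0 0 0| <= 12 * b.
Proof.
have conv m : `|F 0 0 0 - s m m m| <= 12 * b.
  apply: (@le_trans _ _ (3 * b * \sum_(0 <= k < m) (k.+1%:R * Num.sqrt k.+1%:R)^-1)).
    elim: m => [|m IH].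
      by rewrite /s /avg !big_ord1/= !invr1 !mul1r subrr normr0 big_geq// mulr0.
    rewrite -(subrKA (s m m m)); apply: le_trans (ler_normD _ _) _.
    by rewrite big_nat_recr//= mulrDr lerD// s_diag.
  have := sum_inv_sqrt3_le 0 m; rewrite add0n sqrtr1 divr1 => h.
  have -> : 12 * b = 3 * b * 4 by ring.
  by rewrite ler_wpM2l// mulr_ge0.
have small m : `|s m m m| <= S / Num.sqrt m.+1%:R.
  apply: (@le_trans _ _ (S / Num.sqrt (m.+1 * m.+1 * m.+1)%:R)); last first.
    rewrite ler_wpM2l// lef_pV2 ?posrE ?sqrtr_gt0 ?ltr0n// ler_wsqrtr// ler_nat.
    by rewrite leq_pmull.
  apply: (le_trans _ (avg_avg_avg_le (G := F) S_ge0 (square_summable m.+1 m.+1 m.+1))).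
  apply: le_trans (ler_norm_avg _ _) _; apply: ler_avg => i _.
  by apply: le_trans (ler_norm_avg _ _) _; apply: ler_avg => j _; exact: ler_norm_avg.
apply/ler_addgt0Pr => e e0.
pose m := Num.bound ((S / e) ^+ 2).
have sm : S / Num.sqrt m.+1%:R <= e.
  rewrite ler_pdivrMr ?sqrtr_gt0// mulrC -ler_pdivrMr//.
  have Se0 : 0 <= S / e by apply: divr_ge0 => //; exact: ltW.
  rewrite -[leLHS](ger0_norm Se0) -sqrtr_sqr ler_wsqrtr//.
  rewrite (@le_trans _ _ m%:R) ?ler_nat// ltW//.
  by have := archi_boundP (sqr_ge0 (S / e)).
have := ler_normD (F 0 0 0 - s m m m) (s m m m); rewrite subrK.
by move/le_trans; apply; rewrite lerD// (le_trans (small m)).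
Qed.
End ThreeDim.

End Averages.

(** * Dirichlet energy on the lattice and pointwise bounds by the energy *)

Section Energy.
Context {R : realType} {d : nat}.
Implicit Types (L : {fset site d}) (f g phi u : site d -> R) (x y z : site d) (i j k : 'I_d).

Definition edge_sites L i : {fset site d} := (L `|` [fset (y - unitv i)%R | y in L])%fset.

Definition bilin L f g : R :=
  (4 * d)%:R^-1 * \sum_(i < d) \sum_(x <- edge_sites L i)
    (f x - f (x + unitv i)) * (g x - g (x + unitv i)).

Definition dir_energy L f i : R :=
  \sum_(x <- edge_sites L i) (f x - f (x + unitv i)) ^+ 2.

Lemma hamiltonian_bilin L f : hamiltonian L f = bilin L f f.
Proof.
by congr (_ * _); apply: eq_bigr => i _; apply: eq_bigr => x _; rewrite expr2.
Qed.

Lemma hamiltonian_dir L f : hamiltonian L f = (4 * d)%:R^-1 * \sum_(i < d) dir_energy L f i.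
Proof. by []. Qed.

Lemma dir_energy_ge0 L f i : 0 <= dir_energy L f i.
Proof. by apply: sumr_ge0 => x _; exact: sqr_ge0. Qed.

Lemma hamiltonian_ge0 L f : 0 <= hamiltonian L f.
Proof.
by rewrite hamiltonian_dir mulr_ge0 ?invr_ge0// sumr_ge0// => i _; exact: dir_energy_ge0.
Qed.

Lemma bilinC L f g : bilin L f g = bilin L g f.
Proof.
by congr (_ * _); apply: eq_bigr => i _; apply: eq_bigr => x _; rewrite mulrC.
Qed.

Lemma bilinDr L f g g' : bilin L f (fun x => g x + g' x) = bilin L f g + bilin L f g'.
Proof.
rewrite /bilin -mulrDr -big_split/=; congr (_ * _); apply: eq_bigr => i _.
by rewrite -big_split/=; apply: eq_bigr => x _; ring.
Qed.

Lemma bilinZr L f g (c : R) : bilin L f (fun x => c * g x) = c * bilin L f g.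
Proof.
rewrite /bilin mulrCA; congr (_ * _); rewrite mulr_sumr; apply: eq_bigr => i _.
by rewrite mulr_sumr; apply: eq_bigr => x _; ring.
Qed.

Lemma bilin_sumr L f (s : seq (site d)) (c : site d -> R) (g : site d -> site d -> R) :
  bilin L f (fun x => \sum_(z <- s) c z * g z x) = \sum_(z <- s) c z * bilin L f (g z).
Proof.
elim: s => [|z s IH].
  rewrite big_nil /bilin big1 ?mulr0// => i _; rewrite big1// => x _.
  by rewrite !big_nil subrr mulr0.
rewrite big_cons -IH -bilinZr -bilinDr; congr (bilin L f _); apply/funext => x.
by rewrite big_cons.
Qed.

Lemma hamiltonianD L phi u (t : R) :
  hamiltonian L (fun x => phi x + t * u x) =
  hamiltonian L phi + 2 * t * bilin L u phi + t ^+ 2 * hamiltonian L u.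
Proof.
rewrite !hamiltonian_bilin bilinDr bilinZr bilinC bilinDr bilinZr.
rewrite [bilin L (fun x => phi x + t * u x) u]bilinC bilinDr bilinZr.
by rewrite [bilin L phi u]bilinC; ring.
Qed.

Lemma edge_sitesP L f i x : (forall x, x \notin L -> f x = 0) ->
  x \notin edge_sites L i -> f x = 0 /\ f (x + unitv i) = 0.
Proof.
move=> f0; rewrite inE negb_or => /andP[xL xL']; split; first exact: f0.
apply: f0; apply: contra xL' => xL'; apply/imfsetP; exists (x + unitv i) => //=.
by rewrite addrK.
Qed.

Lemma sum_injective_le (I : finType) (S : {fset site d}) (p : I -> site d) (g : site d -> R) :
  injective p -> (forall x, 0 <= g x) -> (forall x, x \notin S -> g x = 0) ->
  \sum_(a : I) g (p a) <= \sum_(x <- S) g x.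
Proof.
move=> pinj g0 goff.
have -> : \sum_(a : I) g (p a) = \sum_(x <- [seq p a | a <- index_enum I]) g x.
  by rewrite big_map.
have up : uniq [seq p a | a <- index_enum I] by rewrite map_inj_uniq// index_enum_uniq.
set s := map _ _ in up *.
rewrite [leLHS](bigID (fun x => x \in S))/= [X in _ + X]big1 ?addr0//.
rewrite [leRHS](bigID (fun x => x \in s))/=.
rewrite -big_filter -[X in _ <= X + _]big_filter.
have pe : perm_eq [seq x <- s | x \in S] [seq x <- S | x \in s].
  apply: uniq_perm; rewrite ?filter_uniq ?fset_uniq// => x.
  by rewrite !mem_filter andbC.
by rewrite (perm_big _ pe)/= lerDl sumr_ge0.
Qed.

Lemma unitvE i j (n : nat) : (unitv i *+ n) ord0 j = (n * (i == j))%:Z.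
Proof.
rewrite mulmxnE mxE eqxx/= eq_sym; case: eqVneq => _; rewrite ?muln1 ?muln0 ?mul0rn//.
by rewrite pmulrn mulrzz mul1r.
Qed.

Definition plane i j x (p q : nat) : site d := x + unitv i *+ p + unitv j *+ q.
Definition space i j k x (p q r : nat) : site d := plane i j x p q + unitv k *+ r.

Lemma planeS1 i j x p q : plane i j x p.+1 q = plane i j x p q + unitv i.
Proof. by rewrite /plane mulrSr addrA [RHS]addrAC. Qed.

Lemma planeS2 i j x p q : plane i j x p q.+1 = plane i j x p q + unitv j.
Proof. by rewrite /plane mulrSr addrA. Qed.

Lemma spaceS1 i j k x p q r : space i j k x p.+1 q r = space i j k x p q r + unitv i.
Proof. by rewrite /space planeS1 addrAC. Qed.

Lemma spaceS2 i j k x p q r : space i j k x p q.+1 r = space i j k x p q r + unitv j.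
Proof. by rewrite /space planeS2 addrAC. Qed.

Lemma spaceS3 i j k x p q r : space i j k x p q r.+1 = space i j k x p q r + unitv k.
Proof. by rewrite /space mulrSr addrA. Qed.

Lemma plane_inj i j x p q p' q' : i != j ->
  plane i j x p q = plane i j x p' q' -> p = p' /\ q = q'.
Proof.
move=> ij; rewrite /plane -!addrA => /addrI h; split.
  by move/(congr1 (fun v : site d => v ord0 i)): h; rewrite !mxE !unitvE eqxx eq_sym (negbTE ij); lia.
by move/(congr1 (fun v : site d => v ord0 j)): h; rewrite !mxE !unitvE eqxx (negbTE ij); lia.
Qed.

Lemma space_inj i j k x p q r p' q' r' : i != j -> i != k -> j != k ->
  space i j k x p q r = space i j k x p' q' r' -> [/\ p = p', q = q' & r = r'].
Proof.
move=> ij ik jk; rewrite /space /plane -!addrA => /addrI h; split.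
- move/(congr1 (fun v : site d => v ord0 i)): h; rewrite !mxE !unitvE eqxx.
  by rewrite [j == i]eq_sym [k == i]eq_sym (negbTE ij) (negbTE ik); lia.
- move/(congr1 (fun v : site d => v ord0 j)): h; rewrite !mxE !unitvE eqxx.
  by rewrite [k == j]eq_sym (negbTE ij) (negbTE jk); lia.
- move/(congr1 (fun v : site d => v ord0 k)): h; rewrite !mxE !unitvE eqxx.
  by rewrite (negbTE ik) (negbTE jk); lia.
Qed.

Lemma grid2_le i j x p q m n (S : {fset site d}) (g : site d -> R) : i != j ->
  (forall x, 0 <= g x) -> (forall x, x \notin S -> g x = 0) ->
  \sum_(a < m) \sum_(b < n) g (plane i j x (p + a) (q + b)) <= \sum_(x <- S) g x.
Proof.
move=> ij g0 goff; rewrite pair_big/=.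
pose P (ab : 'I_m * 'I_n) := plane i j x (p + ab.1) (q + ab.2).
apply: (@sum_injective_le _ S P g) => // -[a b] [a' b'] /(plane_inj ij)[/= h1 h2].
by congr (_, _); apply: val_inj => /=; lia.
Qed.

Lemma grid3_le i j k x m n l (S : {fset site d}) (g : site d -> R) :
  i != j -> i != k -> j != k ->
  (forall x, 0 <= g x) -> (forall x, x \notin S -> g x = 0) ->
  \sum_(a < m) \sum_(b < n) \sum_(c < l) g (space i j k x a b c) <= \sum_(x <- S) g x.
Proof.
move=> ij ik jk g0 goff.
under eq_bigr do rewrite pair_big/=.
rewrite pair_big/=.
pose P (ab : 'I_m * ('I_n * 'I_l)) := space i j k x ab.1 ab.2.1 ab.2.2.
apply: (@sum_injective_le _ S P g) => // -[a [b c]] [a' [b' c']].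
move=> /(space_inj ij ik jk)[/= h1 h2 h3].
by congr (_, (_, _)); exact: val_inj.
Qed.

Lemma planar_oscillation_site L f i j x n p q p' q' (b : R) :
  i != j -> (forall x, x \notin L -> f x = 0) -> 0 <= b ->
  dir_energy L f i <= b ^+ 2 -> dir_energy L f j <= b ^+ 2 ->
  (p <= n)%N -> (q <= n)%N -> (p' <= n)%N -> (q' <= n)%N ->
  `|f (plane i j x p q) - f (plane i j x p' q')| <= (harm n + 1) *+ 4 * b.
Proof.
move=> ij f0 b0 Ei Ej pn qn pn' qn'.
apply: (@planar_oscillation R (fun p q => f (plane i j x p q))) => // {pn}p {qn}q m l.
- apply: le_trans Ei.
  apply: le_trans (grid2_le x p q m l ij (S := edge_sites L i)
     (g := fun x => (f x - f (x + unitv i)) ^+ 2) _ _).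
  + apply: ler_sum => a _; apply: ler_sum => c _.
    by rewrite planeS1.
  + by move=> y; exact: sqr_ge0.
  + by move=> y /(edge_sitesP f0)[-> ->]; rewrite subrr expr0n.
- apply: le_trans Ej.
  apply: le_trans (grid2_le x p q m l ij (S := edge_sites L j)
     (g := fun x => (f x - f (x + unitv j)) ^+ 2) _ _).
  + apply: ler_sum => a _; apply: ler_sum => c _.
    by rewrite planeS2.
  + by move=> y; exact: sqr_ge0.
  + by move=> y /(edge_sitesP f0)[-> ->]; rewrite subrr expr0n.
Qed.

Lemma spatial_bound_site L f i j k x (b : R) :
  i != j -> i != k -> j != k -> (forall x, x \notin L -> f x = 0) -> 0 <= b ->
  dir_energy L f i <= b ^+ 2 -> dir_energy L f j <= b ^+ 2 -> dir_energy L f k <= b ^+ 2 ->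
  `|f x| <= 12 * b.
Proof.
move=> ij ik jk f0 b0 Ei Ej Ek.
have off l y : y \notin edge_sites L l -> (f y - f (y + unitv l)) ^+ 2 = 0.
  by move=> /(edge_sitesP f0)[-> ->]; rewrite subrr expr0n.
have -> : x = space i j k x 0 0 0 by rewrite /space /plane !mulr0n !addr0.
pose S2 := \sum_(y <- L) f y ^+ 2.
have S20 : 0 <= S2 by apply: sumr_ge0 => y _; exact: sqr_ge0.
apply: (@spatial_bound R (fun p q r => f (space i j k x p q r)) b (Num.sqrt S2)) => //.
- move=> m n l; apply: le_trans Ei.
  apply: le_trans (grid3_le x m n l ij ik jk (S := edge_sites L i)
     (g := fun x => (f x - f (x + unitv i)) ^+ 2) _ _) => //; last exact: off.
    do 3 (apply: ler_sum => ? _).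
    by rewrite spaceS1.
  by move=> y; exact: sqr_ge0.
- move=> m n l; apply: le_trans Ej.
  apply: le_trans (grid3_le x m n l ij ik jk (S := edge_sites L j)
     (g := fun x => (f x - f (x + unitv j)) ^+ 2) _ _) => //; last exact: off.
    do 3 (apply: ler_sum => ? _).
    by rewrite spaceS2.
  by move=> y; exact: sqr_ge0.
- move=> m n l; apply: le_trans Ek.
  apply: le_trans (grid3_le x m n l ij ik jk (S := edge_sites L k)
     (g := fun x => (f x - f (x + unitv k)) ^+ 2) _ _) => //; last exact: off.
    do 3 (apply: ler_sum => ? _).
    by rewrite spaceS3.
  by move=> y; exact: sqr_ge0.
- move=> m n l; rewrite sqr_sqrtr//.
  apply: (grid3_le x m n l ij ik jk (S := L) (g := fun x => f x ^+ 2)).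
    by move=> y; exact: sqr_ge0.
  by move=> y yL; rewrite f0// expr0n.
Qed.

(** Summing over the d cyclic triples of consecutive directions keeps the constant independent of d,
    which a single triple would not. Each direction is counted three times, and 1728 = 144 * 3 * 4:
    the factor 4 d of the Hamiltonian loses its d to the number of triples. *)
Lemma spatial_green_bound L f x : (3 <= d)%N -> (forall x, x \notin L -> f x = 0) ->
  f x ^+ 2 <= 1728 * hamiltonian L f.
Proof.
move=> d3 f0; pose E := dir_energy L f.
have E0 i : 0 <= E i by exact: dir_energy_ge0.
have key i : f x ^+ 2 <= 144 * (E i + E (ordS i) + E (ordS (ordS i))).
  pose b := Num.sqrt (E i + E (ordS i) + E (ordS (ordS i))).
  have b0 : 0 <= b by exact: sqrtr_ge0.
  have bE : b ^+ 2 = E i + E (ordS i) + E (ordS (ordS i)).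
    by rewrite sqr_sqrtr// !addr_ge0.
  have := E0 i; have := E0 (ordS i); have := E0 (ordS (ordS i)) => h1 h2 h3.
  have ne (u v : 'I_d) : (u : nat) <> v -> u != v by move=> uv; apply/eqP => /(congr1 val).
  have oS (u : 'I_d) : (ordS u : nat) = if u.+1 == d then 0%N else u.+1.
    rewrite /=; case: eqVneq => [->|ud]; first by rewrite modnn.
    by rewrite modn_small// ltn_neqAle ud ltn_ord.
  have [n1 n2 n3] : [/\ (i : nat) <> ordS i, (i : nat) <> ordS (ordS i) &
      (ordS i : nat) <> ordS (ordS i)].
    have o1 := oS i; have o2 := oS (ordS i); have li := ltn_ord i; move: o1 o2.
    case: (eqVneq i.+1 d) => e1 o1; case: (eqVneq (ordS i).+1 d) => e2 o2;
      rewrite o2; split; lia.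
  have : `|f x| <= 12 * b.
    apply: (@spatial_bound_site L f i (ordS i) (ordS (ordS i))) => //; rewrite ?bE -/(E _).
    - exact: ne.
    - exact: ne.
    - exact: ne.
    - by rewrite -addrA lerDl addr_ge0.
    - by rewrite addrAC lerDr addr_ge0.
    - by rewrite lerDr addr_ge0.
  move=> fb; rewrite -bE -[f x ^+ 2]real_normK ?num_real//.
  apply: (@le_trans _ _ ((12 * b) ^+ 2)); last by rewrite exprMn; lra.
  by apply: lerXn2r; rewrite // nnegrE mulr_ge0.
have dpos : (0 : R) < d%:R by rewrite ltr0n; lia.
have : \sum_(i < d) f x ^+ 2 <= \sum_(i < d) 144 * (E i + E (ordS i) + E (ordS (ordS i))).
  by apply: ler_sum => i _; exact: key.
rewrite sumr_const card_ord -mulr_sumr !big_split/=.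
have shift (h : 'I_d -> R) : \sum_i h (ordS i) = \sum_i h i.
  rewrite [RHS](reindex_inj (@ordS_inj d))//.
rewrite (shift (fun i => E (ordS i))) shift hamiltonian_dir -/E natrM invfM.
set s := \sum_i E i; rewrite -[_ *+ d]mulr_natl => h.
have -> : 1728 * (4^-1 / d%:R * s) = 432 * s / d%:R by field; rewrite gt_eqF.
by rewrite ler_pdivlMr// mulrC; lra.
Qed.

End Energy.

(** A zero of f in the same square turns the bound on the oscillation into one on f. Here 128 = 4^2
    * 8, where 8 = 4 d normalises the Hamiltonian; the logarithm is squared because it already
    bounds |f|. *)
Lemma planar_green_bound {R : realType} (L : {fset site 2}) (f : site 2 -> R) x n p q p' q' :
  (forall x, x \notin L -> f x = 0) ->
  (p <= n)%N -> (q <= n)%N -> (p' <= n)%N -> (q' <= n)%N ->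
  f (plane ord0 ord_max x p' q') = 0 ->
  f (plane ord0 ord_max x p q) ^+ 2 <= 128 * (harm n + 1) ^+ 2 * hamiltonian L f.
Proof.
move=> f0 pn qn pn' qn' fy.
have H0 := hamiltonian_ge0 L f.
pose b := Num.sqrt (8 * hamiltonian L f).
have b0 : 0 <= b by exact: sqrtr_ge0.
have bE : b ^+ 2 = 8 * hamiltonian L f by rewrite sqr_sqrtr// mulr_ge0.
have H2 : b ^+ 2 = dir_energy L f ord0 + dir_energy L f ord_max.
  rewrite bE hamiltonian_dir big_ord_recl big_ord1.
  have -> : lift ord0 ord0 = ord_max :> 'I_2 by exact/val_inj.
  by rewrite -[(4 * 2)%:R]/(8%:R) mulrA divff ?mul1r.
have E0 := dir_energy_ge0 L f ord0; have E1 := dir_energy_ge0 L f ord_max.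
have := @planar_oscillation_site R 2 L f ord0 ord_max x n p q p' q' b isT f0 b0.
rewrite H2 lerDl lerDr fy subr0 => /(_ E1 E0 pn qn pn' qn') h.
rewrite -[f _ ^+ 2]real_normK ?num_real//.
have h1 : 0 <= harm n + 1 :> R by rewrite addr_ge0// harm_ge0.
apply: (@le_trans _ _ (((harm n + 1) *+ 4 * b) ^+ 2)).
  by rewrite lerXn2r// nnegrE mulr_ge0// mulrn_wge0.
by rewrite exprMn bE; lra.
Qed.

(** * Discrete harmonic functions and the harmonic potential of a site *)

Section Harmonic.
Context {R : realType} {d : nat}.
Implicit Types (L : {fset site d}) (f g phi u : site d -> R) (x y z : site d) (i : 'I_d).

Definition supported L f := forall x, x \notin L -> f x = 0.

(** For z in L, [bilin L u (delta z)] is minus the discrete Laplacian of u at z, up to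
    normalisation. Its vanishing is the form in which harmonicity at z is used. *)
Definition delta z : site d -> R := fun x => (x == z)%:R.

Lemma delta_supported L z : z \in L -> supported L (delta z).
Proof. by move=> zL x; rewrite /delta; case: eqVneq => // ->; rewrite zL. Qed.

Lemma delta_sum L f : supported L f -> f = fun x => \sum_(z <- L) f z * delta z x.
Proof.
move=> f0; apply/funext => x; have [xL|xL] := boolP (x \in L).
  rewrite (big_fsetD1 x)//= /delta eqxx mulr1 big1_seq ?addr0// => z.
  rewrite /= in_fsetD1 => /andP[zx _]; by rewrite eq_sym (negbTE zx) mulr0.
rewrite f0// big1_seq// => z /= zL; rewrite /delta; case: eqVneq => [xz|]; last by rewrite mulr0.
by rewrite xz zL in xL.
Qed.

Lemma bilin_delta L u f : supported L f ->
  bilin L u f = \sum_(z <- L) f z * bilin L u (delta z).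
Proof. by move=> f0; rewrite {1}(delta_sum f0) bilin_sumr. Qed.

(** A lattice ray from x leaves L within |L| steps, and Cauchy-Schwarz along the ray bounds f x. The
    dependence on the volume is harmless: the inequality serves definiteness of the energy and
    integrability of the Gibbs weight. *)
Lemma poincare L f x : (0 < d)%N -> supported L f ->
  f x ^+ 2 <= (#|` L| * (4 * d))%:R * hamiltonian L f.
Proof.
move=> d0 f0; pose i := Ordinal d0.
pose p m := x + unitv i *+ m.
have pinj : injective p.
  by move=> m n /addrI /(congr1 (fun v : site d => v ord0 i)); rewrite !unitvE eqxx; lia.
have [m mL pm] : exists2 m, (m <= #|` L|)%N & p m \notin L.
  apply: contrapT => h.
  have sub : {subset [seq p m | m <- iota 0 #|` L|.+1] <= L}.
    move=> _ /mapP[m + ->]; rewrite mem_iota add0n ltnS => /andP[_ mL].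
    by apply/negPn/negP => pm; apply: h; exists m.
  have /uniq_leq_size/(_ sub) : uniq [seq p m | m <- iota 0 #|` L|.+1].
    by rewrite map_inj_uniq// iota_uniq.
  by rewrite size_map size_iota ltnn.
have E : \sum_(k < m) (f (p k) - f (p k.+1)) ^+ 2 <= (4 * d)%:R * hamiltonian L f.
  rewrite hamiltonian_dir mulVKf; last by rewrite pnatr_eq0 -lt0n muln_gt0.
  rewrite (bigD1 i)//=.
  apply: (@le_trans _ _ (dir_energy L f i)); last first.
    by rewrite lerDl sumr_ge0// => k _; exact: dir_energy_ge0.
  apply: le_trans (sum_injective_le (S := edge_sites L i)
    (p := fun k : 'I_m => p k) (g := fun y => (f y - f (y + unitv i)) ^+ 2) _ _ _).
  - by apply: ler_sum => k _; rewrite /p mulrSr addrA.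
  - by move=> k l /pinj; exact: val_inj.
  - by move=> y; exact: sqr_ge0.
  - by move=> y /(edge_sitesP f0)[-> ->]; rewrite subrr expr0n.
have fx : f x = \sum_(k < m) (f (p k) - f (p k.+1)).
  rewrite -(big_mkord predT (fun k => f (p k) - f (p k.+1))).
  rewrite (telescope_sumr_eq (fun k => - f (p k)))// => [|k _].
    by rewrite (f0 (p m))// /p mulr0n addr0 oppr0 opprK add0r.
  by rewrite opprK addrC.
case: m mL pm E fx => [|m] mL pm E fx.
  by rewrite fx big_ord0 expr0n mulr_ge0// hamiltonian_ge0.
have -> : f x = m.+1%:R * avg m (fun k => f (p k) - f (p k.+1)).
  by rewrite fx /avg mulVKf// pnatr_eq0.
rewrite exprMn (@le_trans _ _ (m.+1%:R ^+ 2 * avg m (fun k => (f (p k) - f (p k.+1)) ^+ 2)))//.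
  by rewrite ler_wpM2l ?sqr_ge0// sqr_avg_le.
rewrite /avg expr2 -mulrA mulVKf ?pnatr_eq0// natrM -mulrA ler_pM// ?ler_nat//.
by apply: sumr_ge0 => k _; exact: sqr_ge0.
Qed.

Lemma hamiltonian_eq0 L f : (0 < d)%N -> supported L f -> hamiltonian L f <= 0 ->
  forall x, f x = 0.
Proof.
move=> d0 f0 H0 x; have H : hamiltonian L f = 0 by apply/le_anti; rewrite H0 hamiltonian_ge0.
have := poincare x d0 f0; rewrite H mulr0 => h.
by apply/eqP; rewrite -sqrf_eq0 eq_le h sqr_ge0.
Qed.

(** Summation by parts: where u is harmonic, the values of the other function do not contribute. *)
Lemma bilin_eq_on L u f f' (U : seq (site d)) :
  supported L f -> supported L f' -> (forall z, z \in U -> bilin L u (delta z) = 0) ->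
  (forall z, z \notin U -> f z = f' z) -> bilin L u f = bilin L u f'.
Proof.
move=> f0 f'0 harm ff'; rewrite (bilin_delta _ f0) (bilin_delta _ f'0).
apply: eq_bigr => z _; have [zU|zU] := boolP (z \in U); first by rewrite harm ?mulr0.
by rewrite ff'.
Qed.

(** Induction on U instead of solving a linear system. The function u0, harmonic on U, is corrected
    at the new site z by a multiple of the extension e of [delta z], which is harmonic on U as well.
    The multiplier exists because [bilin L e (delta z)] is the energy of e, nonzero by
    [hamiltonian_eq0]. *)
Lemma harmonic_extension L (U : seq (site d)) g : (0 < d)%N -> {subset U <= L} ->
  supported L g ->
  exists2 u, (forall x, x \notin U -> u x = g x) &
    forall z, z \in U -> bilin L u (delta z) = 0.
Proof.
move=> d0; elim: U g => [|z U IH] g UL g0; first by exists g.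
have UL' : {subset U <= L} by move=> y yU; apply: UL; rewrite inE yU orbT.
have zL : z \in L by apply: UL; rewrite inE eqxx.
have ext_supp h v : supported L h -> (forall x, x \notin U -> v x = h x) -> supported L v.
  move=> h0 vh x xL; rewrite vh; first exact: h0.
  by apply: contra xL; exact: UL'.
have [u0 u0g u0h] := IH g UL' g0; have u00 := ext_supp _ _ g0 u0g.
have [zU|zU] := boolP (z \in U).
  exists u0 => [x|x]; first by rewrite inE negb_or => /andP[_]; exact: u0g.
  by rewrite inE => /predU1P[->|]; exact: u0h.
have [e ed eh] := IH (delta z) UL' (delta_supported zL).
have e0 := ext_supp _ _ (delta_supported zL) ed.
have eE : bilin L e (delta z) = hamiltonian L e.
  rewrite hamiltonian_bilin; apply: (bilin_eq_on (U := U) (delta_supported zL) e0 eh).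
  by move=> y yU; rewrite ed.
have He : hamiltonian L e != 0.
  apply/eqP => H; have := hamiltonian_eq0 d0 e0; rewrite H => /(_ (lexx _) z).
  by rewrite ed// /delta eqxx; apply/eqP; exact: oner_neq0.
pose s := - bilin L u0 (delta z) / hamiltonian L e.
exists (fun x => u0 x + s * e x) => [x|x].
  rewrite inE negb_or => /andP[xz xU].
  by rewrite u0g// ed// /delta (negbTE xz) mulr0 addr0.
rewrite bilinC bilinDr bilinZr ![bilin L (delta _) _]bilinC inE => /predU1P[->|xU].
  by rewrite eE /s divfK// addrN.
by rewrite u0h// eh// mulr0 addr0.
Qed.

Lemma bilin_sign L f g : (forall x y, (f x - f y) * (g x - g y) <= 0) -> bilin L f g <= 0.
Proof.
move=> fg; rewrite mulr_ge0_le0 ?invr_ge0//.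
by apply: sumr_le0 => i _; apply: sumr_le0 => x _; exact: fg.
Qed.

(** At most 2 d edges contribute, each with energy 1, against the factor 1 / (4 d). *)
Lemma delta_energy L z : (0 < d)%N -> hamiltonian L (delta z) <= 2^-1.
Proof.
move=> d0; rewrite hamiltonian_dir ler_pdivrMl ?ltr0n ?muln_gt0//.
have -> : (4 * d)%:R * 2^-1 = \sum_(i < d) 2 :> R.
  by rewrite sumr_const card_ord -[2 *+ d]mulr_natl natrM; field.
apply: ler_sum => i _; rewrite /dir_energy.
apply: (@le_trans _ _ (\sum_(x <- edge_sites L i) (delta z x + delta (z - unitv i) x))).
  apply: ler_sum => x _; rewrite /delta -(can2_eq (addrK _) (subrK _)).
  by case: (x == z); case: (_ == z) => /=; lra.
have one (S : {fset site d}) y : \sum_(x <- S) delta y x <= 1.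
  have [yS|yS] := boolP (y \in S).
    rewrite (big_fsetD1 y)//= big1_seq ?addr0 /delta ?eqxx// => x.
    by rewrite /= in_fsetD1 => /andP[/negbTE->].
  rewrite big1_seq// => x /= xS; rewrite /delta; case: eqVneq => // xy.
  by rewrite -xy xS in yS.
by rewrite big_split/= lerD.
Qed.

(* [h] is the effective conductance between [x] and the sites of [T] together
   with the complement of [L]; under the Gaussian measure with the values on [T]
   frozen, phi x has variance 1 / (2 h). *)
Lemma harmonic_potential L (T : {pred site d}) x (a V : R) : (0 < d)%N ->
  x \in L -> x \notin T -> 0 <= a -> 0 < V ->
  (forall f, supported L f -> (forall z, z \in T -> f z = 0) ->
    f x ^+ 2 <= V * hamiltonian L f) ->
  exists u h, [/\ supported L u, forall z, z \in T -> u z = 0, u x = 1,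
    V^-1 <= h <= 2^-1 & hamiltonian L u = h /\
    forall phi, supported L phi -> (forall z, z \in T -> `|phi z| <= a) ->
      `|bilin L u phi - h * phi x| <= a * h].
Proof.
move=> d0 xL xT a0 V0 HV.
pose U := [seq z <- enum_fset L | (z \notin T) && (z != x)].
have memU z : (z \in U) = [&& z \in L, z \notin T & z != x].
  by rewrite mem_filter andbC.
have UL : {subset U <= L} by move=> z; rewrite memU => /andP[].
have [u uE uU] := harmonic_extension d0 UL (delta_supported xL).
have xU : x \notin U by rewrite memU eqxx !andbF.
have u1 : u x = 1 by rewrite uE// /delta eqxx.
have u0 : supported L u.
  move=> z zL; rewrite uE ?(delta_supported xL)//.
  by apply: contra zL; exact: UL.
have uT z : z \in T -> u z = 0.
  move=> zT; rewrite uE ?memU ?zT ?andbF// /delta; case: eqVneq => // zx.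
  by rewrite -zx zT in xT.
(* Maximum principle: the negative part v of u vanishes off U, so its pairing with u is 0; the sign
   of the increments then forces the energy of v to vanish. *)
have u_ge0 z : 0 <= u z.
  pose v y := Num.max (- u y) 0.
  have v0 y : y \notin U -> v y = 0.
    move=> yU; rewrite /v uE// /delta; case: eqVneq => _; last by rewrite oppr0 maxxx.
    by apply/max_idPr; rewrite oppr_le0.
  have vL : supported L v by move=> y yL; apply: v0; apply: contra yL; exact: UL.
  have : bilin L u v = 0.
    rewrite (bilin_eq_on (U := U) (f' := fun=> 0) vL _ uU)//.
    by rewrite (bilin_delta u (f := fun=> 0))// big1// => y _; rewrite mul0r.
  have le y y' : (u y - u y') * (v y - v y') + (v y - v y') * (v y - v y') <= 0.
    by rewrite /v; case: (lerP (- u y) 0) => h1; case: (lerP (- u y') 0) => h2; nra.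
  have : bilin L v (fun y => u y + v y) <= 0.
    by apply: bilin_sign => y y'; have := le y y'; lra.
  rewrite bilinDr [bilin L v u]bilinC => + uv; rewrite uv add0r -hamiltonian_bilin.
  move=> /(hamiltonian_eq0 d0 vL)/(_ z) vz.
  have : - u z <= v z by rewrite /v le_max lexx.
  by rewrite vz oppr_le0.
pose h := bilin L u (delta x).
have Hu : hamiltonian L u = h.
  by rewrite hamiltonian_bilin; apply: (bilin_eq_on (U := U) u0 (delta_supported xL) uU).
(* The function delta x - u has energy H(delta x) - h, which is nonnegative. *)
have h_ub : h <= 2^-1.
  have := hamiltonian_ge0 L (fun y => delta x y + (-1) * u y).
  by rewrite hamiltonianD Hu -/h; have := delta_energy L x d0; lra.
have h_lb : V^-1 <= h.
  have := HV u u0 uT; rewrite u1 expr1n Hu => h1.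
  by rewrite -[V^-1]mul1r ler_pdivrMr// mulrC.
have beta_le0 z : z \in T -> bilin L u (delta z) <= 0.
  move=> zT; apply: bilin_sign => y y'; rewrite /delta.
  have := u_ge0 y; have := u_ge0 y'; have := uT z zT.
  by case: (eqVneq y z) => [->|_]; case: (eqVneq y' z) => [->|_] /=; nra.
have split_sum phi : supported L phi -> bilin L u phi =
    h * phi x + \sum_(z <- L | z \in T) phi z * bilin L u (delta z).
  move=> phi0; rewrite (bilin_delta _ phi0) (bigID (mem T))/= addrC; congr (_ + _).
  rewrite -big_filter (bigD1_seq x)/= ?filter_uniq ?fset_uniq ?mem_filter ?xT//.
  rewrite big1_seq ?addr0 1?mulrC// => z; rewrite mem_filter => /and3P[zx zT zL].
  by rewrite uU ?mulr0// memU zL zT zx.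
(* Testing u against the indicator of L: the current entering T is at most the current h leaving x,
   the remainder escaping from L. *)
have mass : - \sum_(z <- L | z \in T) bilin L u (delta z) <= h.
  pose one y : R := (y \in L)%:R.
  have one0 : supported L one by move=> y /negbTE yL; rewrite /one yL.
  have : bilin L u (fun y => (-1) * one y) <= 0.
    apply: bilin_sign => y y'; rewrite /one.
    have := u_ge0 y; have := u_ge0 y'.
    have [yL|/u0->] := boolP (y \in L); have [y'L|/u0->] := boolP (y' \in L) => /=; lra.
  rewrite bilinZr (split_sum _ one0) {1}/one xL mulr1.
  have -> : \sum_(z <- L | z \in T) one z * bilin L u (delta z) =
      \sum_(z <- L | z \in T) bilin L u (delta z).
    rewrite big_seq_cond [RHS]big_seq_cond; apply: eq_bigr => z /andP[zL _].
    by rewrite /one zL mul1r.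
  by rewrite mulN1r oppr_le0; lra.
exists u, h; split => //; first by rewrite h_lb.
split=> // phi phi0 phia.
rewrite (split_sum _ phi0) addrAC subrr add0r.
apply: (le_trans (ler_norm_sum _ _ _)).
apply: (@le_trans _ _ (\sum_(z <- L | z \in T) a * - bilin L u (delta z))).
  apply: ler_sum => z zT; rewrite normrM (ler0_norm (beta_le0 _ zT)).
  by rewrite ler_wpM2r ?oppr_ge0 ?beta_le0// phia.
by rewrite -mulr_sumr sumrN ler_wpM2l.
Qed.

End Harmonic.

(** * Iterated Lebesgue integrals over fields *)

Section FieldIntegral.
Context {R : realType} {d : nat}.
Implicit Types (phi psi u : site d -> R) (s : seq (site d)).
Local Notation mu := (@lebesgue_measure R).

Lemma updE phi x t y : upd phi x t y = if y == x then t else phi y.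
Proof. by []. Qed.

(** No sigma-algebra is put on the space of fields. Measurability is required along every measurable
    family of fields, a form that is stable under integrating out one coordinate. The real parameter
    is the additional variable of [field_integral_tonelli]. *)
Definition jointly_measurable (F : R -> (site d -> R) -> \bar R) :=
  forall (disp : measure_display) (W : measurableType disp) (p : W -> R)
    (g : W -> site d -> R),
    measurable_fun setT p -> (forall x, measurable_fun setT (g ^~ x)) ->
    measurable_fun setT (fun w => F (p w) (g w)).

Definition field_measurable (F : (site d -> R) -> \bar R) :=
  jointly_measurable (fun=> F).

Lemma jointly_measurable_field_integral s (F : R -> (site d -> R) -> \bar R) :
  jointly_measurable F -> (forall t phi, 0 <= F t phi)%E ->
  jointly_measurable (fun t => field_integral s (F t)).
Proof.
move=> mF F0; elim: s => [|x s IH] //= disp W p g mp mg.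
pose f (z : W * measurableTypeR R) := field_integral s (F (p z.1)) (upd (g z.1) x z.2).
have mf : measurable_fun setT f.
  apply: (IH _ _ (fun z : W * measurableTypeR R => p z.1)
    (fun z : W * measurableTypeR R => upd (g z.1) x z.2)).
    exact: (measurableT_comp mp).
  move=> y; rewrite /upd; case: (y == x); first exact: measurable_snd.
  exact: (measurableT_comp (mg y) (@measurable_fst _ _ W (measurableTypeR R))).
have f0 z : (0 <= f z)%E.
  rewrite /f; elim: (s) (upd _ _ _) => [|y s' IHs] phi //=.
  by apply: integral_ge0 => t _; exact: IHs.
exact: (@measurable_fun_fubini_tonelli_F _ _ _ _ _ mu f mf f0).
Qed.

Lemma field_integral_ge0 s (F : (site d -> R) -> \bar R) phi :
  (forall phi, 0 <= F phi)%E -> (0 <= field_integral s F phi)%E.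
Proof.
move=> F0; elim: s phi => [|y s IH] phi //=.
by apply: integral_ge0 => t _; exact: IH.
Qed.

Lemma field_measurable_upd s (F : (site d -> R) -> \bar R) phi x :
  field_measurable F -> (forall phi, 0 <= F phi)%E ->
  measurable_fun (setT : set (measurableTypeR R))
    (fun t => field_integral s F (upd phi x t)).
Proof.
move=> mF F0.
apply: (@jointly_measurable_field_integral s (fun=> F) mF (fun=> F0) _
  (measurableTypeR R) (fun=> 0) (fun t => upd phi x t)) => //.
by move=> y; rewrite /upd; case: (y == x).
Qed.

(** The comparison is asked only for fields that agree with phi off s, so that zero boundary
    conditions can be used to prove it. *)
Lemma le_field_integral s (F G : (site d -> R) -> \bar R) phi :
  field_measurable F -> field_measurable G ->
  (forall phi, 0 <= F phi)%E ->
  (forall psi, (forall x, x \notin s -> psi x = phi x) -> F psi <= G psi)%E ->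
  (forall phi, 0 <= G phi)%E ->
  (field_integral s F phi <= field_integral s G phi)%E.
Proof.
move=> mF mG F0 + G0; elim: s phi => [|x s IH] phi FG /=.
  by apply: FG.
apply: ge0_le_integral => //.
- by move=> t _; exact: field_integral_ge0.
- exact: field_measurable_upd.
- exact: field_measurable_upd.
- move=> t _; apply: IH => psi psiE; apply: FG => y.
  by rewrite inE negb_or => /andP[yx ys]; rewrite psiE// /upd (negbTE yx).
Qed.

Lemma eq_field_integral s (F G : (site d -> R) -> \bar R) phi :
  (forall psi, (forall x, x \notin s -> psi x = phi x) -> F psi = G psi)%E ->
  field_integral s F phi = field_integral s G phi.
Proof.
elim: s phi => [|x s IH] phi FG /=; first by apply: FG.
apply: eq_integral => t _; apply: IH => psi psiE; apply: FG => y.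
by rewrite inE negb_or => /andP[yx ys]; rewrite psiE// /upd (negbTE yx).
Qed.

Lemma field_integral_off s (F : (site d -> R) -> \bar R) phi psi :
  (forall x, x \notin s -> phi x = psi x) ->
  field_integral s F phi = field_integral s F psi.
Proof.
elim: s phi psi => [|x s IH] phi psi h /=.
  by congr F; apply/funext => x; exact: h.
apply: eq_integral => t _; apply: IH => y ys; rewrite /upd.
by case: eqVneq => // yx; apply: h; rewrite inE negb_or yx.
Qed.

Lemma field_integralD s (F G : (site d -> R) -> \bar R) phi :
  field_measurable F -> field_measurable G ->
  (forall phi, 0 <= F phi)%E -> (forall phi, 0 <= G phi)%E ->
  (field_integral s (fun psi => F psi + G psi) phi =
   field_integral s F phi + field_integral s G phi)%E.
Proof.
move=> mF mG F0 G0; elim: s phi => [|x s IH] phi //=.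
rewrite -ge0_integralD//.
- by apply: eq_integral => t _; exact: IH.
- by move=> t _; exact: field_integral_ge0.
- exact: field_measurable_upd.
- by move=> t _; exact: field_integral_ge0.
- exact: field_measurable_upd.
Qed.

Lemma field_integralZl s (F : (site d -> R) -> \bar R) (k : \bar R) phi :
  field_measurable F -> (forall phi, 0 <= F phi)%E -> (0 <= k)%E ->
  (field_integral s (fun psi => k * F psi) phi = k * field_integral s F phi)%E.
Proof.
move=> mF F0 k0; elim: s phi => [|x s IH] phi //=.
rewrite -ge0_integralZl//.
- by apply: eq_integral => t _; exact: IH.
- exact: field_measurable_upd.
- by move=> t _; exact: field_integral_ge0.
Qed.

Lemma lebesgue_measure_shift (c : R) (A : set R) : measurable A ->
  pushforward mu ((fun t => t + c) : _ -> measurableTypeR R) A = mu A.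
Proof.
move=> mA; apply/esym.
have mc : measurable_fun setT ((fun t => t + c) : measurableTypeR R -> measurableTypeR R).
  exact: measurable_funD.
apply: lebesgue_measure_unique => //= _ [[a b]] _ <-.
rewrite /pushforward.
have -> : (fun t : measurableTypeR R => (t + c : measurableTypeR R)) @^-1` [set` `]a, b]%R] =
   [set` `]a - c, b - c]%R].
  by apply/seteqP; split => t /=; rewrite !in_itv/= ltrBlDr lerBrDr.
by rewrite !lebesgue_measure_itv/= !lte_fin ltrD2r; case: ifP => // _; rewrite -!EFinB; congr EFin; ring.
Qed.

Lemma ge0_integral_shift (f : R -> \bar R) (c : R) :
  measurable_fun (setT : set (measurableTypeR R)) f -> (forall t, 0 <= f t)%E ->
  (\int[mu]_t f (t + c)%R = \int[mu]_t f t)%E.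
Proof.
move=> mf f0.
have mc : measurable_fun setT ((fun t => t + c) : measurableTypeR R -> measurableTypeR R).
  exact: measurable_funD.
rewrite -[LHS](@ge0_integral_pushforward _ _ (measurableTypeR R) (measurableTypeR R)
  _ (fun t : R => t + c) mc mu setT f)//.
by apply: eq_measure_integral => //= A mA AS; exact/lebesgue_measure_shift.
Qed.

Lemma field_integral_shift s (F : (site d -> R) -> \bar R) u phi :
  field_measurable F -> (forall phi, 0 <= F phi)%E ->
  field_integral s (fun psi => F (fun x => psi x + u x)) phi =
  field_integral s F (fun x => phi x + u x).
Proof.
move=> mF F0; elim: s phi => [|x s IH] phi //=.
under eq_integral do rewrite IH.
rewrite -[RHS](@ge0_integral_shift (fun t => field_integral s F (upd _ x t)) (u x)).
- apply: eq_integral => t _; congr field_integral; apply/funext => y.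
  by rewrite /upd; case: eqVneq => [->|].
- exact: field_measurable_upd.
- by move=> t; exact: field_integral_ge0.
Qed.

Lemma field_integral_tonelli s (F : R -> (site d -> R) -> \bar R) phi :
  jointly_measurable F -> (forall t phi, 0 <= F t phi)%E ->
  (\int[mu]_t field_integral s (F t) phi =
   field_integral s (fun psi => \int[mu]_t F t psi) phi)%E.
Proof.
move=> mF F0; elim: s phi => [|x s IH] phi //=.
pose f (z : measurableTypeR R * measurableTypeR R) :=
  field_integral s (F z.1) (upd phi x z.2).
have mf : measurable_fun setT f.
  apply: (@jointly_measurable_field_integral s F mF F0 _ _
    (fun z : measurableTypeR R * measurableTypeR R => z.1)
    (fun z : measurableTypeR R * measurableTypeR R => upd phi x z.2)).
    exact: measurable_fst.
  by move=> y; rewrite /upd; case: (y == x); first exact: measurable_snd.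
have f0 z : (0 <= f z)%E by exact: field_integral_ge0.
rewrite -[LHS]/(\int[mu]_t \int[mu]_r f (t, r))%E.
rewrite (@fubini_tonelli _ _ _ _ _ mu mu f)//.
by apply: eq_integral => r _; rewrite -IH.
Qed.

Lemma ge0_integral_gt0 (c : R) (f : R -> \bar R) :
  measurable_fun (setT : set (measurableTypeR R)) f -> (forall t, 0 <= f t)%E ->
  (forall t, (c < t)%R -> 0 < f t)%E -> (0 < \int[mu]_t f t)%E.
Proof.
move=> mf f0 fc; rewrite lt0e integral_ge0 ?andbT//.
apply/negP => /eqP int0.
have : (\int[mu]_t `|f t| = 0)%E.
  by rewrite -int0; apply: eq_integral => t _; rewrite gee0_abs.
move=> /(ae_eq_integral_abs mu measurableT mf) [N [mN N0 sN]].
have sub : [set` `[c + 1, c + 2]%R] `<=` N.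
  move=> t /=; rewrite in_itv/= => /andP[ct _]; apply: sN => /= /(_ I) ft0.
  have : c < t by apply: lt_le_trans ct; rewrite ltrDl.
  by move/fc; rewrite ft0 ltxx.
have : (mu [set` `[c + 1, c + 2]%R] <= mu N)%E by apply: le_measure; rewrite ?inE.
have -> : mu [set` `[c + 1, c + 2]%R] = 1%E.
  rewrite lebesgue_measure_itv/= lte_fin ltrD2l ltr1n -EFinB; congr EFin; ring.
by rewrite N0 lee_fin ler10.
Qed.

(** The fields exceeding c on all of s form a set of positive measure. With c = a this is the region
    where no site is pinned. *)
Lemma field_integral_gt0 (c : R) s (F : (site d -> R) -> \bar R) phi :
  field_measurable F -> (forall psi, 0 <= F psi)%E ->
  (forall psi, (forall x, x \in s -> c < psi x) ->
    (forall x, x \notin s -> psi x = phi x) -> (0 < F psi)%E) ->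
  (0 < field_integral s F phi)%E.
Proof.
move=> mF F0; elim: s phi => [|x s IH] phi Fc; first by apply: Fc.
apply: (@ge0_integral_gt0 c).
- exact: field_measurable_upd.
- by move=> t; exact: field_integral_ge0.
- move=> t ct; apply: IH => psi psic psiE; apply: Fc => y.
    rewrite inE => /predU1P[->|]; last exact: psic.
    by have [/psic//|/psiE->] := boolP (x \in s); rewrite updE eqxx.
  by rewrite inE negb_or => /andP[yx ys]; rewrite psiE// updE (negbTE yx).
Qed.

End FieldIntegral.

Lemma gaussian_integral {R : realType} (k : R) : 0 < k ->
  (\int[@lebesgue_measure R]_t (expR (- (k * t ^+ 2)))%:E = (Num.sqrt (pi / k))%:E)%E.
Proof.
move=> k0; pose s := (Num.sqrt (2 * k))^-1.
have s0 : 0 < s by rewrite invr_gt0 sqrtr_gt0 mulr_gt0.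
have s2 : s ^+ 2 = (2 * k)^-1 by rewrite exprVn sqr_sqrtr// mulr_ge0// ltW.
have pE : normal_peak s = (Num.sqrt (pi / k))^-1.
  congr (Num.sqrt _)^-1; rewrite s2; field; exact: lt0r_neq0.
have := integral_normal_pdf (0 : R) s; rewrite (normal_pdfE _ (lt0r_neq0 s0)).
have p0 : 0 < normal_peak s by apply: normal_peak_gt0; exact: lt0r_neq0.
under eq_integral do rewrite EFinM.
rewrite ge0_integralZl//; last 3 first.
- by apply/measurable_EFinP; exact: measurable_normal_fun.
- by move=> t _; rewrite lee_fin normal_fun_ge0.
- by rewrite lee_fin ltW.
have -> : (\int[@lebesgue_measure R]_t (expR (- (k * t ^+ 2)))%:E =
    \int[@lebesgue_measure R]_t (normal_fun 0 s t)%:E)%E.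
  apply: eq_integral => t _; rewrite /normal_fun subr0 s2; congr (expR _)%:E.
  by field; exact: lt0r_neq0.
move=> h; rewrite -[LHS]mul1e -[Num.sqrt _]invrK -pE.
have <- : ((normal_peak s)^-1%:E * (normal_peak s)%:E = 1)%E.
  by rewrite -EFinM mulVf// lt0r_neq0.
by rewrite -muleA h mule1.
Qed.

(** * Gibbs weights of pinned sets and the cost of pinning one more site *)

Section Pinning.
Context {R : realType} {d : nat}.
Variables (a : R) (L : {fset site d}).
Implicit Types (phi u : site d -> R) (A T : {set L}).
Local Notation mu := (@lebesgue_measure R).

Definition slab_ind (t : R) : R := \1_(`[- a, a]) t.

Lemma slab_ind_ge0 t : 0 <= slab_ind t. Proof. by rewrite /slab_ind indicE. Qed.
Lemma slab_ind_le1 t : slab_ind t <= 1. Proof. by rewrite /slab_ind indicE; case: (_ \in _). Qed.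

Lemma measurable_slab_ind : measurable_fun setT slab_ind.
Proof. exact: measurable_indic. Qed.

Definition gibbs (f : L -> R -> R) phi : \bar R :=
  (expR (- hamiltonian L phi) * \prod_(x : L) f x (phi (val x)))%:E.

Definition gibbs_integral f : \bar R := field_integral L (gibbs f) (fun=> 0).

Lemma measurable_hamiltonian disp (W : measurableType disp) (g : W -> site d -> R) :
  (forall x, measurable_fun setT (g ^~ x)) ->
  measurable_fun setT (fun w => hamiltonian L (g w)).
Proof.
move=> mg; apply: measurable_funM => //.
apply: measurable_sum => i; apply: measurable_sum => x.
by apply: measurable_funX; apply: measurable_funB.
Qed.

Lemma gibbs_measurable f : (forall x : L, measurable_fun setT (f x)) -> field_measurable (gibbs f).
Proof.
move=> mf disp W p g mp mg; apply/measurable_EFinP; apply: measurable_funM.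
  apply: measurableT_comp => //; apply: measurableT_comp => //.
  exact: measurable_hamiltonian.
by apply: measurable_prod => x _; exact: (measurableT_comp (mf x) (mg (val x))).
Qed.

Lemma gibbs_ge0 f phi : (forall (x : L) t, 0 <= f x t) -> (0 <= gibbs f phi)%E.
Proof. by move=> f0; rewrite lee_fin mulr_ge0 ?expR_ge0// prodr_ge0. Qed.

Lemma field_integral_prod (s : seq (site d)) (g : R -> R) phi : uniq s ->
  measurable_fun setT g -> (forall t, 0 <= g t) ->
  field_integral s (fun psi => (\prod_(x <- s) g (psi x))%:E) phi =
  ((\int[mu]_t (g t)%:E) ^+ size s)%E.
Proof.
move=> + mg g0; elim: s phi => [|x s IH] phi; first by rewrite /= big_nil.
rewrite cons_uniq => /andP[xs us].
have mp : field_measurable (fun psi => (\prod_(x <- s) g (psi x))%:E).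
  move=> disp W p h mp mh; apply/measurable_EFinP; apply: measurable_prod => y _.
  exact: (measurableT_comp mg (mh y)).
have p0 psi : (0 <= (\prod_(x <- s) g (psi x))%:E)%E by rewrite lee_fin prodr_ge0.
rewrite [field_integral _ _ _]/= [size _]/= expeS -ge0_integralZr//.
- apply: eq_integral => t _; rewrite -(IH (upd phi x t) us).
  rewrite -field_integralZl ?lee_fin//.
  apply: eq_field_integral => psi psiE; rewrite big_cons EFinM.
  by rewrite psiE// updE eqxx.
- exact/measurable_EFinP.
- by move=> t _; rewrite lee_fin.
- by apply: expe_ge0; apply: integral_ge0 => t _; rewrite lee_fin.
Qed.

End Pinning.

Section PinningIntegrals.
Context {R : realType} {d : nat}.
Hypothesis d_gt0 : (0 < d)%N.
Variables (a : R) (L : {fset site d}).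
Hypothesis a_gt0 : 0 < a.
Implicit Types (phi psi u : site d -> R) (A T : {set L}).
Local Notation mu := (@lebesgue_measure R).
Local Notation eta := (slab_ind a).

(** The inequality [poincare], summed over the box, dominates the Gibbs weight by a product of
    one-dimensional Gaussians. *)
Lemma gibbs_integral_fin (f : L -> R -> R) : (forall x, measurable_fun setT (f x)) ->
  (forall x t, 0 <= f x t <= 1) -> (gibbs_integral f < +oo)%E.
Proof.
move=> mf f01.
have f0 x t : 0 <= f x t by case/andP: (f01 x t).
pose K : R := (#|` L| * (4 * d))%:R.
(* Chosen so that [kap] times the sum of the squares is at most the Hamiltonian; the summand 1
   covers the empty box. *)
pose kap : R := (#|` L|%:R * K + 1)^-1.
have K0 : 0 <= K by exact: ler0n.
have kap0 : 0 < kap by rewrite invr_gt0 ltr_wpDl// mulr_ge0.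
pose g (t : R) := expR (- (kap * t ^+ 2)).
have mg : measurable_fun setT g.
  apply: measurableT_comp => //; apply: measurableT_comp => //.
  by apply: measurable_funM => //; exact: measurable_funX.
have mP : field_measurable (fun psi : site d -> R => (\prod_(x <- enum_fset L) g (psi x))%:E).
  move=> disp W p h mp mh; apply/measurable_EFinP; apply: measurable_prod => y _.
  exact: (measurableT_comp mg (mh y)).
apply: (@le_lt_trans _ _ (field_integral (enum_fset L)
   (fun psi => (\prod_(x <- enum_fset L) g (psi x))%:E) (fun=> 0))).
  apply: le_field_integral => //.
  - exact: gibbs_measurable.
  - by move=> psi; exact: gibbs_ge0.
  - move=> psi psi0; rewrite lee_fin.
    have sumE : \sum_(x <- enum_fset L) kap * psi x ^+ 2 <= hamiltonian L psi.
      rewrite -mulr_sumr /kap mulrC ler_pdivrMr; last by rewrite ltr_wpDl// mulr_ge0.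
      have H0 := hamiltonian_ge0 L psi.
      apply: (@le_trans _ _ (\sum_(x <- enum_fset L) K * hamiltonian L psi)).
        by apply: ler_sum => x _; exact: poincare.
      rewrite big_const_seq count_predT iter_addr_0 -[_ *+ _]mulr_natl.
      rewrite mulrDr mulr1 -/(#|` L|); nra.
    rewrite /g -expR_sum sumrN.
    apply: (@le_trans _ _ (expR (- hamiltonian L psi) * 1)).
      apply: ler_wpM2l; first exact: expR_ge0.
      by apply: prodr_ile1 => x _; exact: f01.
    by rewrite mulr1 ler_expR lerN2.
  - by move=> psi; rewrite lee_fin prodr_ge0// => x _; exact: expR_ge0.
rewrite field_integral_prod ?fset_uniq//; last by move=> t; exact: expR_ge0.
rewrite /g gaussian_integral//.
by elim: size => [|n IH]; rewrite ?expe0 ?ltry// expeS lte_mul_pinfty.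
Qed.

Lemma gibbs_integral_ge0 (f : L -> R -> R) : (forall x t, 0 <= f x t) ->
  (0 <= gibbs_integral f)%E.
Proof. by move=> f0; apply: field_integral_ge0 => psi; exact: gibbs_ge0. Qed.

(** [slab A] asks for pinning at least on A, [cell A] for pinning exactly on A. The shift of the
    field estimates the former; the latter gives the coefficients of the expansion of the partition
    function. *)
Definition slab A (x : L) (t : R) : R := if x \in A then eta t else 1.
Definition cell A (x : L) (t : R) : R := if x \in A then eta t else 1 - eta t.

Lemma measurable_slab A x : measurable_fun setT (slab A x).
Proof. by rewrite /slab; case: (x \in A) => //; exact: measurable_slab_ind. Qed.

Lemma measurable_cell A x : measurable_fun setT (cell A x).
Proof.
rewrite /cell; case: (x \in A); first exact: measurable_slab_ind.
by apply: measurable_funB => //; exact: measurable_slab_ind.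
Qed.

Lemma slab_itv A x t : 0 <= slab A x t <= 1.
Proof. by rewrite /slab; case: (x \in A); rewrite ?slab_ind_ge0 ?slab_ind_le1 ?ler01 ?lexx. Qed.

Lemma cell_itv A x t : 0 <= cell A x t <= 1.
Proof.
rewrite /cell; case: (x \in A); rewrite ?slab_ind_ge0 ?slab_ind_le1//.
by rewrite subr_ge0 slab_ind_le1 gerBl slab_ind_ge0.
Qed.

Definition slabZ A : R := fine (gibbs_integral (slab A)).
Definition cellZ A : R := fine (gibbs_integral (cell A)).

Lemma slabZ_fin A : gibbs_integral (slab A) = (slabZ A)%:E.
Proof.
rewrite fineK// ge0_fin_numE.
  by apply: gibbs_integral_fin => x; [exact: measurable_slab|exact: slab_itv].
by apply: gibbs_integral_ge0 => x t; case/andP: (slab_itv A x t).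
Qed.

Lemma cellZ_fin A : gibbs_integral (cell A) = (cellZ A)%:E.
Proof.
rewrite fineK// ge0_fin_numE.
  by apply: gibbs_integral_fin => x; [exact: measurable_cell|exact: cell_itv].
by apply: gibbs_integral_ge0 => x t; case/andP: (cell_itv A x t).
Qed.

Lemma slabZ_ge0 A : 0 <= slabZ A.
Proof.
by rewrite -lee_fin -slabZ_fin; apply: gibbs_integral_ge0 => x t; case/andP: (slab_itv A x t).
Qed.

Lemma cellZ_ge0 A : 0 <= cellZ A.
Proof.
by rewrite -lee_fin -cellZ_fin; apply: gibbs_integral_ge0 => x t; case/andP: (cell_itv A x t).
Qed.

Lemma cellZ0_gt0 : 0 < cellZ finset.set0.
Proof.
rewrite -lte_fin -cellZ_fin; apply: (@field_integral_gt0 _ _ a).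
- by apply: gibbs_measurable => x; exact: measurable_cell.
- by move=> psi; apply: gibbs_ge0 => x t; case/andP: (cell_itv finset.set0 x t).
- move=> psi psia _; rewrite lte_fin mulr_gt0 ?expR_gt0// prodr_gt0// => x _.
  rewrite /cell inE /slab_ind indicE; case: (boolP (_ \in _)); rewrite ?subr0// inE/= in_itv/= => /andP[_].
  by rewrite leNgt psia//; exact: valP.
Qed.

Lemma integral_eta (b : R) : (\int[mu]_t (eta (b - t))%:E = (2 * a)%:E)%E.
Proof.
have -> : (fun t => (eta (b - t))%:E) = (fun t => (\1_(`[b - a, b + a]%classic) t)%:E).
  apply/funext => t; rewrite /slab_ind !indicE; congr (nat_of_bool _)%:R%:E.
  by apply/idP/idP; rewrite !inE/= !in_itv/= => /andP[? ?]; apply/andP; split; lra.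
rewrite integral_indic// setIT /= lebesgue_measure_itv/= lte_fin.
have -> : b - a < b + a by rewrite ltrD2l gtrN.
by rewrite -EFinB; congr EFin; ring.
Qed.

(** Here 2 a is the length of the slab, sqrt (2 pi V) the mass of exp (- t^2 / (2 V)), and exp (- 4
    a^2) pays for values on T and at x that are known only up to a. *)
Definition pin_rate (V : R) : R := 2 * a * expR (- (4 * a ^+ 2)) / Num.sqrt (2 * pi * V).

(* Shifting the field by a multiple of the harmonic potential of [x] moves the
   value at [x] into [-a, a] without changing the values on [T]. *)
Lemma slabZ_insert T (x : L) (V : R) : x \notin T -> 0 < V ->
  (forall f : site d -> R, supported L f -> (forall z : L, z \in T -> f (val z) = 0) ->
    f (val x) ^+ 2 <= V * hamiltonian L f) ->
  pin_rate V * slabZ T <= slabZ (x |: T)%SET.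
Proof.
move=> xT V0 HV.
pose T' : {pred site d} := [pred z | [exists z' : L, (z' \in T) && (val z' == z)]].
have T'P z : (z \in T') = [exists z' : L, (z' \in T) && (val z' == z)] by [].
have valT (z : L) : (val z \in T') = (z \in T).
  rewrite T'P; apply/existsP/idP => [[z' /andP[z'T /eqP/val_inj <-]]//|zT].
  by exists z; rewrite zT eqxx.
have [u [h [u0 uT u1 /andP[h_lb h_ub] [Hu Hm]]]] := @harmonic_potential R d L T' (val x) a V
  d_gt0 (valP x) (etrans (congr1 negb (valT x)) xT) (ltW a_gt0) V0
  (fun f f0 fT => HV f f0 (fun z zT => fT _ (etrans (valT z) zT))).
(* Slices of the weight of T: [F t] requires the value at x to be within a of t, and integrating
   over t returns 2 a times the weight of T. Each slice is shifted back by t u. *)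
pose F (t : R) (phi : site d -> R) : \bar R :=
  (expR (- hamiltonian L phi) * \prod_(z : L) slab T z (phi (val z)) *
   eta (phi (val x) - t))%:E.
have prod_ge0 phi : 0 <= \prod_(z : L) slab T z (phi (val z)).
  by apply: prodr_ge0 => z _; case/andP: (slab_itv T z (phi (val z))).
have F0 t phi : (0 <= F t phi)%E.
  by rewrite lee_fin mulr_ge0 ?slab_ind_ge0// mulr_ge0 ?expR_ge0.
have mF : jointly_measurable F.
  move=> disp W p g mp mg; apply/measurable_EFinP; apply: measurable_funM; last first.
    apply: (measurableT_comp (measurable_slab_ind a)).
    by apply: measurable_funB => //; exact: mg.
  apply: measurable_funM.
    apply: measurableT_comp => //; apply: measurableT_comp => //.
    exact: measurable_hamiltonian.
  by apply: measurable_prod => z _; exact: (measurableT_comp (measurable_slab T z) (mg (val z))).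
have mG A : field_measurable (gibbs (slab A)).
  by apply: gibbs_measurable => z; exact: measurable_slab.
have G0 A phi : (0 <= gibbs (slab A) phi)%E.
  by apply: gibbs_ge0 => z t; case/andP: (slab_itv A z t).
pose c (t : R) : R := expR (4 * a ^+ 2) * expR (- ((2 * V)^-1 * t ^+ 2)).
have c0 t : 0 <= c t by rewrite mulr_ge0// expR_ge0.
have step t : (field_integral L (F t) (fun=> 0%R) <= (c t)%:E * (slabZ (x |: T)%SET)%:E)%E.
  have -> : field_integral L (F t) (fun=> 0) =
      field_integral L (fun psi => F t (fun y => psi y + t * u y)) (fun=> 0).
    rewrite (@field_integral_shift R d L (F t) (fun y => t * u y))//; last first.
      move=> disp W p g mp mg; exact: (mF _ _ (fun=> t)).
    by apply: field_integral_off => y yL; rewrite u0// mulr0 addr0.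
  rewrite -slabZ_fin -field_integralZl//; last by rewrite lee_fin.
  apply: le_field_integral => //.
  - move=> disp W p g mp mg; apply: (mF _ _ (fun=> t) (fun w y => g w y + t * u y)) => //.
    by move=> y; apply: measurable_funD.
  - move=> disp W p g mp mg; apply: measurable_funeM; exact: (mG (x |: T)%SET _ _ p g).
  - move=> psi psi0; rewrite -EFinM lee_fin.
    have -> : \prod_(z : L) slab T z (psi (val z) + t * u (val z)) =
              \prod_(z : L) slab T z (psi (val z)).
      apply: eq_bigr => z _; rewrite /slab; case: ifP => // zT.
      by rewrite uT ?valT// mulr0 addr0.
    have -> : \prod_(z : L) slab (x |: T)%SET z (psi (val z)) =
        \prod_(z : L) slab T z (psi (val z)) * eta (psi (val x)).
      rewrite (bigD1 x)//= [in RHS](bigD1 x)//= /slab !inE eqxx (negbTE xT)/= mul1r mulrC.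
      by congr (_ * _); apply: eq_bigr => z /negbTE zx; rewrite !inE zx.
    rewrite u1 mulr1 addrK [expR (- hamiltonian L psi) * _]mulrA [c t * _]mulrA [c t * _]mulrA.
    have [->|e0] := eqVneq (eta (psi (val x))) 0; first by rewrite !mulr0.
    have [->|p0] := eqVneq (\prod_(z : L) slab T z (psi (val z))) 0.
      by rewrite !(mul0r, mulr0).
    rewrite ler_wpM2r ?slab_ind_ge0// ler_wpM2r// /c -!expRD ler_expR.
    have etaP s : eta s != 0 -> `|s| <= a.
      rewrite /slab_ind indicE; case: (boolP (_ \in _)); last by rewrite eqxx.
      by rewrite inE/= in_itv/= ler_norml => ->.
    have xa : `|psi (val x)| <= a by exact: etaP.
    have Ta z : z \in T' -> `|psi z| <= a.
      rewrite T'P => /existsP[z' /andP[z'T /eqP<-]]; apply: etaP.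
      by move: p0; rewrite (bigD1 z')//= mulf_eq0 negb_or /slab z'T => /andP[].
    have := Hm psi psi0 Ta; rewrite hamiltonianD Hu.
    set B := bilin L u psi; set H := hamiltonian L psi.
    have hV : (2 * V)^-1 * t ^+ 2 <= h * (t ^+ 2 / 2).
      rewrite invfM; have := sqr_ge0 t; move: h_lb; set w := V^-1; nra.
    have h0 : 0 <= h by apply: le_trans h_lb; rewrite invr_ge0 ltW.
    move: xa; rewrite !ler_norml => /andP[x1 x2] /andP[b1 b2].
    have B1 : B <= 2 * a * h by nra.
    have B2 : - (2 * a * h) <= B by nra.
    (* The inequality 4 a |t| <= t^2 / 2 + 8 a^2, which leaves half of h t^2 for the integration
       over t. The bound h <= 1/2 then turns 8 a^2 h into 4 a^2. *)
    have key : - (2 * t * B) <= h * (t ^+ 2 / 2 + 8 * a ^+ 2).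
      have [t0|t0] := leP 0 t.
        by have := mulr_ge0 h0 (sqr_ge0 (t - 4 * a)); nra.
      by have := mulr_ge0 h0 (sqr_ge0 (t + 4 * a)); nra.
    by have := sqr_ge0 a; nra.
  - by move=> psi; rewrite mule_ge0// lee_fin.
have mc : measurable_fun (setT : set (measurableTypeR R)) c.
  apply: measurable_funM => //; apply: measurableT_comp => //; apply: measurableT_comp => //.
  by apply: measurable_funM => //; exact: measurable_funX.
have : ((2 * a)%:E * (slabZ T)%:E <=
    (expR (4 * a ^+ 2) * Num.sqrt (pi / (2 * V)^-1))%:E * (slabZ (x |: T)%SET)%:E)%E.
  rewrite -slabZ_fin -field_integralZl//; last by rewrite lee_fin mulr_ge0// ltW.
  have -> : (fun psi => (2 * a)%:E * gibbs (slab T) psi)%E =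
      (fun psi => \int[mu]_t F t psi)%E.
    apply/funext => psi; rewrite /F; under eq_integral do rewrite EFinM.
    rewrite ge0_integralZl ?integral_eta 1?muleC//.
    - apply/measurable_EFinP; apply: (measurableT_comp (measurable_slab_ind a)).
      by apply: measurable_funB.
    - by move=> t _; rewrite lee_fin slab_ind_ge0.
    - by rewrite lee_fin mulr_ge0 ?expR_ge0.
  rewrite -field_integral_tonelli//.
  apply: (@le_trans _ _ (\int[mu]_t ((c t)%:E * (slabZ (x |: T)%SET)%:E))%E).
    apply: ge0_le_integral => //.
    - by move=> t _; exact: field_integral_ge0.
    - apply: (@jointly_measurable_field_integral R d L F mF F0 _ (measurableTypeR R)
        (fun t => t) (fun=> (fun=> 0))) => //.
    - by apply: emeasurable_funM => //; exact/measurable_EFinP.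
  rewrite ge0_integralZr//; last 3 first.
  - exact/measurable_EFinP.
  - by move=> t _; rewrite lee_fin.
  - by rewrite lee_fin slabZ_ge0.
  rewrite /c; under eq_integral do rewrite EFinM.
  rewrite ge0_integralZl//.
  - by rewrite gaussian_integral// invr_gt0 mulr_gt0.
  - apply/measurable_EFinP; apply: measurableT_comp => //; apply: measurableT_comp => //.
    by apply: measurable_funM => //; exact: measurable_funX.
rewrite -!EFinM lee_fin invrK /pin_rate expRN.
have -> : pi * (2 * V) = 2 * pi * V by ring.
set s := Num.sqrt _; have s0 : 0 < s by rewrite sqrtr_gt0 !mulr_gt0 ?pi_gt0.
have E0 := expR_gt0 (4 * a ^+ 2); set E := expR _ in E0 *.
move=> hh.
have -> : 2 * a / E / s * slabZ T = (2 * a * slabZ T) / (E * s).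
  by field; rewrite !lt0r_neq0.
by rewrite ler_pdivrMr ?mulr_gt0//; apply: (le_trans hh); rewrite mulrC.
Qed.

End PinningIntegrals.

(** * Polynomials indexed by subsets, affine in each variable *)

Section SubsetSums.
Context {R : realType} {X : finType}.
Implicit Types (A B S : {set X}) (x k : X) (c w F G : X -> R).

Lemma prodD_sets F G : \prod_x (F x + G x) =
  \sum_(A : {set X}) (\prod_(x in A) F x) * (\prod_(x | x \notin A) G x).
Proof.
rewrite (bigA_distr _ _ F G); apply: eq_bigr => A _.
rewrite (bigID (mem A))/=; congr (_ * _); apply: eq_bigr => x; first by move=> ->.
by move=> /negbTE->.
Qed.

Lemma prod_nat_subset A B : \prod_(x | x \notin B) (x \notin A)%:R = (A \subset B)%:R :> R.
Proof.
have [AB|] := boolP (A \subset B).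
  by rewrite big1// => x xB; rewrite (contra (fintype.subsetP AB x) xB).
by case/subsetPn => x xA xB; rewrite (bigD1 x)//= xA mul0r.
Qed.

Lemma prod1D_subset B w : \prod_(x in B) (1 + w x) =
  \sum_(A : {set X} | A \subset B) \prod_(x in A) w x.
Proof.
have -> : \prod_(x in B) (1 + w x) = \prod_x ((if x \in B then w x else 0) + 1).
  by rewrite big_mkcond/=; apply: eq_bigr => x _; case: (x \in B); rewrite ?add0r 1?addrC.
rewrite prodD_sets [RHS]big_mkcond; apply: eq_bigr => A _.
rewrite [X in _ * X]big1 ?mulr1//; case: ifPn => [AB|].
  by apply: eq_bigr => x xA; rewrite (fintype.subsetP AB).
by case/subsetPn => x xA xB; rewrite (bigD1 x)//= (negbTE xB) mul0r.
Qed.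

Variable K : {set X} -> R.

Definition weightZ c : R := \sum_(A : {set X}) K A * \prod_(x in A) c x.
Definition coef0 k c : R := \sum_(A : {set X} | k \notin A) K A * \prod_(x in A) c x.
Definition coef1 k c : R :=
  \sum_(A : {set X} | k \in A) K A * \prod_(x in A | x != k) c x.
Definition upper A : R := \sum_(B : {set X} | A \subset B) K B.

Lemma weightZ_affine k c : weightZ c = coef0 k c + c k * coef1 k c.
Proof.
rewrite /weightZ (bigID (fun A : {set X} => k \notin A))/=; congr (_ + _).
rewrite mulr_sumr; apply: eq_big => [A|A]; first by rewrite negbK.
by rewrite negbK => kA; rewrite (bigD1 k)//= mulrCA.
Qed.

Lemma coef0_eq k c c' : (forall x, x != k -> c x = c' x) -> coef0 k c = coef0 k c'.
Proof.
move=> cc; apply: eq_bigr => A kA; congr (_ * _); apply: eq_bigr => x xA; apply: cc.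
by apply: contra kA => /eqP<-.
Qed.

Lemma coef1_eq k c c' : (forall x, x != k -> c x = c' x) -> coef1 k c = coef1 k c'.
Proof.
by move=> cc; apply: eq_bigr => A kA; congr (_ * _); apply: eq_bigr => x /andP[_ xk]; exact: cc.
Qed.

Hypothesis K_ge0 : forall A, 0 <= K A.
Hypothesis K0_gt0 : 0 < K finset.set0.

Lemma coef0_ge k c : (forall x, 0 <= c x) -> K finset.set0 <= coef0 k c.
Proof.
move=> c0; rewrite /coef0 (bigD1 finset.set0) ?inE//= big_set0 mulr1 lerDl.
by apply: sumr_ge0 => A _; rewrite mulr_ge0// prodr_ge0.
Qed.

Lemma coef1_ge0 k c : (forall x, 0 <= c x) -> 0 <= coef1 k c.
Proof. by move=> c0; apply: sumr_ge0 => A _; rewrite mulr_ge0// prodr_ge0. Qed.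

Lemma weightZ_ge c : (forall x, 0 <= c x) -> K finset.set0 <= weightZ c.
Proof.
move=> c0; rewrite /weightZ (bigD1 finset.set0)//= big_set0 mulr1 lerDl.
by apply: sumr_ge0 => A _; rewrite mulr_ge0// prodr_ge0.
Qed.

Lemma le_weightZ c c' : (forall x, 0 <= c x <= c' x) -> weightZ c <= weightZ c'.
Proof.
move=> cc; apply: ler_sum => A _; rewrite ler_wpM2l// ler_prod// => x _; exact: cc.
Qed.

(* [pinnedZ q S] is the partition function with weight [q] at every pinned site,
   restricted to configurations pinned on [S]. *)
Definition pinnedZ (q : R) S : R := \sum_(B : {set X} | S \subset B) K B * q ^+ #|B|.

(** Expand q = 1 + (q - 1) over B. For q >= 1 the result is a nonnegative combination of [upper]
    sums; for pinning these are the [slabZ], to which the shift estimate applies. *)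
Lemma pinnedZE (q : R) S : 1 <= q ->
  pinnedZ q S = \sum_(A : {set X}) (q - 1) ^+ #|A| * upper (A :|: S)%SET.
Proof.
move=> q1; rewrite /pinnedZ /upper.
under [RHS]eq_bigr do rewrite mulr_sumr.
rewrite (exchange_big_dep (fun B : {set X} => S \subset B))/=; last first.
  by move=> A B _; rewrite finset.subUset => /andP[].
apply: eq_bigr => B SB; rewrite -prodr_const.
have -> : \prod_(x in B) q = \prod_(x in B) (1 + (q - 1)).
  by apply: eq_bigr => x _; rewrite addrC subrK.
rewrite (prod1D_subset B (fun=> q - 1)) mulr_sumr.
apply: eq_big => [A|A AB]; first by rewrite finset.subUset SB andbT.
by rewrite prodr_const mulrC.
Qed.

(* If inserting one more pinned site costs at most a factor [r], then a site with
   weight [q] is pinned with odds at least [r], whatever larger weights the other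
   sites carry. *)
Lemma pinning_odds (q r : R) w k : 0 < q -> (forall x, 0 <= w x) ->
  (forall S, k \notin S -> r * pinnedZ q S <= pinnedZ q (k |: S)%SET) ->
  r * (coef0 k (fun x => q * (1 + w x)) + q * coef1 k (fun x => q * (1 + w x))) <=
  q * coef1 k (fun x => q * (1 + w x)).
Proof.
move=> q0 w0 ins; pose c x := q * (1 + w x); rewrite -/c.
(* With w set to 0 at k, this site carries exactly q and no set containing k survives in the
   expansion. *)
pose w' x := if x == k then 0 else w x.
have E1 : coef0 k c + q * coef1 k c = \sum_(S : {set X} | k \notin S)
    (\prod_(x in S) w x) * pinnedZ q S.
  have -> : coef0 k c + q * coef1 k c = weightZ (fun x => q * (1 + w' x)).
    rewrite (weightZ_affine k) {2}/w' eqxx addr0 mulr1; congr (_ + _ * _).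
      by apply: coef0_eq => x xk; rewrite /c /w' (negbTE xk).
    by apply: coef1_eq => x xk; rewrite /c /w' (negbTE xk).
  rewrite /weightZ; under eq_bigr do rewrite big_split/= prodr_const prod1D_subset mulrA mulr_sumr.
  rewrite (exchange_big_dep xpredT)//= [LHS](bigID (fun A : {set X} => k \notin A))/=.
  rewrite [X in _ + X]big1 ?addr0 => [|A]; last first.
    rewrite negbK => kA; rewrite big1// => B _.
    by rewrite (bigD1 k)//= /w' eqxx mul0r mulr0.
  apply: eq_bigr => A kA; rewrite /pinnedZ mulr_sumr; apply: eq_bigr => B AB.
  rewrite mulrC; congr (_ * _); apply: eq_bigr => x xA; rewrite /w'.
  by case: eqVneq => // xk; rewrite -xk xA in kA.
have E2 : q * coef1 k c = \sum_(S : {set X} | k \notin S)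
    (\prod_(x in S) w x) * pinnedZ q (k |: S)%SET.
  pose c' x := q * (1 + w' x).
  have -> : q * coef1 k c = \sum_(A : {set X} | k \in A) K A * \prod_(x in A) c' x.
    rewrite mulr_sumr; apply: eq_bigr => A kA; rewrite [in RHS](bigD1 k)//= mulrCA.
    rewrite /c' {1}/w' eqxx addr0 mulr1; congr (_ * (_ * _)).
    by apply: eq_bigr => x /andP[_ /negbTE xk]; rewrite /c /w' xk.
  rewrite /c'; under eq_bigr do rewrite big_split/= prodr_const prod1D_subset mulrA mulr_sumr.
  rewrite (exchange_big_dep xpredT)//= [LHS](bigID (fun A : {set X} => k \notin A))/=.
  rewrite [X in _ + X]big1 ?addr0 => [|A]; last first.
    rewrite negbK => kA; rewrite big1// => B _.
    by rewrite (bigD1 k)//= /w' eqxx mul0r mulr0.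
  apply: eq_bigr => A kA; rewrite /pinnedZ mulr_sumr; apply: eq_big => [B|B AB].
    by rewrite finset.subUset finset.sub1set.
  rewrite mulrC; congr (_ * _); apply: eq_bigr => x xA; rewrite /w'.
  by case: eqVneq => // xk; rewrite -xk xA in kA.
rewrite E1 E2 mulr_sumr; apply: ler_sum => S kS.
by rewrite mulrCA ler_wpM2l ?prodr_ge0// ins.
Qed.

End SubsetSums.

(* The difference of the two sides is a perfect increment: with equal values at
   [g = 1], log-concavity turns moving mass from the slope [be] to the constant
   [al] into a multiple of [g - 1], which has mean zero. *)
Lemma ln_affine_le {R : realType} (al be al' be' g : R) :
  0 < al -> 0 <= be -> al <= al' -> 0 <= be' -> al + be = al' + be' -> 0 <= g ->
  ln (al + be * g) <= ln (al' + be' * g) + (be - be') / (al + be) * (g - 1).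
Proof.
move=> al0 be0 alal' be'0 e g0.
have al'0 : 0 < al' by apply: lt_le_trans alal'.
have n0 : 0 < al + be * g by rewrite ltr_pwDl// mulr_ge0.
have d0 : 0 < al' + be' * g by rewrite ltr_pwDl// mulr_ge0.
have s0 : 0 < al + be by rewrite ltr_pwDl.
rewrite -lerBlDl -ln_div ?posrE//.
(* By ln t <= t - 1 it remains to compare (g - 1) / (al' + be' g) with (g - 1) / (al' + be'); the
   difference has the sign of be' (g - 1)^2. *)
apply: (@le_trans _ _ ((al + be * g) / (al' + be' * g) - 1)).
  set t := _ / _; have t0 : 0 < t by rewrite divr_gt0.
  have -> : ln t = ln (1 + (t - 1)) by congr ln; rewrite addrC subrK.
  by apply: le_ln1Dx; rewrite ltrBrDl subrr.
have -> : (al + be * g) / (al' + be' * g) - 1 = (be - be') * (g - 1) / (al' + be' * g).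
  have -> : al = al' + be' - be by rewrite -e addrK.
  by field; exact: lt0r_neq0.
have bb : 0 <= be - be' by lra.
rewrite -mulrA [leRHS]mulrAC -[leRHS]mulrA ler_wpM2l// ler_pdivrMr// mulrAC ler_pdivlMr//.
have := mulr_ge0 be'0 (sqr_ge0 (g - 1)); rewrite e; lra.
Qed.

(** * Expansion of the partition functions over pinned sets *)

Section PartitionFunctions.
Context {R : realType} {d : nat}.
Hypothesis d_gt0 : (0 < d)%N.
Variables (a : R) (L : {fset site d}).
Hypothesis a_gt0 : 0 < a.
Implicit Types (A B : {set L}).
Local Notation eta := (slab_ind a).
Local Notation cellZ := (@cellZ R d a L).
Local Notation slabZ := (@slabZ R d a L).

Lemma field_integral_sum (I : Type) (r : seq I) (k : I -> R)
    (G : I -> (site d -> R) -> \bar R) (s : seq (site d)) phi :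
  (forall i, field_measurable (G i)) -> (forall i psi, 0 <= G i psi)%E ->
  (forall i, 0 <= k i) ->
  (field_integral s (fun psi => \sum_(i <- r) (k i)%:E * G i psi) phi =
   \sum_(i <- r) (k i)%:E * field_integral s (G i) phi)%E.
Proof.
move=> mG G0 k0; elim: r => [|i r IH].
  rewrite big_nil; under [X in field_integral _ X]funext do rewrite big_nil.
  by elim: s phi => //= x s IHs phi; apply: integral0_eq => t _; rewrite IHs.
rewrite big_cons -IH -field_integralZl ?lee_fin//.
rewrite -field_integralD//.
- by apply: eq_field_integral => psi _; rewrite big_cons.
- by move=> disp W p g mp mg; apply: measurable_funeM; exact: (mG i _ _ p g).
- move=> disp W p g mp mg; apply: emeasurable_sum => j.
  by apply: measurable_funeM; exact: (mG j _ _ p g).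
- by move=> psi; rewrite mule_ge0 ?lee_fin.
- by move=> psi; apply: sume_ge0 => j _; rewrite mule_ge0 ?lee_fin.
Qed.

Lemma gibbs_integral_cells (p q : L -> R) : (forall x, 0 <= p x) -> (forall x, 0 <= q x) ->
  gibbs_integral (fun x t => p x * eta t + q x * (1 - eta t)) =
  (\sum_(B : {set L}) (\prod_(x in B) p x * \prod_(x | x \notin B) q x) * cellZ B)%:E.
Proof.
move=> p0 q0; pose k B := \prod_(x in B) p x * \prod_(x | x \notin B) q x.
have k0 B : 0 <= k B by rewrite mulr_ge0 ?prodr_ge0.
transitivity (field_integral L
    (fun psi => \sum_(B : {set L}) (k B)%:E * gibbs (cell a B) psi)%E (fun=> 0)).
  apply: eq_field_integral => psi _.
  rewrite /gibbs prodD_sets mulr_sumr -sumEFin; apply: eq_bigr => B _.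
  rewrite -EFinM; congr EFin; rewrite [RHS]mulrCA; congr (_ * _).
  rewrite !big_split/= /k mulrACA; congr (_ * _).
  rewrite [RHS](bigID (mem B))/=; congr (_ * _); apply: eq_bigr => x; rewrite /cell.
    by move=> ->.
  by move=> /negbTE->.
rewrite (field_integral_sum (I := {set L}) _ (k := k) (G := fun B => gibbs (cell a B))).
- rewrite -sumEFin; apply: eq_bigr => B _; rewrite [RHS]EFinM; congr (_ * _)%E.
  exact: cellZ_fin.
- by move=> B; apply: gibbs_measurable => x; exact: measurable_cell.
- by move=> B psi; apply: gibbs_ge0 => x t; case/andP: (cell_itv a B x t).
- exact: k0.
Qed.

Lemma partition_fun_weightZ (v : site d -> R) :
  partition_fun a v L = weightZ cellZ (fun x => expR (v (val x))).
Proof.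
rewrite /partition_fun.
have -> : (fun phi => (expR (- hamiltonian L phi +
      \sum_(x <- L) v x * \1_(`[- a, a]) (phi x)))%:E) =
    gibbs (fun (x : L) t => expR (v (val x)) * eta t + 1 * (1 - eta t)).
  apply/funext => phi; rewrite /gibbs expRD; congr (_ * _)%:E.
  rewrite big_seq_fsetE expR_sum; apply: eq_bigr => x _.
  rewrite /slab_ind indicE; case: (_ \in _) => /=.
    by rewrite !mulr1 subrr mulr0 addr0.
  by rewrite !mulr0 expR0 subr0 mulr1 add0r.
rewrite -/(gibbs_integral _) gibbs_integral_cells//.
rewrite /= /weightZ; apply: eq_bigr => B _.
by rewrite [X in _ * X * _]big1// mulr1 mulrC.
Qed.

Lemma Z_free_weightZ : Z_free R L = weightZ cellZ (fun=> 1).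
Proof.
have -> : Z_free R L = partition_fun a (fun=> 0) L.
  congr fine; apply: eq_field_integral => phi _; congr (expR _)%:E.
  by rewrite big1 ?addr0// => x _; rewrite mul0r.
rewrite partition_fun_weightZ; apply: eq_bigr => B _; congr (_ * _).
by apply: eq_bigr => x _; rewrite expR0.
Qed.

Lemma slabZ_upper A : slabZ A = upper cellZ A.
Proof.
have -> : slabZ A = fine (gibbs_integral (fun (x : L) t => 1 * eta t + (x \notin A)%:R * (1 - eta t))).
  congr (fine (gibbs_integral _)); apply/funext => x; apply/funext => t.
  rewrite /slab mul1r; case: (x \in A) => /=; first by rewrite mul0r addr0.
  by rewrite mul1r addrC subrK.
rewrite gibbs_integral_cells//= /upper [RHS]big_mkcond; apply: eq_bigr => B _.
rewrite big1// mul1r prod_nat_subset; case: ifP; first by rewrite mul1r.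
by rewrite mul0r.
Qed.

End PartitionFunctions.

(** * Insertion of a pinned site into the homogeneous model *)

Section PinningDensity.
Context {R : realType}.
Variable a : R.
Hypothesis a_gt0 : 0 < a.

Lemma pin_rate_gt0 (V : R) : 0 < V -> 0 < pin_rate a V.
Proof.
move=> V0; apply: divr_gt0; first by rewrite !mulr_gt0// expR_gt0.
by rewrite sqrtr_gt0 !mulr_gt0// pi_gt0.
Qed.

(** Covers the case where the inserted site already belongs to the pinned set and insertion changes
    nothing. *)
Lemma pin_rate_le1 (V : R) : 1 <= V -> pin_rate a V <= 1.
Proof.
move=> V1; have V0 : 0 < V by apply: lt_le_trans V1.
have p2 : 2 <= pi :> R by exact: pi_ge2.
rewrite /pin_rate expRN ler_pdivrMr ?sqrtr_gt0 ?mulr_gt0 ?pi_gt0// mul1r.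
apply: (@le_trans _ _ 1).
  rewrite ler_pdivrMr ?expR_gt0// mul1r.
  by apply: le_trans (expR_ge1Dx _); have := sqr_ge0 (4 * a - 1); lra.
by rewrite -{1}[1]sqrtr1 ler_wsqrtr//; nra.
Qed.

Lemma slabZ_insert_le {d : nat} (L : {fset site d}) (T : {set L}) (x : L) (V : R) :
  (0 < d)%N -> 1 <= V ->
  (forall f : site d -> R, x \notin T -> supported L f ->
    (forall z : L, z \in T -> f (val z) = 0) -> f (val x) ^+ 2 <= V * hamiltonian L f) ->
  pin_rate a V * slabZ a T <= slabZ a (x |: T)%SET.
Proof.
move=> d0 V1 HV; have V0 : 0 < V by apply: lt_le_trans V1.
have [xT|xT] := boolP (x \in T).
  have -> : (x |: T)%SET = T by apply/finset.setUidPr; rewrite finset.sub1set.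
  by rewrite ler_piMl ?pin_rate_le1// slabZ_ge0.
by apply: slabZ_insert => // f; exact: HV.
Qed.

Lemma pinnedZ_slabs {d : nat} (L : {fset site d}) (Q : R) (S : {set L}) : (0 < d)%N -> 1 <= Q ->
  pinnedZ (@cellZ R d a L) Q S = \sum_(A : {set L}) (Q - 1) ^+ #|A| * slabZ a (A :|: S)%SET.
Proof.
move=> d0 Q1; rewrite pinnedZE//; apply: eq_bigr => A _; congr (_ * _).
by rewrite slabZ_upper.
Qed.

Lemma pinnedZ_insert_spatial {d : nat} (L : {fset site d}) (Q : R) (S : {set L}) (x : L) :
  (3 <= d)%N -> 1 <= Q ->
  pin_rate a 1728 * pinnedZ (@cellZ R d a L) Q S <= pinnedZ (@cellZ R d a L) Q (x |: S)%SET.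
Proof.
move=> d3 Q1; have d0 : (0 < d)%N by apply: leq_trans d3.
rewrite !pinnedZ_slabs// mulr_sumr; apply: ler_sum => A _.
rewrite mulrCA ler_wpM2l ?exprn_ge0 ?subr_ge0//.
have -> : (A :|: (x |: S) = x |: (A :|: S))%SET by rewrite finset.setUCA.
apply: slabZ_insert_le => //; first by lra.
by move=> f _ f0 _; exact: spatial_green_bound.
Qed.

(** The part of [pin_rate] at V = 128 (harm n + 1)^2 that does not depend on n; 256 = 2 * 128. *)
Definition planar_const : R := 2 * a * expR (- (4 * a ^+ 2)) / Num.sqrt (256 * pi).
Definition planar_rate (n : nat) : R := planar_const / (harm n + 1).

Lemma planar_const_gt0 : 0 < planar_const.
Proof.
apply: divr_gt0; first by rewrite !mulr_gt0// expR_gt0.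
by rewrite sqrtr_gt0; apply: mulr_gt0; [exact: ltr0n|exact: pi_gt0].
Qed.

Lemma harm1_gt0 n : 0 < harm n + 1 :> R.
Proof. by rewrite ltr_wpDl// harm_ge0. Qed.

Lemma planar_rate_gt0 n : 0 < planar_rate n.
Proof. by rewrite divr_gt0 ?planar_const_gt0 ?harm1_gt0. Qed.

Lemma planar_rateE n : planar_rate n = pin_rate a (128 * (harm n + 1) ^+ 2).
Proof.
rewrite /planar_rate /planar_const /pin_rate -mulrA -invfM; congr (_ / _).
have -> : 2 * pi * (128 * (harm n + 1) ^+ 2) = (256 * pi) * (harm n + 1) ^+ 2 :> R by ring.
have p0 : 0 <= 256 * pi :> R by apply: mulr_ge0; [exact: ler0n|exact: pi_ge0].
by rewrite (sqrtrM _ p0) sqrtr_sqr ger0_norm// ltW// harm1_gt0.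
Qed.

(** Crude, but it leaves the summable weight n^(-3/2) for the shells. The logarithmic bound
    [harm_le_ln] is applied only to the final rate. *)
Lemma harm_le_sqrt n : harm n <= 2 * Num.sqrt n%:R :> R.
Proof.
elim: n => [|n IH]; first by rewrite /harm big_ord0 sqrtr0 mulr0.
rewrite /harm big_ord_recr/=; apply: (le_trans (lerD IH (lexx _))).
set x := Num.sqrt n%:R; set y := Num.sqrt n.+1%:R.
have x0 : 0 <= x by exact: sqrtr_ge0.
have y0 : 0 < y by rewrite sqrtr_gt0.
have x2 : x ^+ 2 = n%:R by rewrite sqr_sqrtr.
have y2 : y ^+ 2 = n.+1%:R by rewrite sqr_sqrtr.
have xy : x <= y by rewrite ler_wsqrtr// ler_nat.
have y1 : 1 <= y by rewrite -[1]sqrtr1 ler_wsqrtr// ler1n.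
rewrite -y2; have yx : y ^+ 2 - x ^+ 2 = 1 by rewrite x2 y2 -natr1; ring.
have -> : (y ^+ 2)^-1 = (y ^+ 2 - x ^+ 2) / y ^+ 2 by rewrite yx mul1r.
rewrite -lerBrDl -mulrBr ler_pdivrMr ?exprn_gt0//.
have : 0 <= (y - x) * (2 * y ^+ 2 - x - y) by rewrite mulr_ge0 ?subr_ge0//; nra.
lra.
Qed.

Section Planar.
Variables (L : {fset site 2}) (Q : R) (S : {set L}) (x : L).
Hypothesis Q_gt1 : 1 < Q.
Local Notation J A := ((Q - 1) ^+ #|A| * slabZ a (A :|: S)%SET).
Local Notation pt p q := (plane (ord0 : 'I_2) ord_max (val x) p q).

(** The quadrant square of scale n with corner x meets T or leaves L. In both cases it contains a
    zero of every function supported on L and vanishing on T, as [planar_green_bound] requires. *)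
Definition touches (T : {set L}) (n : nat) : bool :=
  [exists p : 'I_n.+1, exists q : 'I_n.+1,
    (pt p q \notin L) || [exists z : L, (z \in T) && (val z == pt p q)]].

Let J_ge0 (A : {set L}) : 0 <= J A.
Proof. by rewrite mulr_ge0 ?slabZ_ge0// exprn_ge0// subr_ge0 ltW. Qed.

Lemma touchesP (T : {set L}) n : reflect (exists p q, [/\ (p <= n)%N, (q <= n)%N &
    pt p q \notin L \/ exists2 z : L, z \in T & val z = pt p q]) (touches T n).
Proof.
apply: (iffP existsP) => [[p /existsP[q pq]]|[p [q [pn qn h]]]].
  exists p, q; split; rewrite ?leq_ord//.
  by case/orP: pq => [|/existsP[z /andP[zT /eqP zE]]]; [left|right; exists z].
exists (Ordinal (pn : (p < n.+1)%N)); apply/existsP; exists (Ordinal (qn : (q < n.+1)%N)) => /=.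
apply/orP; case: h => [|[z zT zE]]; [by left|right].
by apply/existsP; exists z; rewrite zT zE eqxx.
Qed.

Lemma touches_le (T : {set L}) m n : (m <= n)%N -> touches T m -> touches T n.
Proof.
move=> mn /touchesP[p [q [pm qm h]]]; apply/touchesP; exists p, q.
by split; rewrite // (leq_trans _ mn).
Qed.

(** A row of |L| + 1 points does not fit into L. *)
Lemma touches_large (T : {set L}) : touches T #|` L|.
Proof.
apply/touchesP; apply: contrapT => h.
have sub : {subset [seq pt m 0 | m <- iota 0 #|` L|.+1] <= L}.
  move=> _ /mapP[m + ->]; rewrite mem_iota add0n ltnS => /andP[_ mL].
  by apply/negPn/negP => pm; apply: h; exists m, 0%N; split => //; left.
have /uniq_leq_size/(_ sub) : uniq [seq pt m 0 | m <- iota 0 #|` L|.+1].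
  by rewrite map_inj_uniq ?iota_uniq// => m m' /plane_inj[].
by rewrite size_map size_iota ltnn.
Qed.

(** The inserted site may be any site of the square: [shell_bound] tries all of them, the final
    estimate takes the corner. *)
Lemma planar_insert (T : {set L}) n p q (z : L) : touches T n ->
  (p <= n)%N -> (q <= n)%N -> val z = pt p q ->
  planar_rate n * slabZ a T <= slabZ a (z |: T)%SET.
Proof.
move=> /touchesP[p' [q' [p'n q'n h]]] pn qn zE; rewrite planar_rateE.
apply: slabZ_insert_le => //.
  have : (1 : R) <= (harm n + 1) ^+ 2 by rewrite exprn_ege1// lerDr harm_ge0.
  by lra.
move=> f _ f0 fT; rewrite zE; apply: (planar_green_bound (p' := p') (q' := q')) => //.
by case: h => [|[z' z'T <-]]; [exact: f0|exact: fT].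
Qed.

(** Entropy: if the square of scale n is empty, each of its (n + 1)^2 sites can be added to A at a
    factor of at least (Q - 1) [planar_rate], the scale n + 1 providing the nearby zero. A pair (A,
    site) is recovered from the enlarged set, whose only site in the square is the added one; hence
    all images together weigh at most the full sum. *)
Lemma shell_bound n :
  planar_rate n.+1 * (Q - 1) * n.+1%:R ^+ 2 *
    \sum_(A : {set L} | ~~ touches (A :|: S)%SET n && touches (A :|: S)%SET n.+1) J A <=
  \sum_(A : {set L}) J A.
Proof.
pose P : {set {set L}} := [set A : {set L} | ~~ touches (A :|: S)%SET n && touches (A :|: S)%SET n.+1]%SET.
have Q0 : 0 < Q - 1 by rewrite subr_gt0.
pose I : finType := ('I_n.+1 * 'I_n.+1)%type.
(* The default x of [insubd] is never taken once P is nonempty, because an untouched square lies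
   inside L. *)
pose z (i : I) : L := insubd x (pt i.1 i.2).
have zE A (i : I) : A \in P -> val (z i) = pt i.1 i.2 /\ z i \notin (A :|: S)%SET.
  rewrite inE => /andP[/touchesP nt _].
  have zL : pt i.1 i.2 \in L.
    apply/negPn/negP => zL; apply: nt; exists i.1, i.2.
    by split; rewrite ?leq_ord//; left.
  have vz : val (z i) = pt i.1 i.2 by rewrite insubdK.
  split=> //; apply/negP => zT; apply: nt; exists i.1, i.2.
  by split; rewrite ?leq_ord//; right; exists (z i).
pose h (Ai : {set L} * I) : {set L} := (z Ai.2 |: Ai.1)%SET.
pose D : {set {set L} * I} := [set Ai | Ai.1 \in P]%SET.
have hinj : {in D &, injective h}.
  move=> [A i] [A' i']; rewrite !inE/= => AP A'P; rewrite /h/= => e.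
  have AP' : A \in P by rewrite inE.
  have A'P' : A' \in P by rewrite inE.
  have [vi iA] := zE _ i AP'; have [vi' i'A'] := zE _ i' A'P'.
  have [_ iA'] := zE _ i A'P'.
  have zz : z i = z i'.
    have : z i \in (z i' |: A')%SET by rewrite -e !inE eqxx.
    rewrite !inE => /predU1P[//|iA'']; move: iA'; by rewrite inE iA''.
  have ii : i = i'.
    move: vi vi'; rewrite zz => -> /plane_inj[//|e1 e2].
    by case: (i) (i') e1 e2 => [u v] [u' v'] /= e1 e2; congr (_, _); exact: val_inj.
  congr (_, _) => //.
  have -> : A = ((z i |: A) :\ z i)%SET.
    by rewrite finset.setU1K//; move: iA; rewrite inE negb_or => /andP[].
  have -> : A' = ((z i' |: A') :\ z i')%SET.
    by rewrite finset.setU1K//; move: i'A'; rewrite inE negb_or => /andP[].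
  by rewrite e zz.
apply: (@le_trans _ _ (\sum_(B in [set h Ai | Ai in D]%SET) J B)); last first.
  rewrite [leRHS](bigID (mem [set h Ai | Ai in D]%SET))/= lerDl.
  by apply: sumr_ge0 => B _; exact: J_ge0.
rewrite big_imset//=.
have -> : \sum_(Ai in D) J (h Ai) = \sum_(A in P) \sum_(i : I) J (h (A, i)).
  rewrite (pair_big_dep _ (fun _ _ => true))/=; apply: eq_big => [[A i]|[A i] _] //.
  by rewrite !inE andbT.
have -> : \sum_(A : {set L} | ~~ touches (A :|: S)%SET n && touches (A :|: S)%SET n.+1) J A =
   \sum_(A in P) J A by apply: eq_bigl => A; rewrite inE.
rewrite mulr_sumr; apply: ler_sum => A AP.
apply: (@le_trans _ _ (\sum_(i : I) planar_rate n.+1 * (Q - 1) * J A)).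
  rewrite sumr_const card_prod !card_ord -[leRHS]mulr_natl natrM -expr2.
  have alg (r q N j : R) : r * q * N ^+ 2 * j <= N ^+ 2 * (r * q * j).
    by rewrite le_eqVlt; apply/orP; left; apply/eqP; ring.
  exact: alg.
apply: ler_sum => i _; have [vi iA] := zE _ i AP.
have -> : #|h (A, i)| = #|A|.+1.
  by rewrite /h cardsU1; move: iA; rewrite inE negb_or => /andP[-> _].
have -> : (h (A, i) :|: S = z i |: (A :|: S))%SET by rewrite /h finset.setUA.
rewrite exprS -[leRHS]mulrA -mulrA mulrCA ler_pM2l//.
rewrite mulrCA ler_wpM2l ?exprn_ge0 ?(ltW Q0)//.
move: (AP); rewrite inE => /andP[_ t]; apply: (planar_insert t (leqW (leq_ord _)) (leqW (leq_ord _)) vi).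
Qed.

(** By [harm_le_sqrt] and the series of n^(-3/2), the shells beyond D carry at most 12 / ((Q - 1)
    [planar_const] sqrt (D + 1)) of the total; the condition on D makes this at most one half. *)
Lemma shell_sum D : (24 / ((Q - 1) * planar_const)) ^+ 2 <= D.+1%:R ->
  \sum_(A : {set L}) J A <= 2 * \sum_(A : {set L} | touches (A :|: S)%SET D) J A.
Proof.
move=> HD; set F := \sum_(A : {set L}) J A.
pose N n := \sum_(A : {set L} | ~~ touches (A :|: S)%SET n && touches (A :|: S)%SET n.+1) J A.
pose Tm n := \sum_(A : {set L} | touches (A :|: S)%SET n) J A.
have F0 : 0 <= F by apply: sumr_ge0 => A _; exact: J_ge0.
have Q0 : 0 < Q - 1 by rewrite subr_gt0.
have c0 := planar_const_gt0.
have dec m : Tm (D + m)%N <= Tm D + \sum_(D <= n < D + m) N n.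
  elim: m => [|m IH]; first by rewrite addn0 big_geq// addr0.
  rewrite addnS big_nat_recr ?leq_addr//= addrA (le_trans _ (lerD IH (lexx _)))//.
  rewrite /Tm [leLHS](bigID (fun A : {set L} => touches (A :|: S)%SET (D + m)%N))/=.
  rewrite le_eqVlt; apply/orP; left; apply/eqP; congr (_ + _); apply: eq_bigl => A.
    by apply: andb_idl => t; apply: touches_le t.
  by rewrite andbC.
have shell n : N n <= F * (3 / ((Q - 1) * planar_const)) * (n.+1%:R * Num.sqrt n.+1%:R)^-1.
  have := shell_bound n; rewrite -/F -/(N n).
  set y := Num.sqrt n.+1%:R; set m : R := n.+1%:R.
  have y0 : 0 < y by rewrite sqrtr_gt0.
  have y2 : y ^+ 2 = m by rewrite sqr_sqrtr.
  have y1 : 1 <= y by rewrite -[1]sqrtr1 ler_wsqrtr// ler1n.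
  have N0 : 0 <= N n by apply: sumr_ge0 => A _; exact: J_ge0.
  have h1 := harm1_gt0 n.+1; have h2 := harm_le_sqrt n.+1; rewrite -/y in h2.
  rewrite /planar_rate => h3.
  have h4 : harm n.+1 + 1 <= 3 * y by lra.
  have h5 : planar_const * (Q - 1) * m ^+ 2 * N n <= F * (3 * y).
    apply: (@le_trans _ _ (F * (harm n.+1 + 1))); last by rewrite ler_wpM2l.
    rewrite -ler_pdivrMr//; apply: le_trans h3.
    by rewrite le_eqVlt; apply/orP; left; apply/eqP; ring.
  have -> : F * (3 / ((Q - 1) * planar_const)) * (m * y)^-1 =
      F * (3 * y) / (planar_const * (Q - 1) * m ^+ 2).
    by rewrite -y2; field; rewrite !lt0r_neq0.
  rewrite ler_pdivlMr; first by rewrite mulrC.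
  by apply: mulr_gt0; [exact: mulr_gt0|apply: exprn_gt0; rewrite ltr0n].
have := dec #|` L|.
have -> : Tm (D + #|` L|)%N = F.
  rewrite /Tm; apply: eq_bigl => A; apply/idP.
  by apply: touches_le (touches_large _); rewrite leq_addl.
rewrite -/(Tm D) => h1.
suff : \sum_(D <= n < D + #|` L|) N n <= F / 2.
  by move: h1; move: (Tm D) (\sum_(_ <= n < _) N n) => u v h1 h2; lra.
apply: (@le_trans _ _ (F * (3 / ((Q - 1) * planar_const)) * (4 / Num.sqrt D.+1%:R))).
  apply: (@le_trans _ _ (\sum_(D <= n < D + #|` L|)
     F * (3 / ((Q - 1) * planar_const)) * (n.+1%:R * Num.sqrt n.+1%:R)^-1)).
    by apply: ler_sum => n _; exact: shell.
  rewrite -mulr_sumr ler_wpM2l ?sum_inv_sqrt3_le//.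
  by rewrite mulr_ge0// divr_ge0// mulr_ge0// ltW.
rewrite -mulrA ler_wpM2l//.
have e0 : 0 <= 24 / ((Q - 1) * planar_const).
  by rewrite divr_ge0// mulr_ge0// ltW.
have := ler_wsqrtr HD; rewrite sqrtr_sqr ger0_norm//.
set y := Num.sqrt _; have y0 : 0 < y by rewrite sqrtr_gt0.
have qc0 : 0 < (Q - 1) * planar_const by exact: mulr_gt0.
rewrite (ler_pdivrMr _ _ qc0) => h.
have -> : 3 / ((Q - 1) * planar_const) * (4 / y) = 12 / (y * ((Q - 1) * planar_const)).
  by field; rewrite !lt0r_neq0.
by rewrite (ler_pdivrMr _ _ (mulr_gt0 y0 qc0)); lra.
Qed.

End Planar.

(** Half of the weight touches at scale D by [shell_sum], and on that half insertion at x costs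
    [planar_rate D]. *)
Lemma pinnedZ_insert_planar (L : {fset site 2}) (Q : R) (S : {set L}) (x : L) D : 1 < Q ->
  (24 / ((Q - 1) * planar_const)) ^+ 2 <= D.+1%:R ->
  planar_rate D / 2 * pinnedZ (@cellZ R 2 a L) Q S <= pinnedZ (@cellZ R 2 a L) Q (x |: S)%SET.
Proof.
move=> Q1 HD; rewrite !pinnedZ_slabs ?(ltW Q1)//.
have Q0 : 0 <= Q - 1 by rewrite subr_ge0 ltW.
have r0 := planar_rate_gt0 D.
have slab0 (A : {set L}) : 0 <= slabZ a A by exact: slabZ_ge0.
apply: (@le_trans _ _ (planar_rate D * \sum_(A : {set L} | touches x (A :|: S)%SET D)
    (Q - 1) ^+ #|A| * slabZ a (A :|: S)%SET)).
  have := shell_sum S x Q1 HD; rewrite -mulrA ler_pM2l//; lra.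
rewrite mulr_sumr big_mkcond; apply: ler_sum => A _; case: ifPn => [t|_]; last first.
  by rewrite mulr_ge0// exprn_ge0.
rewrite mulrCA ler_wpM2l ?exprn_ge0//.
have -> : (A :|: (x |: S) = x |: (A :|: S))%SET by rewrite finset.setUCA.
apply: (planar_insert t (leq0n _) (leq0n _)).
by rewrite /plane !mulr0n !addr0.
Qed.

End PinningDensity.

(** * Independence of one site from the others *)

Section Independence.
Context {R : realType} {d : nat} {disp : measure_display} {T : measurableType disp}.
Variables (P : probability T R) (e : site d -> {RV P >-> R}).
Hypothesis indep : mutually_independent e.
Implicit Types (J : {fset site d}).

Definition cylinder J (B : site d -> set R) : set T := \bigcap_(x in [set` J]) (e x @^-1` B x).

Definition cylinders J : set (set T) :=
  [set C | exists2 B, (forall x, measurable (B x)) & C = cylinder J B].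

(** Measurability on this copy of T expresses dependence on the disorder at the sites of J only. *)
Definition restricted_space J := g_sigma_algebraType (cylinders J).

Lemma measurable_cylinder J B : (forall x, measurable (B x)) -> measurable (cylinder J B).
Proof.
move=> mB; apply: fin_bigcap_measurable; first exact: finite_fset.
by move=> x _; rewrite -[X in measurable X]setTI; exact: measurable_funPT.
Qed.

Lemma cylinders_measurable J : cylinders J `<=` measurable.
Proof. by move=> _ [B mB ->]; exact: measurable_cylinder. Qed.

Lemma restricted_measurable J (C : set T) :
  (measurable : set (set (restricted_space J))) C -> measurable C.
Proof.
exact: (smallest_sub (@sigma_algebra_measurable _ T) (@cylinders_measurable J)).
Qed.

Lemma measurable_restricted_id J : measurable_fun setT (fun w : T => (w : restricted_space J)).
Proof. by move=> _ C mC; rewrite setTI; exact: restricted_measurable mC. Qed.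

Lemma measurable_restricted J x : x \in J ->
  measurable_fun setT (fun w : restricted_space J => e x w).
Proof.
move=> xJ _ B mB; rewrite setTI; apply: sub_sigma_algebra.
exists (fun y => if y == x then B else setT) => [y|]; first by case: ifP.
apply/seteqP; split=> [w Bw y yJ /=|w /(_ x xJ)/=]; last by rewrite eqxx.
by case: eqVneq => // ->.
Qed.

(** For fixed A both sides are finite measures in C, and they agree on the cylinders, which form a
    pi-system. *)
Lemma indep_restricted J k (A : set R) (C : set T) : k \notin J -> measurable A ->
  (measurable : set (set (restricted_space J))) C ->
  P (e k @^-1` A `&` C) = (P (e k @^-1` A) * P C)%E.
Proof.
move=> kJ mA mC.
have mkA : measurable (e k @^-1` A).
  by rewrite -[X in measurable X]setTI; exact: measurable_funPT.
have fkA : P (e k @^-1` A) \is a fin_num by rewrite fin_num_measure.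
have rP : 0 <= fine (P (e k @^-1` A)) by rewrite fine_ge0.
pose m1 : {measure set T -> \bar R} := mrestr P mkA.
pose m2 : {measure set T -> \bar R} := mscale (NngNum rP) P.
have m2E D : m2 D = (P (e k @^-1` A) * P D)%E by rewrite /m2/= /mscale/= fineK.
rewrite setIC -m2E -[LHS]/(m1 C).
apply: (@g_sigma_algebra_measure_unique _ R T (cylinders J) _ (fun=> setT) _ _ m1 m2) => //.
- exact: cylinders_measurable.
- move=> _; exists (fun=> setT) => //.
  by apply/esym/seteqP; split => // w _ x _.
- by apply/seteqP; split => // w _; exists 0%N.
- move=> _ _ [B1 mB1 ->] [B2 mB2 ->]; exists (fun x => B1 x `&` B2 x).
    by move=> x; exact: measurableI.
  apply/seteqP; split=> [w [h1 h2] x xJ|w h]; first by split; [exact: h1|exact: h2].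
  by split=> x xJ; have [] := h x xJ.
- move=> _ [B mB ->]; rewrite m2E /m1/= /mrestr.
  pose B' x := if x == k then A else B x.
  have mB' x : measurable (B' x) by rewrite /B'; case: ifP.
  have BB' x : x \in J -> B' x = B x.
    by rewrite /B'; case: eqVneq => // ->; rewrite (negbTE kJ).
  have cE : cylinder J B = cylinder J B'.
    by apply: eq_bigcapr => x xJ; rewrite BB'.
  have kE : cylinder J B `&` (e k @^-1` A) = cylinder (k |` J)%fset B'.
    rewrite cE; apply/seteqP; split=> [w [h1 h2] x|w h].
      by rewrite /= in_fset1U => /predU1P[->|xJ]; [rewrite /B' eqxx|exact: h1].
    split=> [x xJ|]; first by apply: h; rewrite /= in_fset1U xJ orbT.
    by have := h k; rewrite /= /B' eqxx; apply; rewrite fset1U1.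
  rewrite kE cE /cylinder !indep// big_fsetU1//=.
  by congr (_ * _)%E; rewrite /B' eqxx.
- by move=> _; rewrite /m1/= /mrestr setTI (le_lt_trans (probability_le1 P mkA))// ltry.
Qed.

(** The joint law of [e k] and of the point of [restricted_space J] is a product measure, so Tonelli
    applies. *)
Lemma indep_integral J k (g : R -> R) (f : restricted_space J -> R) : k \notin J ->
  measurable_fun setT g -> (forall t, 0 <= g t) ->
  measurable_fun setT f -> (forall w, 0 <= f w) ->
  (\int[P]_w (f w * g (e k w))%:E = \int[P]_w (f w)%:E * \int[P]_w (g (e k w))%:E)%E.
Proof.
move=> kJ mg g0 mf f0.
have mid := @measurable_restricted_id J.
pose idJ : {mfun T >-> restricted_space J} :=
  HB.pack (fun w : T => (w : restricted_space J)) (isMeasurableFun.Build _ _ _ _ _ mid).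
have mpr : measurable_fun setT (fun w : T => (e k w, w : restricted_space J)).
  by apply/measurable_fun_pairP; split => //=; exact: measurable_funPT.
pose pr : {mfun T >-> (R * restricted_space J)%type} :=
  HB.pack (fun w : T => (e k w, w : restricted_space J)) (isMeasurableFun.Build _ _ _ _ _ mpr).
pose m1 := distribution P (e k).
pose m2 := distribution P idJ.
pose F (z : R * restricted_space J) := (f z.2 * g z.1)%:E.
have mF : measurable_fun setT F.
  apply/measurable_EFinP; apply: measurable_funM.
    exact: (measurableT_comp mf measurable_snd).
  exact: (measurableT_comp mg measurable_fst).
have F0 z : (0 <= F z)%E by rewrite lee_fin mulr_ge0.
transitivity (\int[distribution P pr]_z F z)%E.
  by rewrite ge0_integral_distribution.
transitivity (\int[(m1 \x m2)%E]_z F z)%E.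
  apply: eq_measure_integral => A mA _; apply/esym.
  apply: (@product_measure_unique _ _ R (restricted_space J) R m1 m2 (distribution P pr)) => //.
  move=> B C mB mC; rewrite /m1 /m2 /distribution /pushforward/=.
  by rewrite -(indep_restricted kJ mB mC).
rewrite (fubini_tonelli2 F)//.
transitivity (\int[m2]_w ((f w)%:E * \int[m1]_t (g t)%:E))%E.
  apply: eq_integral => w _; rewrite /fubini_G/= -ge0_integralZl ?lee_fin//.
  - exact/measurable_EFinP.
  - by move=> t _; rewrite lee_fin.
rewrite ge0_integralZr//=.
- congr (_ * _)%E.
    by rewrite (ge0_integral_distribution idJ (f := fun w => (f w)%:E))//; exact/measurable_EFinP.
  by rewrite (ge0_integral_distribution (e k) (f := fun t => (g t)%:E))//; exact/measurable_EFinP.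
- exact/measurable_EFinP.
- by move=> w _; rewrite lee_fin.
- by apply: integral_ge0 => t _; rewrite lee_fin.
Qed.

(** Equality of laws is applied to positive and negative parts, so that logarithms are covered
    before their integrability is known. *)
Lemma identical_integral (g : R -> R) x y : identically_distributed e ->
  measurable_fun setT g ->
  (\int[P]_w (g (e x w))%:E = \int[P]_w (g (e y w))%:E)%E.
Proof.
move=> id mg.
have key (f : R -> \bar R) : measurable_fun setT f -> (forall t, 0 <= f t)%E ->
    (\int[P]_w f (e x w) = \int[P]_w f (e y w))%E.
  move=> mf f0.
  rewrite -[LHS](ge0_integral_distribution (e x))// -[RHS](ge0_integral_distribution (e y))//.
  by apply: eq_measure_integral => A mA _; exact: id.
pose G (t : R) := (g t)%:E.
have mG : measurable_fun setT G by exact/measurable_EFinP.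
have hp := key (G^\+)%E (measurable_funepos mG) (funepos_ge0 G).
have hn := key (G^\-)%E (measurable_funeneg mG) (funeneg_ge0 G).
rewrite [LHS]integralE [RHS]integralE; congr (_ - _)%E.
  rewrite -[LHS]/(\int[P]_w ((G \o e x)^\+ w))%E -[RHS]/(\int[P]_w ((G \o e y)^\+ w))%E.
  by rewrite (funepos_comp G (e x)) (funepos_comp G (e y)).
rewrite -[LHS]/(\int[P]_w ((G \o e x)^\- w))%E -[RHS]/(\int[P]_w ((G \o e y)^\- w))%E.
by rewrite (funeneg_comp G (e x)) (funeneg_comp G (e y)).
Qed.

End Independence.

Lemma Rintegral_EFin {R : realType} {disp : measure_display} {T : measurableType disp}
    (mu : {measure set T -> \bar R}) (f : T -> R) :
  mu.-integrable setT (EFin \o f) ->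
  ((\int[mu]_w f w)%:E = \int[mu]_w (f w)%:E)%E.
Proof. by move=> fi; rewrite /Rintegral fineK// integrable_fin_num. Qed.

(** * Interpolation between the quenched and the annealed model *)

Section Disorder.
Context {R : realType} {d : nat} {disp : measure_display} {T : measurableType disp}.
Variables (P : probability T R) (e : site d -> {RV P >-> R}) (b h : R).
Hypothesis indep : mutually_independent e.
Hypothesis ident : identically_distributed e.
Hypothesis exp_moment : forall x, ('E_P[fun w => expR (b * e x w + h)%R] < +oo)%E.
Local Notation l := (log_mgf b h e).

Lemma prob_integral_cst (r : R) : (\int[P]_w r%:E = r%:E)%E.
Proof. by have := expectation_cst P r; rewrite unlock. Qed.

Definition gam (x : site d) (w : T) : R := expR (b * e x w + h - l).

Lemma gam_ge0 x w : 0 <= gam x w. Proof. exact: expR_ge0. Qed.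

Lemma measurable_exp_affine (c : R) : measurable_fun setT (fun t : R => expR (b * t + h - c)).
Proof.
apply: measurableT_comp => //; apply: measurable_funB => //; apply: measurable_funD => //.
Qed.

Lemma measurable_gam x : measurable_fun setT (gam x).
Proof. exact: (measurableT_comp (measurable_exp_affine l) (@measurable_funPT _ _ _ _ (e x))). Qed.

Lemma exp_log_mgf x : (\int[P]_w (expR (b * e x w + h))%:E = (expR l)%:E)%E.
Proof.
pose g (t : R) := expR (b * t + h).
have mg : measurable_fun setT g.
  by have := measurable_exp_affine 0; under eq_fun do rewrite subr0.
have -> := identical_integral x 0 ident mg.
have E0 : (\int[P]_w (g (e 0 w))%:E)%E \is a fin_num.
  rewrite ge0_fin_numE; last by apply: integral_ge0 => w _; rewrite lee_fin expR_ge0.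
  by have := exp_moment 0; rewrite unlock.
(* Positivity is required for [expR] to invert [ln]: a zero mean would make a positive integrand
   vanish almost everywhere. *)
have E1 : (0 < \int[P]_w (g (e 0 w))%:E)%E.
  rewrite lt0e integral_ge0 ?andbT; last by move=> w _; rewrite lee_fin expR_ge0.
  apply/negP => /eqP int0.
  have : (\int[P]_w `|(g (e 0 w))%:E| = 0)%E.
    by rewrite -int0; apply: eq_integral => w _; rewrite gee0_abs// lee_fin expR_ge0.
  have mge : measurable_fun setT (fun w => (g (e 0 w))%:E).
    by apply/measurable_EFinP; exact: (measurableT_comp mg (@measurable_funPT _ _ _ _ (e 0))).
  move=> /(ae_eq_integral_abs P measurableT mge) [N [mN N0 sN]].
  have NT : N = setT.
    rewrite -subTset => w _; apply: sN => /= /(_ I) [] /eqP.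
    by rewrite gt_eqF// expR_gt0.
  by have := @probability_setT _ _ _ P; rewrite -NT N0 => /eqP; rewrite eqe eq_sym oner_eq0.
by rewrite /log_mgf unlock -/(g _) lnK ?fineK// posrE fine_gt0// E1 -ge0_fin_numE ?ltW.
Qed.

Lemma gam_mean x : (\int[P]_w (gam x w)%:E = 1)%E.
Proof.
have -> : (fun w => (gam x w)%:E) = (fun w => (expR (- l))%:E * (expR (b * e x w + h))%:E)%E.
  by apply/funext => w; rewrite -EFinM -expRD addrC.
rewrite ge0_integralZl//.
- by rewrite exp_log_mgf -EFinM -expRD addNr expR0.
- apply/measurable_EFinP; have := measurable_exp_affine 0.
  under eq_fun do rewrite subr0.
  by move=> m; exact: (measurableT_comp m (@measurable_funPT _ _ _ _ (e x))).
Qed.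

Section Box.
Variables (L : {fset site d}) (K : {set L} -> R) (c : R).
Hypothesis K_ge0 : forall A, 0 <= K A.
Hypothesis K0_gt0 : 0 < K finset.set0.
Hypothesis c_ge0 : 0 <= c.
Implicit Types (u : L -> R) (k : L) (s : seq L).
Local Notation rest k := (L `\ val k)%fset.

(** Interpolates between c gamma at u = 0 and the constant c at u = c, with mean c throughout; u is
    the deterministic share of the reward. *)
Definition weights u (w : T) (x : L) : R := u x + (c - u x) * gam (val x) w.

Lemma weights_ge0 u w x : 0 <= u x <= c -> 0 <= weights u w x.
Proof. by move=> /andP[u0 uc]; rewrite addr_ge0// mulr_ge0 ?gam_ge0// subr_ge0. Qed.

Lemma measurable_weights (J : {fset site d}) u (x : L) : val x \in J ->
  measurable_fun setT (fun w : restricted_space e J => weights u w x).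
Proof.
move=> xJ; apply: measurable_funD => //; apply: measurable_funM => //.
exact: (measurableT_comp (measurable_exp_affine l) (@measurable_restricted R d disp T P e J (val x) xJ)).
Qed.

Lemma measurable_coef0 k u :
  measurable_fun setT (fun w : restricted_space e (rest k) => coef0 K k (weights u w)).
Proof.
rewrite (_ : (fun w => _) = (fun w : restricted_space e (rest k) => \sum_(A : {set L})
    (if k \notin A then K A * \prod_(x <- enum A) weights u w x else 0))); last first.
  apply/funext => w; rewrite /coef0 big_mkcond; apply: eq_bigr => A _.
  by case: ifP => // _; rewrite big_enum.
apply: measurable_sum => A; case: (boolP (k \notin A)) => kA //; apply: measurable_funM => //.
apply: measurable_prod => x; rewrite mem_enum => xA.
apply: measurable_weights; rewrite in_fsetD1 (valP x) andbT.
by apply: contra kA => /eqP/val_inj <-.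
Qed.

Lemma measurable_coef1 k u :
  measurable_fun setT (fun w : restricted_space e (rest k) => coef1 K k (weights u w)).
Proof.
rewrite (_ : (fun w => _) = (fun w : restricted_space e (rest k) => \sum_(A : {set L})
    (if k \in A then K A * \prod_(x <- [seq x <- enum A | x != k]) weights u w x else 0)));
    last first.
  apply/funext => w; rewrite /coef1 big_mkcond; apply: eq_bigr => A _.
  by case: ifP => // _; rewrite big_filter big_enum_cond.
apply: measurable_sum => A; case: (boolP (k \in A)) => kA //; apply: measurable_funM => //.
apply: measurable_prod => x; rewrite mem_filter => /andP[xk _].
by apply: measurable_weights; rewrite in_fsetD1 (valP x) andbT (inj_eq val_inj).
Qed.

Lemma measurable_weights_prod u (A : {set L}) :
  measurable_fun setT (fun w : T => \prod_(x in A) weights u w x).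
Proof.
rewrite (_ : (fun w => _) = (fun w : T => \prod_(x <- enum A) weights u w x)); last first.
  by apply/funext => w; rewrite big_enum.
apply: measurable_prod => x _.
apply: measurable_funD => //; apply: measurable_funM => //; exact: measurable_gam.
Qed.

Lemma measurable_weightZ u : measurable_fun setT (fun w : T => weightZ K (weights u w)).
Proof.
apply: measurable_sum => A; apply: measurable_funM => //.
exact: measurable_weights_prod.
Qed.

Lemma weights_prod_mean u s : (forall x, 0 <= u x <= c) -> uniq s ->
  (\int[P]_w (\prod_(x <- s) weights u w x)%:E = (c ^+ size s)%:E)%E.
Proof.
move=> uc; elim: s => [_|k s IH].
  by under eq_integral do rewrite big_nil; rewrite prob_integral_cst.
rewrite cons_uniq => /andP[ks us].
have [u0 uk] := andP (uc k).
pose g (t : R) := u k + (c - u k) * expR (b * t + h - l).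
have mg : measurable_fun setT g.
  by apply: measurable_funD => //; apply: measurable_funM => //; exact: measurable_exp_affine.
have g0 t : 0 <= g t by rewrite addr_ge0// mulr_ge0 ?subr_ge0// expR_ge0.
pose f (w : restricted_space e (rest k)) := \prod_(x <- s) weights u w x.
have mf : measurable_fun setT f.
  apply: measurable_prod => x xs; apply: measurable_weights.
  rewrite in_fsetD1 (valP x) andbT; apply: contra ks => /eqP/val_inj <- //.
have f0 w : 0 <= f w by rewrite prodr_ge0// => x _; exact: weights_ge0.
have kJ : val k \notin rest k by rewrite in_fsetD1 eqxx.
have := indep_integral indep kJ mg g0 mf f0.
have -> : (\int[P]_w (g (e (val k) w))%:E = c%:E)%E.
  have -> : (fun w => (g (e (val k) w))%:E) =
      (fun w => (u k)%:E + (c - u k)%:E * (gam (val k) w)%:E)%E by [].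
  rewrite ge0_integralD//.
  - rewrite prob_integral_cst ge0_integralZl ?lee_fin ?subr_ge0//.
    + by rewrite gam_mean mule1 -EFinD addrC subrK.
    + by apply/measurable_EFinP; exact: measurable_gam.
    + by move=> w _; rewrite lee_fin gam_ge0.
  - by move=> w _; rewrite mule_ge0// lee_fin ?subr_ge0 ?gam_ge0.
  - by apply: measurable_funeM; apply/measurable_EFinP; exact: measurable_gam.
rewrite /f IH// -EFinM => fE.
rewrite [size _]/= exprSr -fE; apply: eq_integral => w _.
by rewrite big_cons mulrC.
Qed.

(** A site occurs at most once in each term and has mean weight c whatever u is, so the
    interpolation never changes the annealed partition function. *)
Lemma weightZ_mean u : (forall x, 0 <= u x <= c) ->
  (\int[P]_w (weightZ K (weights u w))%:E = (weightZ K (fun=> c))%:E)%E.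
Proof.
move=> uc; rewrite /weightZ -sumEFin; under eq_integral do rewrite -sumEFin.
have m (A : {set L}) : measurable_fun setT (fun w => \prod_(x in A) weights u w x).
  exact: measurable_weights_prod.
have p0 (A : {set L}) w : 0 <= \prod_(x in A) weights u w x.
  by rewrite prodr_ge0// => x _; exact: weights_ge0.
rewrite ge0_integral_sum//.
- apply: eq_bigr => A _; under eq_integral do rewrite EFinM.
  rewrite ge0_integralZl ?lee_fin//.
  + rewrite EFinM; congr (_ * _)%E; rewrite prodr_const cardE.
    by rewrite -(weights_prod_mean uc (enum_uniq _)); apply: eq_integral => w _; rewrite big_enum.
  + by apply/measurable_EFinP.
  + by move=> w _; rewrite lee_fin.
- by move=> A; apply/measurable_EFinP; apply: measurable_funM.
- by move=> A w _; rewrite lee_fin mulr_ge0.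
Qed.

(** The logarithm lies between the constant ln of the empty-set coefficient and the partition
    function itself, whose mean is finite. *)
Lemma integrable_ln_weightZ u : (forall x, 0 <= u x <= c) ->
  P.-integrable setT (EFin \o (fun w => ln (weightZ K (weights u w)))).
Proof.
move=> uc.
have Wint : P.-integrable setT (EFin \o (fun w => `|ln (K finset.set0)| + weightZ K (weights u w))).
  rewrite (_ : _ \o _ = (cst `|ln (K finset.set0)|%:E \+ (EFin \o (fun w => weightZ K (weights u w))))%E)//.
  apply: integrableD => //; first exact: finite_measure_integrable_cst.
  apply/integrableP; split; first by apply/measurable_EFinP; exact: measurable_weightZ.
  rewrite (eq_integral (fun w => (weightZ K (weights u w))%:E)) ?weightZ_mean ?ltry//.
  move=> w _ /=; rewrite ger0_norm// (le_trans (ltW K0_gt0))// weightZ_ge// => x.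
  exact: weights_ge0.
apply: le_integrable Wint => //.
  apply/measurable_EFinP; apply: (measurableT_comp (@measurable_ln R)); exact: measurable_weightZ.
move=> w _ /=; rewrite lee_fin.
have W0 : K finset.set0 <= weightZ K (weights u w) by apply: weightZ_ge => // x; exact: weights_ge0.
have Wp : 0 < weightZ K (weights u w) by exact: lt_le_trans W0.
rewrite [leRHS]ger0_norm ?addr_ge0 ?normr_ge0//; last exact: ltW.
have h1 : ln (K finset.set0) <= ln (weightZ K (weights u w)) by rewrite ler_ln.
have h2 := ltW (ln_sublinear Wp).
rewrite ler_norml; apply/andP; split; last by have := normr_ge0 (ln (K finset.set0)); lra.
have := ler_norm (- ln (K finset.set0)); rewrite normrN; lra.
Qed.

Lemma integrable_gam x : P.-integrable setT (EFin \o gam x).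
Proof.
apply/integrableP; split; first by apply/measurable_EFinP; exact: measurable_gam.
rewrite (eq_integral (fun w => (gam x w)%:E)) ?gam_mean ?ltry// => w _ /=.
by rewrite ger0_norm// gam_ge0.
Qed.

Lemma mean_decoupled k (C : restricted_space e (rest k) -> R) :
  measurable_fun setT C -> (forall w, 0 <= C w <= 1) ->
  P.-integrable setT (EFin \o (fun w : T => C w * (gam (val k) w - 1))) /\
  \int[P]_w (C w * (gam (val k) w - 1)) = 0.
Proof.
move=> mC C01.
have mCT : measurable_fun setT (fun w : T => C w).
  exact: (measurableT_comp mC (@measurable_restricted_id _ _ _ _ P e (rest k))).
have C0 w : 0 <= C w by case/andP: (C01 w).
have iC : P.-integrable setT (EFin \o (fun w : T => C w)).
  have i1 : P.-integrable setT (EFin \o cst (1 : R)) by exact: finite_measure_integrable_cst.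
  apply: le_integrable i1 => //.
    exact/measurable_EFinP.
  by move=> w _ /=; rewrite lee_fin normr1 ger0_norm//; case/andP: (C01 w).
have iCg : P.-integrable setT (EFin \o (fun w : T => C w * gam (val k) w)).
  have ig := integrable_gam (val k); apply: le_integrable ig => //.
    by apply/measurable_EFinP; apply: measurable_funM => //; exact: measurable_gam.
  move=> w _ /=; rewrite lee_fin normrM ler_piMl// ger0_norm//.
  by case/andP: (C01 w).
have CgE : (fun w : T => C w * (gam (val k) w - 1)) = (fun w => C w * gam (val k) w - C w).
  by apply/funext => w; rewrite mulrBr mulr1.
split.
  rewrite CgE (_ : _ \o _ = (EFin \o (fun w : T => (C w * gam (val k) w)%R)) \-
     (EFin \o (fun w : T => C w)))%E//.
  exact: integrableB.
rewrite CgE RintegralB//.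
have kJ : val k \notin rest k by rewrite in_fsetD1 eqxx.
have := indep_integral indep kJ (measurable_exp_affine l) (fun t => expR_ge0 _) mC C0.
rewrite -[X in (_ = _ * X)%E -> _]/(\int[P]_w (gam (val k) w)%:E)%E gam_mean mule1 => CE.
apply/eqP; rewrite subr_eq0; apply/eqP/EFin_inj.
by rewrite !Rintegral_EFin.
Qed.

(** [ln_affine_le] in expectation: its correction is a bounded function of the other sites times
    gamma - 1, and [mean_decoupled] makes it vanish. *)
Lemma ln_replace k (al be al' be' : restricted_space e (rest k) -> R) :
  measurable_fun setT al -> measurable_fun setT be -> measurable_fun setT be' ->
  (forall w, [/\ 0 < al w, 0 <= be w, al w <= al' w, 0 <= be' w &
     al w + be w = al' w + be' w]) ->
  P.-integrable setT (EFin \o (fun w : T => ln (al w + be w * gam (val k) w))) ->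
  P.-integrable setT (EFin \o (fun w : T => ln (al' w + be' w * gam (val k) w))) ->
  \int[P]_w ln (al w + be w * gam (val k) w) <= \int[P]_w ln (al' w + be' w * gam (val k) w).
Proof.
move=> mal mbe mbe' cond i1 i2.
pose C (w : restricted_space e (rest k)) := (be w - be' w) / (al w + be w).
have abp w : 0 < al w + be w by have [al0 be0 _ _ _] := cond w; exact: ltr_pwDl.
have mC : measurable_fun setT C.
  have -> : C = fun w => (be w - be' w) * expR (- ln (al w + be w)).
    by apply/funext => w; rewrite /C expRN lnK// posrE.
  apply: measurable_funM; first exact: measurable_funB.
  apply: measurableT_comp => //; apply: measurableT_comp => //.
  apply: (measurableT_comp (@measurable_ln R)); exact: measurable_funD.
have C01 w : 0 <= C w <= 1.
  have [al0 be0 aa be'0 ee] := cond w; have ab := abp w.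
  rewrite /C divr_ge0 ?(ltW ab)//=; last by lra.
  by rewrite ler_pdivrMr// mul1r; lra.
have [iC C0] := mean_decoupled mC C01.
rewrite -[leRHS]addr0 -C0 -RintegralD//.
apply: le_Rintegral => //.
  rewrite (_ : _ \o _ = (EFin \o (fun w : T => ln (al' w + be' w * gam (val k) w))) \+
     (EFin \o (fun w : T => (C w * (gam (val k) w - 1))%R)))%E//.
  exact: integrableD.
move=> w _; have [al0 be0 aa be'0 ee] := cond w.
by apply: ln_affine_le => //; exact: gam_ge0.
Qed.

Lemma weights_eq_off k u u' w : (forall x, x != k -> u x = u' x) ->
  forall x, x != k -> weights u w x = weights u' w x.
Proof. by move=> uu x xk; rewrite /weights uu. Qed.

Lemma weightZ_split k u w : weightZ K (weights u w) =
  (coef0 K k (weights u w) + u k * coef1 K k (weights u w)) +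
  (c - u k) * coef1 K k (weights u w) * gam (val k) w.
Proof. by rewrite (weightZ_affine _ k) {2}/weights; ring. Qed.

Local Notation ELn u := (\int[P]_w ln (weightZ K (weights u w))).

Lemma ELn_le k u u' : (forall x, 0 <= u x <= c) -> (forall x, 0 <= u' x <= c) ->
  (forall x, x != k -> u x = u' x) -> u k <= u' k -> ELn u <= ELn u'.
Proof.
move=> uc uc' uu ukk.
have i1 := integrable_ln_weightZ uc; have i2 := integrable_ln_weightZ uc'.
have E1 w : ln (weightZ K (weights u w)) =
  ln ((coef0 K k (weights u w) + u k * coef1 K k (weights u w)) +
  (c - u k) * coef1 K k (weights u w) * gam (val k) w) by rewrite -weightZ_split.
have E2 w : ln (weightZ K (weights u' w)) =
  ln ((coef0 K k (weights u w) + u' k * coef1 K k (weights u w)) +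
  (c - u' k) * coef1 K k (weights u w) * gam (val k) w).
  have ww := weights_eq_off w uu.
  by rewrite (coef0_eq _ ww) (coef1_eq _ ww) -weightZ_split.
rewrite (funext E1) (funext E2) in i1 i2 *.
have m0 := @measurable_coef0 k u; have m1 := @measurable_coef1 k u.
apply: (ln_replace (k := k)
  (al := fun w => coef0 K k (weights u w) + u k * coef1 K k (weights u w))
  (be := fun w => (c - u k) * coef1 K k (weights u w))
  (al' := fun w => coef0 K k (weights u w) + u' k * coef1 K k (weights u w))
  (be' := fun w => (c - u' k) * coef1 K k (weights u w))) => //.
- by apply: measurable_funD => //; apply: measurable_funM.
- by apply: measurable_funM.
- by apply: measurable_funM.
- move=> w; have w0 x : 0 <= weights u w x by exact: weights_ge0.
  have c0 : 0 < coef0 K k (weights u w) by apply: lt_le_trans (coef0_ge K_ge0 k w0).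
  have c1 := coef1_ge0 K_ge0 k w0.
  have [uk0 ukc] := andP (uc k); have [uk0' ukc'] := andP (uc' k).
  split.
  + by rewrite ltr_pwDl// mulr_ge0.
  + by rewrite mulr_ge0// subr_ge0.
  + by rewrite lerD2l ler_wpM2r.
  + by rewrite mulr_ge0// subr_ge0.
  + by ring.
Qed.

Lemma integrable_ln_mixture p x : 0 <= p < 1 ->
  P.-integrable setT (EFin \o (fun w => ln (p * gam x w + 1 - p))).
Proof.
move=> /andP[p0 p1].
have q0 : 0 < 1 - p by rewrite subr_gt0.
have Wint : P.-integrable setT (EFin \o (fun w => `|ln (1 - p)| + 1 + gam x w)).
  rewrite (_ : _ \o _ = (cst (`|ln (1 - p)| + 1)%:E \+ (EFin \o gam x))%E)//.
  apply: integrableD => //; first exact: finite_measure_integrable_cst.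
  exact: integrable_gam.
apply: le_integrable Wint => //.
  apply/measurable_EFinP; apply: (measurableT_comp (@measurable_ln R)).
  apply: measurable_funB => //; apply: measurable_funD => //.
  by apply: measurable_funM => //; exact: measurable_gam.
move=> w _ /=; rewrite lee_fin; have g0 := gam_ge0 x w; set g := gam x w in g0 *.
have lb : 1 - p <= p * g + 1 - p by have := mulr_ge0 p0 g0; lra.
have n0 : 0 < p * g + 1 - p by exact: lt_le_trans lb.
rewrite [leRHS]ger0_norm ?addr_ge0 ?normr_ge0//.
have h1 : ln (1 - p) <= ln (p * g + 1 - p) by rewrite ler_ln.
have h2 := ltW (ln_sublinear n0).
have h3 : p * g <= g by rewrite ler_piMl// ltW.
have := ler_norm (- ln (1 - p)); rewrite normrN => h4.
by rewrite ler_norml; apply/andP; split; have := normr_ge0 (ln (1 - p)); lra.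
Qed.

Lemma mixture_identical p x y : \int[P]_w ln (p * gam x w + 1 - p) =
  \int[P]_w ln (p * gam y w + 1 - p).
Proof.
congr fine.
apply: (identical_integral x y (g := fun t => ln (p * expR (b * t + h - l) + 1 - p))) => //.
apply: (measurableT_comp (@measurable_ln R)).
apply: measurable_funB => //; apply: measurable_funD => //.
by apply: measurable_funM => //; exact: measurable_exp_affine.
Qed.

(** Let W be the value at gamma = 1. The assumption says that p is at most the share of the slope in
    W, so the slope may be lowered to p W; then ln (W (1 - p + p gamma)) splits into the term with
    deterministic reward c at k and the gain. *)
Lemma ELn_pin k u u' p : 0 <= p < 1 -> (forall x, 0 <= u x <= c) ->
  (forall x, x != k -> u x = u' x) -> u' k = c ->
  (forall w, p * (coef0 K k (weights u w) + c * coef1 K k (weights u w)) <=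
    (c - u k) * coef1 K k (weights u w)) ->
  ELn u <= ELn u' + \int[P]_w ln (p * gam 0 w + 1 - p).
Proof.
move=> p01 uc uu ukc Hp; have [p0 p1] := andP p01.
have uc' x : 0 <= u' x <= c.
  by have [->|xk] := eqVneq x k; [rewrite ukc c_ge0 lexx|rewrite -uu].
have i1 := integrable_ln_weightZ uc; have i2 := integrable_ln_weightZ uc'.
have i3 := integrable_ln_mixture (val k) p01.
rewrite (mixture_identical p 0 (val k)) -RintegralD//.
have E1 w : ln (weightZ K (weights u w)) =
  ln ((coef0 K k (weights u w) + u k * coef1 K k (weights u w)) +
  (c - u k) * coef1 K k (weights u w) * gam (val k) w) by rewrite -weightZ_split.
pose W w := coef0 K k (weights u w) + c * coef1 K k (weights u w).
have w0 w x : 0 <= weights u w x by exact: weights_ge0.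
have c0 w : 0 < coef0 K k (weights u w) by apply: lt_le_trans (coef0_ge K_ge0 k (w0 w)).
have c1 w := coef1_ge0 K_ge0 k (w0 w).
have W0 w : 0 < W w by rewrite ltr_pwDl// mulr_ge0.
have E2 w : ln (weightZ K (weights u' w)) + ln (p * gam (val k) w + 1 - p) =
  ln (W w * (1 - p) + (W w * p) * gam (val k) w).
  have -> : weightZ K (weights u' w) = W w.
    rewrite (weightZ_split k) ukc subrr !mul0r addr0 /W.
    by have ww := weights_eq_off w uu; rewrite (coef0_eq _ ww) (coef1_eq _ ww).
  rewrite -lnM ?posrE//; first by congr ln; ring.
  by have := mulr_ge0 p0 (gam_ge0 (val k) w); lra.
have i4 : P.-integrable setT (EFin \o (fun w =>
    ln (weightZ K (weights u' w)) + ln (p * gam (val k) w + 1 - p))).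
  rewrite (_ : _ \o _ = ((EFin \o (fun w => ln (weightZ K (weights u' w)))) \+
    (EFin \o (fun w => ln (p * gam (val k) w + 1 - p))))%E)//.
  exact: integrableD.
rewrite (funext E1) in i1 *; rewrite (funext E2) in i4 *.
have m0 := @measurable_coef0 k u; have m1 := @measurable_coef1 k u.
have mW : measurable_fun setT (W : restricted_space e (rest k) -> R).
  by apply: measurable_funD => //; apply: measurable_funM.
have [uk0 uk1] := andP (uc k).
apply: (ln_replace (k := k)
  (al := fun w => coef0 K k (weights u w) + u k * coef1 K k (weights u w))
  (be := fun w => (c - u k) * coef1 K k (weights u w))
  (al' := fun w => W w * (1 - p)) (be' := fun w => W w * p)) => //.
- by apply: measurable_funD => //; apply: measurable_funM.
- by apply: measurable_funM.
- by apply: measurable_funM.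
- move=> w; have := Hp w; rewrite -/(W w) => Hw; split.
  + by rewrite ltr_pwDl// mulr_ge0.
  + by rewrite mulr_ge0// subr_ge0.
  + by move: Hw; rewrite /W; lra.
  + by rewrite mulr_ge0// ltW.
  + by rewrite /W; ring.
Qed.

End Box.

(** Two sweeps over the sites. Raising u from 0 to Q everywhere only raises the mean logarithm, and
    gives every site the deterministic share on which the odds rest; raising u from Q to Q^2 site by
    site then collects one term in p per site. *)
Lemma quenched_annealed (L : {fset site d}) (K : {set L} -> R) (Q r p : R) :
  (forall A, 0 <= K A) -> 0 < K finset.set0 -> 1 <= Q ->
  (forall (S : {set L}) (k : L), k \notin S -> r * pinnedZ K Q S <= pinnedZ K Q (k |: S)%SET) ->
  0 <= p < 1 -> p <= (Q - 1) * r * (1 - p) ->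
  \int[P]_w ln (weightZ K (fun x => Q ^+ 2 * gam (val x) w)) <=
  ln (weightZ K (fun=> Q ^+ 2)) + #|` L|%:R * \int[P]_w ln (p * gam 0 w + 1 - p).
Proof.
move=> K0 Kp Q1 ins p01 pr; have [p0 p1] := andP p01.
have Q0 : 0 < Q by apply: lt_le_trans Q1.
pose c := Q ^+ 2; have c0 : 0 <= c by rewrite exprn_ge0// ltW.
have Qc : Q <= c by rewrite /c expr2 ler_peMl// ltW.
pose ELn u := \int[P]_w ln (weightZ K (weights c u w)).
set phi := \int[P]_w ln (p * gam 0 w + 1 - p).
pose u1 (s : seq L) (x : L) := if x \in s then Q else 0.
pose u2 (s : seq L) (x : L) := if x \in s then c else Q.
have u1c s x : 0 <= u1 s x <= c by rewrite /u1; case: ifP; rewrite ?lexx ?c0 ?Qc ?(ltW Q0).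
have u2c s x : 0 <= u2 s x <= c by rewrite /u2; case: ifP; rewrite ?lexx ?c0 ?Qc ?(ltW Q0).
have phase1 s : ELn (u1 [::]) <= ELn (u1 s).
  elim: s => [|k s IH]; first exact: lexx.
  apply: (le_trans IH); apply: (@ELn_le L K c K0 Kp k) => // [x xk|].
    by rewrite /u1 inE (negbTE xk).
  by rewrite /u1 inE eqxx/=; case: ifP => // _; exact: ltW.
have phase2 s : uniq s -> ELn (u2 [::]) <= ELn (u2 s) + (size s)%:R * phi.
  elim: s => [_|k s IH]; first by rewrite mul0r addr0.
  rewrite cons_uniq => /andP[ks us]; apply: (le_trans (IH us)).
  rewrite [size _]/= -natr1 mulrDl mul1r [_ * phi + phi]addrC addrA lerD2r.
  apply: (@ELn_pin L K c K0 Kp c0 k) => // [x xk||w].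
  - by rewrite /u2 inE (negbTE xk).
  - by rewrite /u2 inE eqxx.
  (* Sites already made deterministic and sites still random both have the form Q (1 + v), with v =
     Q - 1 and v = (Q - 1) gamma. *)
  pose v (x : L) : R := (Q - 1) * (if x \in s then 1 else gam (val x) w).
  have v0 x : 0 <= v x by rewrite mulr_ge0 ?subr_ge0//; case: ifP => // _; exact: gam_ge0.
  have wv x : x != k -> weights c (u2 s) w x = Q * (1 + v x).
    by move=> _; rewrite /weights /u2 /v /c; case: ifP => _; ring.
  have := pinning_odds Q0 v0 (fun S kS => ins S k kS).
  have u2k : u2 s k = Q by rewrite /u2 (negbTE ks).
  rewrite -(coef0_eq _ wv) -(coef1_eq _ wv) u2k.
  set a0 := coef0 _ _ _; set a1 := coef1 _ _ _ => h1.
  have w0 x : 0 <= weights c (u2 s) w x by exact: weights_ge0.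
  have a00 : 0 <= a0 by apply: le_trans (coef0_ge K0 k w0); exact: ltW.
  have a10 : 0 <= a1 by exact: coef1_ge0.
  have -> : c = Q * Q by rewrite /c expr2.
  have h2 : (Q - 1) * (1 - p) * (r * (a0 + Q * a1)) <= (Q - 1) * (1 - p) * (Q * a1).
    by rewrite ler_wpM2l// mulr_ge0 ?subr_ge0// ltW.
  have h3 : p * (a0 + Q * a1) <= (Q - 1) * r * (1 - p) * (a0 + Q * a1).
    by rewrite ler_wpM2r// addr_ge0// mulr_ge0// ltW.
  lra.
have h1 := phase1 (enum (fset_sub_type L)); have h2 := phase2 (enum (fset_sub_type L)) (enum_uniq _).
have e1 : u1 (enum (fset_sub_type L)) = u2 [::] by apply/funext => x; rewrite /u1 /u2 mem_enum.
have e2 : ELn (u2 (enum (fset_sub_type L))) = ln (weightZ K (fun=> c)).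
  rewrite /ELn (_ : (fun w => _) = fun=> ln (weightZ K (fun=> c))); last first.
    apply/funext => w; congr (ln (weightZ K _)); apply/funext => x.
    by rewrite /weights /u2 mem_enum/= subrr mul0r addr0.
  by rewrite /Rintegral prob_integral_cst.
have e3 : ELn (u1 [::]) = \int[P]_w ln (weightZ K (fun x => Q ^+ 2 * gam (val x) w)).
  congr (Rintegral _ _ _); apply/funext => w; congr (ln (weightZ K _)); apply/funext => x.
  by rewrite /weights /u1/= add0r subr0.
rewrite -e3 -e2 (le_trans h1)// e1 (le_trans h2)// -cardE.
by rewrite cardfE.
Qed.

End Disorder.

(** * Free energies in finite volume and in the limit *)

Section FreeEnergy.
Context {R : realType} {d : nat} {disp : measure_display} {T : measurableType disp}.
Variables (P : probability T R) (e : site d -> {RV P >-> R}) (a b h : R).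
Hypothesis d_gt0 : (0 < d)%N.
Hypothesis a_gt0 : 0 < a.
Hypothesis b_gt0 : 0 < b.
Hypothesis indep : mutually_independent e.
Hypothesis ident : identically_distributed e.
Hypothesis mean0 : forall x, ('E_P[e x] = 0)%E.
Hypothesis var1 : forall x, ('V_P[e x] = 1)%E.
Hypothesis exp_moment : forall x, ('E_P[fun w => expR (b * e x w + h)%R] < +oo)%E.
Local Notation l := (log_mgf b h e).
Local Notation phi p := (\int[P]_w ln (p * gam e b h 0 w + 1 - p)).

Lemma prob_Rintegral_cst (r : R) : \int[P]_w r = r.
Proof. by rewrite /Rintegral prob_integral_cst. Qed.

Lemma Z_disorder_weightZ (L : {fset site d}) w :
  Z_disorder a b h (fun x => e x w) L =
  weightZ (@cellZ R d a L) (fun x => expR l * gam e b h (val x) w).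
Proof.
rewrite /Z_disorder partition_fun_weightZ//; congr weightZ; apply/funext => x.
by rewrite /gam -expRD [X in expR X = _](_ : _ = l + (b * e (val x) w + h - l)) //; ring.
Qed.

Lemma weights_zero (L : {fset site d}) c w :
  weights e b h c (fun=> 0) w = (fun x : L => c * gam e b h (val x) w).
Proof. by apply/funext => x; rewrite /weights add0r subr0. Qed.

Section Box.
Variable L : {fset site d}.
Hypothesis L_neq0 : (0 < #|` L|)%N.
Local Notation K := (@cellZ R d a L).

Let K_ge0 A : 0 <= K A. Proof. exact: cellZ_ge0. Qed.
Let K0_gt0 : 0 < K finset.set0. Proof. exact: cellZ0_gt0. Qed.

Lemma Z_free_gt0 : 0 < Z_free R L.
Proof.
rewrite (Z_free_weightZ d_gt0 a L); apply: (lt_le_trans K0_gt0).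
by apply: weightZ_ge.
Qed.

Let W_gt0 w : 0 < weightZ K (fun x => expR l * gam e b h (val x) w).
Proof.
apply: (lt_le_trans K0_gt0); apply: weightZ_ge => // x.
by rewrite mulr_ge0 ?expR_ge0// gam_ge0.
Qed.

Lemma annealed_feE : annealed_fe a b h e L =
  #|` L|%:R^-1 * (ln (weightZ K (fun=> expR l)) - ln (Z_free R L)).
Proof.
rewrite /annealed_fe; congr (_ * _); rewrite -ln_div ?posrE ?Z_free_gt0//; last first.
  by apply: (lt_le_trans K0_gt0); apply: weightZ_ge => // x; exact: expR_ge0.
congr (ln (_ / _)); rewrite unlock.
have c0 (x : L) : 0 <= (0 : R) <= expR l by rewrite lexx expR_ge0.
have := weightZ_mean indep ident exp_moment K_ge0 c0 => mE.
rewrite (_ : (fun w => (Z_disorder _ _ _ _ _)%:E) =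
   (fun w => (weightZ K (weights e b h (expR l) (fun=> 0) w))%:E)) ?mE//.
by apply/funext => w; rewrite weights_zero Z_disorder_weightZ.
Qed.

Let quenched_feE : (fun w => quenched_fe a b h (fun x => e x w) L) =
  fun w => #|` L|%:R^-1 * (ln (weightZ K (fun x => expR l * gam e b h (val x) w)) -
    ln (Z_free R L)).
Proof.
apply/funext => w; rewrite /quenched_fe Z_disorder_weightZ; congr (_ * _).
by rewrite ln_div// posrE ?W_gt0 ?Z_free_gt0.
Qed.

Local Notation lnW := (fun w => ln (weightZ K (fun x : L => (expR l * gam e b h (val x) w)%R))).

Let integrable_lnW : P.-integrable setT
  (EFin \o lnW).
Proof.
have c0 (x : L) : 0 <= (0 : R) <= expR l by rewrite lexx expR_ge0.
have := integrable_ln_weightZ indep ident exp_moment K_ge0 K0_gt0 c0.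
by rewrite (_ : (fun w => ln _) = lnW)//;
  apply/funext => w; rewrite weights_zero.
Qed.

Let integrable_diff : P.-integrable setT
  (EFin \o (fun w => lnW w - ln (Z_free R L))).
Proof.
rewrite (_ : _ \o _ = ((EFin \o lnW) \- (EFin \o cst (ln (Z_free R L))))%E)//.
by apply: integrableB => //; exact: finite_measure_integrable_cst.
Qed.

Lemma integrable_quenched_fe :
  P.-integrable setT (EFin \o (fun w => quenched_fe a b h (fun x => e x w) L)).
Proof.
rewrite quenched_feE.
rewrite (_ : _ \o _ = (fun w => (#|` L|%:R^-1)%:E * (EFin \o (fun w =>
  (lnW w - ln (Z_free R L))%R)) w)%E)//.
exact: integrableZl.
Qed.

Lemma quenched_mean_le (r p : R) : 0 <= l ->
  (forall (S : {set L}) (k : L), k \notin S ->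
    r * pinnedZ K (expR (l / 2)) S <= pinnedZ K (expR (l / 2)) (k |: S)%SET) ->
  0 <= p < 1 -> p <= (expR (l / 2) - 1) * r * (1 - p) ->
  \int[P]_w quenched_fe a b h (fun x => e x w) L <= annealed_fe a b h e L + phi p.
Proof.
move=> l0 ins p01 pr.
have Q1 : 1 <= expR (l / 2) by rewrite -expR0 ler_expR divr_ge0.
have Q2 : expR (l / 2) ^+ 2 = expR l by rewrite expr2 -expRD -splitr.
have := quenched_annealed indep ident exp_moment K_ge0 K0_gt0 Q1 ins p01 pr.
rewrite Q2 quenched_feE RintegralZl// RintegralB//; last exact: finite_measure_integrable_cst.
have N0 : 0 < #|` L|%:R :> R by rewrite ltr0n.
rewrite annealed_feE prob_Rintegral_cst => h1.
have -> : phi p = #|` L|%:R^-1 * (#|` L|%:R * phi p) by rewrite mulKf// lt0r_neq0.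
by rewrite -mulrDr ler_pM2l ?invr_gt0//; lra.
Qed.

(** Used in contraposition: a positive annealed free energy forces l > 0. *)
Lemma annealed_fe_le0 : l <= 0 -> annealed_fe a b h e L <= 0.
Proof.
move=> l0; rewrite annealed_feE mulr_ge0_le0 ?invr_ge0// subr_le0.
rewrite ler_ln ?posrE ?Z_free_gt0//; last first.
  by apply: (lt_le_trans K0_gt0); apply: weightZ_ge => // x; exact: expR_ge0.
rewrite (Z_free_weightZ d_gt0 a L); apply: le_weightZ => // x.
by rewrite expR_ge0 -expR0 ler_expR.
Qed.

End Box.

Lemma ln_mixture_le (p g : R) : 0 <= p < 1 -> 0 <= g ->
  ln (p * g + 1 - p) <= p * (g - 1) ?= iff ((p == 0) || (g == 1)).
Proof.
move=> /andP[p0 p1] g0.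
have n0 : 0 < 1 + p * (g - 1) by have := mulr_ge0 p0 g0; lra.
have -> : p * g + 1 - p = 1 + p * (g - 1) by ring.
have iffE : (p * (g - 1) == 0) = ((p == 0) || (g == 1)) by rewrite mulf_eq0 subr_eq0.
split; first by apply: le_ln1Dx; move: n0; lra.
rewrite -iffE; have [->|x0] := eqVneq (p * (g - 1)) 0; first by rewrite addr0 ln1 eqxx.
apply/negbTE; rewrite lt_eqF// -ltr_expR lnK ?posrE//.
exact: expR_gt1Dx.
Qed.

(** Equality in Jensen would force gamma = 1 and hence, as b > 0, a constant [e 0] almost surely.
    Mean zero makes this constant 0, against variance one. *)
Lemma phi_lt0 p : 0 < p < 1 -> phi p < 0.
Proof.
move=> /andP[p0 p1]; have p01 : 0 <= p < 1 by rewrite ltW.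
have ig := integrable_gam ident exp_moment 0.
have il := integrable_ln_mixture ident exp_moment 0 p01.
have i1 : P.-integrable setT (EFin \o cst (1 : R)) by exact: finite_measure_integrable_cst.
have ig1 : P.-integrable setT (EFin \o (fun w => gam e b h 0 w - 1)).
  rewrite (_ : _ \o _ = ((EFin \o gam e b h 0) \- (EFin \o cst 1%R)))%E//.
  exact: integrableB.
have ipg : P.-integrable setT (EFin \o (fun w => p * (gam e b h 0 w - 1))).
  rewrite (_ : _ \o _ = (fun w => p%:E * (EFin \o (fun w => gam e b h 0 w - 1)%R) w))%E//.
  exact: integrableZl.
have Epg : \int[P]_w (p * (gam e b h 0 w - 1)) = 0.
  rewrite RintegralZl// RintegralB//.
  by rewrite prob_Rintegral_cst /Rintegral gam_mean// subrr mulr0.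
rewrite ltNge; apply/negP => phi0.
pose D w := p * (gam e b h 0 w - 1) - ln (p * gam e b h 0 w + 1 - p).
have D0 w : 0 <= D w by rewrite subr_ge0 (ln_mixture_le p01)// gam_ge0.
have iD : P.-integrable setT (EFin \o D).
  rewrite (_ : _ \o _ = ((EFin \o (fun w => p * (gam e b h 0 w - 1))%R) \-
     (EFin \o (fun w => ln (p * gam e b h 0 w + 1 - p)))))%E//.
  exact: integrableB.
have ED : (\int[P]_w `|(D w)%:E| = 0)%E.
  rewrite (eq_integral (fun w => (D w)%:E)); last by move=> w _; rewrite gee0_abs// lee_fin.
  rewrite -Rintegral_EFin//; congr EFin; apply/le_anti/andP; split; last first.
    by apply: Rintegral_ge0.
  by rewrite /D RintegralB// Epg sub0r oppr_le0.
have mD := measurable_int P iD.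
have [N [mN N0 sN]] := (ae_eq_integral_abs P measurableT mD).1 ED.
pose m := (l - h) / b.
have em : ae_eq P setT (fun w => (e 0 w)%:E) (fun=> m%:E).
  exists N; split => // w /= hw; apply: sN => /= /(_ I)[] /eqP.
  rewrite subr_eq0 eq_sym => De; apply: hw => _; congr EFin.
  have := (ln_mixture_le p01 (gam_ge0 e b h 0 w)).2; rewrite De gt_eqF//= => /esym.
  rewrite /gam => /eqP /(congr1 (@ln R)); rewrite expRK ln1 => eq0.
  have e1 : b * e 0 w = l - h by apply/eqP; rewrite -subr_eq0 opprB addrA; apply/eqP.
  by rewrite /m -e1 mulrAC divff ?mul1r// lt0r_neq0.
have me : measurable_fun setT (fun w => (e 0 w)%:E).
  by apply/measurable_EFinP; exact: measurable_funPT.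
have m0 : m = 0.
  have eE : (\int[P]_w (e 0 w)%:E = \int[P]_w m%:E)%E by apply: ae_eq_integral em.
  have := mean0 0; rewrite unlock eE.
  by rewrite prob_integral_cst => -[].
have := var1 0; rewrite /variance unlock mean0 unlock/=.
have -> : (\int[P]_x (((e 0 x - 0) * (e 0 x - 0))%R)%:E = \int[P]_x (0%:E))%E.
  apply: ae_eq_integral => //.
    apply/measurable_EFinP; apply: measurable_funM; apply: measurable_funB => //;
      exact: measurable_funPT.
  case: em => [M [mM M0 sM]]; exists M; split => // w /= hw; apply: sM => /= he; apply: hw.
  by move=> _; have [->] := he I; rewrite m0 subrr mulr0.
by rewrite prob_integral_cst => -[] /eqP; rewrite eq_sym oner_eq0.
Qed.

Lemma quenched_annealed_limit (L : nat -> {fset site d}) (fq fa f : R) :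
  (\forall n \near \oo, (0 < #|` L n|)%N) ->
  (\forall n \near \oo, \int[P]_w quenched_fe a b h (fun x => e x w) (L n) <=
    annealed_fe a b h e (L n) + f) ->
  is_quenched_limit a b h e L fq -> is_annealed_limit a b h e L fa -> fq <= fa + f.
Proof.
move=> Lpos le_n [_ hq] ha.
apply/ler_addgt0Pr => eps eps0.
pose del := eps / 2; have del0 : 0 < del by rewrite divr_gt0.
have near_a : \forall n \near \oo, annealed_fe a b h e (L n) <= fa + del.
  have := ha; rewrite /is_annealed_limit => /cvgrPdist_le /(_ _ del0).
  by apply: filterS => n; rewrite ler_distl => /andP[? ?]; lra.
have nbhs_q : nbhs (0%E : \bar R) [set y | (y < (del ^+ 2)%:E)%E].
  apply: open_nbhs_nbhs; split; first exact: open_ereal_lt_ereal.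
  by rewrite /= lte_fin exprn_gt0.
have near_q := hq _ nbhs_q.
near \oo => n.
have Ln : (0 < #|` L n|)%N by near: n.
have le1 : \int[P]_w quenched_fe a b h (fun x => e x w) (L n) <= annealed_fe a b h e (L n) + f.
  by near: n.
have le2 : annealed_fe a b h e (L n) <= fa + del by near: n.
have le3 : ('E_P[fun w => ((quenched_fe a b h (fun x => e x w) (L n) - fq) ^+ 2)%R] <
    (del ^+ 2)%:E)%E by near: n.
pose X w := quenched_fe a b h (fun x => e x w) (L n).
have iX : P.-integrable setT (EFin \o X) by exact: integrable_quenched_fe.
have mX : measurable_fun setT X by apply/measurable_EFinP; exact: measurable_int iX.
pose Y w := (X w - fq) ^+ 2.
have EY : (\int[P]_w (Y w)%:E < (del ^+ 2)%:E)%E by have := le3; rewrite unlock.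
have iY : P.-integrable setT (EFin \o Y).
  apply/integrableP; split.
    apply/measurable_EFinP; apply: measurable_funX; exact: measurable_funB.
  rewrite (eq_integral (fun w => (Y w)%:E)); first by rewrite (lt_trans EY)// ltry.
  by move=> w _ /=; rewrite ger0_norm// sqr_ge0.
have EY' : \int[P]_w Y w < del ^+ 2 by rewrite -lte_fin Rintegral_EFin.
have iZ : P.-integrable setT (EFin \o (fun w => (2 * del)^-1 * Y w)).
  rewrite (_ : _ \o _ = (fun w => ((2 * del)^-1)%:E * (EFin \o Y) w)%E)//.
  exact: integrableZl.
have i1 r : P.-integrable setT (EFin \o cst (r : R)) by exact: finite_measure_integrable_cst.
have iC : P.-integrable setT (EFin \o (fun w => (fq - del / 2) - (2 * del)^-1 * Y w)).
  rewrite (_ : _ \o _ = ((EFin \o cst (fq - del / 2)%R) \-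
     (EFin \o (fun w => ((2 * del)^-1 * Y w)%R))))%E//.
  exact: integrableB.
(* A completed square: X >= fq - del / 2 - (X - fq)^2 / (2 del) pointwise, so a mean square distance
   below del^2 puts the mean of X above fq - del. *)
have : \int[P]_w ((fq - del / 2) - (2 * del)^-1 * Y w) <= \int[P]_w X w.
  apply: le_Rintegral => // w _; rewrite -subr_ge0.
  have -> : X w - ((fq - del / 2) - (2 * del)^-1 * Y w) = (X w - fq + del) ^+ 2 / (2 * del).
    by rewrite /Y; field; exact: lt0r_neq0.
  by rewrite divr_ge0 ?sqr_ge0// mulr_ge0// ltW.
rewrite RintegralB//; last exact: i1.
rewrite prob_Rintegral_cst RintegralZl// => lower.
have : (2 * del)^-1 * \int[P]_w Y w <= del / 2.
  rewrite ler_pdivrMl ?mulr_gt0//; move: EY'; rewrite expr2; lra.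
rewrite -/X in le1; move: lower le1 le2; rewrite /del; lra.
Unshelve. all: by end_near. Qed.

End FreeEnergy.

(** * Choice of the constants and of lambda *)

Section Constants.
Context {R : realType}.

(** Since 1/4 = 1/2 * 1/2 and ln (1 - 1/2) <= - 1/2. *)
Lemma abs_ln_ge1 (x : R) : 0 < x <= 4^-1 -> 1 <= `|ln x|.
Proof.
move=> /andP[x0 x4].
have h2 : ln (2^-1) <= - 2^-1 :> R.
  rewrite [X in ln X](_ : _ = 1 + (- 2^-1)); first by apply: le_ln1Dx; lra.
  by field.
have h4 : ln (4^-1) <= -1 :> R.
  rewrite [X in ln X](_ : _ = 2^-1 * 2^-1); last by field.
  rewrite lnM ?posrE ?invr_gt0 ?ltr0n//.
  by rewrite [leRHS](_ : _ = - 2^-1 + - 2^-1) ?lerD//; field.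
have lx : ln x <= -1 by apply: le_trans h4; rewrite ler_ln ?posrE// invr_gt0.
have ln0 : ln x <= 0 by apply: le_trans lx _; exact: lerN10.
by rewrite ler0_norm// lerNr.
Qed.

Lemma harm_le_ln n : harm n.+1 <= 1 + ln n.+1%:R :> R.
Proof.
elim: n => [|n IH]; first by rewrite /harm big_ord1 invr1 ln1 addr0.
rewrite /harm big_ord_recr/=; apply: (le_trans (lerD IH (lexx _))).
rewrite -addrA lerD2l -lerBrDl -ln_div ?posrE//.
have n2 : n.+2%:R != 0 :> R by rewrite pnatr_eq0.
have h : ln (n.+1%:R / n.+2%:R) <= - n.+2%:R^-1 :> R.
  have -> : n.+1%:R / n.+2%:R = 1 + (- n.+2%:R^-1) :> R.
    by rewrite -[n.+1%:R](addrK 1) natr1 mulrBl divff// mul1r.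
  apply: le_ln1Dx; rewrite ltrN2 invf_lt1// ltr1n//.
have -> : n.+2%:R / n.+1%:R = (n.+1%:R / n.+2%:R)^-1 :> R by rewrite invf_div.
by rewrite lnV ?posrE ?divr_gt0 ?ltr0n// lerNr.
Qed.

Variable a : R.
Hypothesis a_gt0 : 0 < a.
Local Notation cP := (planar_const a).

(** The division by 2 comes from exp (l / 2) - 1 >= l / 2. *)
Definition spatial_constant : R := pin_rate a 1728 / 2.

(* The scale beyond which unpinned squares have negligible weight. *)
Definition pinning_scale (l : R) : nat := Num.truncn ((48 / (l * cP)) ^+ 2).
Definition planar_pinning (l : R) : R := planar_rate a (pinning_scale l) / 2.
(** Here 48 = 12 * 4, with 12 from [planar_pinning_lb] and 4 from the odds in [planar_lambda_odds];
    the minimum with 1 ensures lambda <= l below the cutoff. *)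
Definition planar_constant : R := Num.min 1 (cP / 48).
(** Below 1/4 one has |ln l| >= 1; below the second term the constant in [pinning_scale] is absorbed
    by one more power of 1 / l. *)
Definition planar_cutoff : R := Num.min 4^-1 ((48 / cP) ^- 2).
(** Above the cutoff the value is free: being at most 1/4 it satisfies lambda / |ln lambda| <=
    lambda, and it is taken at most the available odds. *)
Definition planar_lambda (l : R) : R :=
  if l < planar_cutoff then planar_constant * l / Num.sqrt `|ln l|
  else Num.min 4^-1 (l * planar_pinning l / 4).

Let cP0 : 0 < cP. Proof. exact: planar_const_gt0. Qed.

Lemma pinning_scale_ge (l q : R) : 0 < l -> l / 2 <= q ->
  (24 / (q * cP)) ^+ 2 <= (pinning_scale l).+1%:R.
Proof.
move=> l0 lq; apply: (le_trans _ (ltW (truncnS_gt _))).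
move: cP0; set c := cP => c0.
have q0 : 0 < q by apply: lt_le_trans lq; rewrite divr_gt0.
have qc0 : 0 < q * c by rewrite mulr_gt0.
have lc0 : 0 < l * c by rewrite mulr_gt0.
have x0 : 0 <= 24 / (q * c) by apply: divr_ge0; [exact: ler0n|exact: ltW].
suff xy : 24 / (q * c) <= 48 / (l * c) by rewrite !expr2; exact: ler_pM.
rewrite ler_pdivrMr// mulrAC ler_pdivlMr//.
have := ler_wpM2r (ltW c0) lq; lra.
Qed.

Lemma spatial_constant_gt0 : 0 < spatial_constant.
Proof.
apply: divr_gt0; last exact: ltr0n.
by apply: pin_rate_gt0; [exact: a_gt0|exact: ltr0n].
Qed.

Lemma planar_constant_gt0 : 0 < planar_constant.
Proof. by rewrite lt_min ltr01/=; apply: divr_gt0; [exact: cP0|exact: ltr0n]. Qed.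

Lemma planar_cutoff_itv : 0 < planar_cutoff < 1.
Proof.
have K0 : 0 < (48 / cP) ^+ 2 by apply/exprn_gt0/divr_gt0; [exact: ltr0n|exact: cP0].
apply/andP; split; first by rewrite lt_min !invr_gt0 ltr0n K0.
by rewrite gt_min invf_lt1 ?ltr0n// ltr1n.
Qed.

Lemma planar_pinning_gt0 l : 0 < planar_pinning l.
Proof. by apply: divr_gt0; [exact: planar_rate_gt0|exact: ltr0n]. Qed.

Lemma planar_lambda_itv l : 0 < l -> 0 < planar_lambda l <= 4^-1.
Proof.
move=> l0; rewrite /planar_lambda; case: ifPn => [|_]; last first.
  have r0 := mulr_gt0 l0 (planar_pinning_gt0 l).
  by rewrite lt_min ge_min lexx invr_gt0 ltr0n (divr_gt0 r0) ?ltr0n.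
rewrite {1}/planar_cutoff lt_min => /andP[l4 _].
have y1 : 1 <= `|ln l| by apply: abs_ln_ge1; rewrite l0 ltW.
have s1 : 1 <= Num.sqrt `|ln l| by rewrite -[1]sqrtr1 ler_wsqrtr.
have s0 : 0 < Num.sqrt `|ln l| by apply: lt_le_trans s1.
rewrite (divr_gt0 (mulr_gt0 planar_constant_gt0 l0) s0)/= ler_pdivrMr//.
have c1 : planar_constant <= 1 by rewrite ge_min lexx.
have c0 := planar_constant_gt0.
have : planar_constant * l <= 1 * l by rewrite ler_wpM2r// ltW.
by move: l4 s1; set y := Num.sqrt _; set c := planar_constant; set q := 4^-1; nra.
Qed.

(** Below the cutoff the scale is at most l^(-3) and its successor at most l^(-4), whence harm + 1
    <= 2 + 4 |ln l| <= 6 |ln l|; the halving in [planar_pinning] makes the 12. *)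
Lemma planar_pinning_lb l : 0 < l < planar_cutoff ->
  cP / 12 <= planar_pinning l * `|ln l|.
Proof.
move=> /andP[l0]; rewrite {1}/planar_cutoff lt_min => /andP[l4 lK].
have y1 : 1 <= `|ln l| by apply: abs_ln_ge1; rewrite l0 ltW.
have l1 : l < 1 by lra.
have yE : `|ln l| = - ln l by rewrite ler0_norm// ln_le0// ltW.
pose K : R := (48 / cP) ^+ 2.
have K0 : 0 < K by apply/exprn_gt0/divr_gt0; [exact: ltr0n|exact: cP0].
have Kl : K <= l^-1.
  by rewrite -[K]invrK lef_pV2 ?posrE ?invr_gt0// ltW.
have trE : (pinning_scale l)%:R <= K / l ^+ 2.
  have -> : K / l ^+ 2 = (48 / (l * cP)) ^+ 2.
    by rewrite /K; field; rewrite !lt0r_neq0.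
  by rewrite truncn_le sqr_ge0.
have D4 : (pinning_scale l).+1%:R <= l ^- 4.
  have li : 4 <= l^-1 by rewrite -[4]invrK lef_pV2 ?posrE ?invr_gt0// ltW.
  rewrite -natr1; have -> : l ^- 4 = l^-1 * l^-1 * l^-1 * l^-1.
    by field; exact: lt0r_neq0.
  apply: (@le_trans _ _ (l^-1 * l^-1 * l^-1 + 1)).
    rewrite lerD2r; apply: (le_trans trE).
    have -> : K / l ^+ 2 = K * (l^-1 * l^-1) by field; exact: lt0r_neq0.
    by rewrite -[leRHS]mulrA; apply: ler_wpM2r => //; rewrite mulr_ge0// invr_ge0 ltW.
  by move: li; set x := l^-1 => x4; have := mulr_ge0 (sqr_ge0 x) (sqr_ge0 x); nra.
have hD : harm (pinning_scale l) + 1 <= 6 * `|ln l|.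
  have h1 : harm (pinning_scale l) <= harm (pinning_scale l).+1 :> R.
    by rewrite /harm big_ord_recr/= lerDl invr_ge0.
  have h2 := harm_le_ln (pinning_scale l).
  have h3 : ln (pinning_scale l).+1%:R <= ln (l ^- 4).
    by rewrite ler_ln// posrE ?ltr0n// invr_gt0 exprn_gt0.
  have h4 : ln (l ^- 4) = 4 * `|ln l|.
    by rewrite lnV ?posrE ?exprn_gt0// lnXn// yE -mulr_natl; ring.
  lra.
rewrite /planar_pinning /planar_rate.
have hp := harm1_gt0 (R := R) (pinning_scale l).
move: cP0 hp hD; set c := cP; set H := _ + 1; set y := `|ln l| => c0 H0 Hy.
have -> : c / H / 2 * y = c * y / (2 * H) by field; exact: lt0r_neq0.
rewrite ler_pdivlMr ?mulr_gt0// mulrAC ler_pdivrMr//.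
have := ler_wpM2l (ltW c0) Hy; lra.
Qed.

(** Below the cutoff lambda <= l gives |ln lambda| >= |ln l|, so the left side is at most
    [planar_constant] l / |ln l|, and [planar_pinning_lb] concludes. *)
Lemma planar_lambda_odds l : 0 < l ->
  planar_lambda l / `|ln (planar_lambda l)| <= l * planar_pinning l / 4.
Proof.
move=> l0; have /andP[m0 m4] := planar_lambda_itv l0.
have z1 : 1 <= `|ln (planar_lambda l)| by apply: abs_ln_ge1; rewrite m0 m4.
have r0 := planar_pinning_gt0 l.
have [lc|lc] := ltP l planar_cutoff; last first.
  apply: (@le_trans _ _ (planar_lambda l)).
    by rewrite ler_pdivrMr ?(lt_le_trans ltr01 z1)// ler_peMr// ltW.
  by rewrite /planar_lambda ltNge lc/= ge_min lexx orbT.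
have lb : cP / 12 <= planar_pinning l * `|ln l| by apply: planar_pinning_lb; rewrite l0.
have l4 : l < 4^-1 by move: lc; rewrite {1}/planar_cutoff lt_min => /andP[].
have y1 : 1 <= `|ln l| by apply: abs_ln_ge1; rewrite l0 ltW.
have s1 : 1 <= Num.sqrt `|ln l| by rewrite -[1]sqrtr1 ler_wsqrtr.
have s0 : 0 < Num.sqrt `|ln l| by apply: lt_le_trans s1.
have lamE : planar_lambda l = planar_constant * l / Num.sqrt `|ln l|.
  by rewrite /planar_lambda lc.
have c0 := planar_constant_gt0.
have c1 : planar_constant <= 1 by rewrite ge_min lexx.
have c48 : planar_constant <= cP / 48 by rewrite ge_min lexx orbT.
have lam_cl : planar_lambda l <= planar_constant * l.
  by rewrite lamE ler_pdivrMr// ler_peMr// ltW// mulr_gt0.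
have lam_l : planar_lambda l <= l.
  by apply: (le_trans lam_cl); rewrite ler_piMl// ltW.
have zy : `|ln l| <= `|ln (planar_lambda l)|.
  have l1 : l <= 1 by lra.
  rewrite !ler0_norm ?ln_le0 ?(le_trans lam_l)// lerN2 ler_ln ?posrE//.
have y0 : 0 < `|ln l| by apply: lt_le_trans y1.
apply: (@le_trans _ _ (planar_constant * l / `|ln l|)).
  apply: ler_pM; [exact: ltW| | exact: lam_cl |]; first by rewrite invr_ge0.
  by rewrite lef_pV2 ?posrE// (lt_le_trans y0).
rewrite ler_pdivrMr//.
have : l * cP / 12 <= l * (planar_pinning l * `|ln l|) by rewrite -mulrA ler_wpM2l// ltW.
have : planar_constant * l <= cP / 48 * l by rewrite ler_wpM2r// ltW.
set u := planar_constant * l; set c := cP; set q := planar_pinning l; set y := `|ln l|.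
by lra.
Qed.

End Constants.

Lemma van_hove_card_gt0 (R : realType) (d : nat) (L : nat -> {fset site d}) :
  van_hove R L -> \forall n \near \oo, (0 < #|` L n|)%N.
Proof.
move=> [mono cover _]; have [m mL] := cover 0.
exists m => // n /= mn; rewrite cardfs_gt0; apply/fset0Pn; exists 0.
by move/fsubsetP: (mono _ _ mn); apply.
Qed.

Definition planar_weight {R : realType} (a l : R) : R :=
  planar_lambda a l / `|ln (planar_lambda a l)|.

Lemma planar_weight_itv {R : realType} (a m : R) : 0 < a -> 0 < m ->
  0 < planar_weight a m <= 4^-1.
Proof.
move=> a_gt0 m0; rewrite /planar_weight; have /andP[x0 x4] := planar_lambda_itv a_gt0 m0.
have z1 : 1 <= `|ln (planar_lambda a m)| by apply: abs_ln_ge1; rewrite x0.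
have z0 := lt_le_trans ltr01 z1.
rewrite (divr_gt0 x0 z0)/= ler_pdivrMr//; apply: (le_trans x4).
by rewrite ler_peMr// invr_ge0 ler0n.
Qed.

(** * The gap between the limiting free energies *)

Section Gap.
Context {R : realType} {d : nat} {disp : measure_display} {T : measurableType disp}.
Variables (P : probability T R) (e : site d -> {RV P >-> R}) (a b h : R).
Hypothesis d_ge2 : (2 <= d)%N.
Hypothesis a_gt0 : 0 < a.
Hypothesis indep : mutually_independent e.
Hypothesis ident : identically_distributed e.
Hypothesis exp_moment : forall x, ('E_P[fun w => expR (b * e x w + h)%R] < +oo)%E.
Variables (L : nat -> {fset site d}) (fq fa : R).
Hypothesis L_van_hove : van_hove R L.
Hypothesis quenched_limit : is_quenched_limit a b h e L fq.
Hypothesis annealed_limit : is_annealed_limit a b h e L fa.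
Hypothesis fa_gt0 : 0 < fa.
Local Notation l := (log_mgf b h e).
Local Notation phi p := (\int[P]_w ln (p * gam e b h 0 w + 1 - p)).

Let d_gt0 : (0 < d)%N. Proof. exact: leq_trans d_ge2. Qed.

Lemma log_mgf_gt0 : 0 < l.
Proof.
rewrite ltNge; apply/negP => l0; have := fa_gt0; rewrite ltNge => /negP; apply.
have lim_fa := cvg_lim (@Rhausdorff R) annealed_limit; rewrite -lim_fa.
apply: limr_le; first exact: cvgP annealed_limit.
by apply: nearW => n; exact: annealed_fe_le0.
Qed.

Let half_le_odds : l / 2 <= expR (l / 2) - 1.
Proof. by rewrite lerBrDl; exact: expR_ge1Dx. Qed.

Lemma free_energy_gap (r p : R) :
  (forall n (S : {set L n}) (k : L n), k \notin S ->
    r * pinnedZ (@cellZ R d a (L n)) (expR (l / 2)) S <=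
    pinnedZ (@cellZ R d a (L n)) (expR (l / 2)) (k |: S)%SET) ->
  0 <= r -> 0 <= p < 1 -> p <= l / 2 * r * (1 - p) -> fq <= fa + phi p.
Proof.
move=> ins r0 p01 pr; have l0 := log_mgf_gt0.
have pos := van_hove_card_gt0 L_van_hove.
apply: (quenched_annealed_limit d_gt0 indep ident exp_moment pos _
  quenched_limit annealed_limit).
apply: filterS pos => n Ln; apply: (quenched_mean_le d_gt0 indep ident exp_moment Ln (ltW l0) _ p01).
  by move=> S k kS; exact: ins.
apply: (le_trans pr); rewrite ler_wpM2r ?ler_wpM2r//.
by case/andP: p01 => _ p1; rewrite subr_ge0 ltW.
Qed.

Lemma spatial_weight_itv :
  0 < spatial_constant a * l / (1 + spatial_constant a * l) < 1.
Proof.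
have x0 : 0 < spatial_constant a * l by apply: mulr_gt0; [exact: spatial_constant_gt0|exact: log_mgf_gt0].
by rewrite divr_gt0 ?addr_gt0//= ltr_pdivrMr ?addr_gt0// mul1r ltrDr.
Qed.

Lemma spatial_gap : (3 <= d)%N ->
  fq <= fa + phi (spatial_constant a * l / (1 + spatial_constant a * l)).
Proof.
move=> d3; have /andP[p0 p1] := spatial_weight_itv.
have l0 := log_mgf_gt0.
apply: (@free_energy_gap (pin_rate a 1728)).
- move=> n S k _; apply: pinnedZ_insert_spatial => //.
  by rewrite -expR0 ler_expR divr_ge0// ltW.
- by apply/ltW/pin_rate_gt0; [exact: a_gt0|exact: ltr0n].
- by rewrite ltW.
have x0 : 0 < 1 + spatial_constant a * l by apply/addr_gt0/mulr_gt0 => //; exact: spatial_constant_gt0.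
(* With x = [spatial_constant a * l] the weight p = x / (1 + x) solves p = x (1 - p), so the
   condition holds with equality. *)
rewrite (_ : l / 2 * _ = spatial_constant a * l); last first.
  by rewrite [LHS]mulrAC -[LHS]mulrA mulrC.
move: x0; set x := spatial_constant a * l => x0.
by rewrite le_eqVlt; apply/orP; left; apply/eqP; field; exact: lt0r_neq0.
Qed.

End Gap.

Lemma planar_gap {R : realType} {disp : measure_display} {T : measurableType disp}
    (P : probability T R) (e : site 2 -> {RV P >-> R}) (a b h : R)
    (L : nat -> {fset site 2}) (fq fa : R) :
  0 < a -> mutually_independent e -> identically_distributed e ->
  (forall x, ('E_P[fun w => expR (b * e x w + h)%R] < +oo)%E) ->
  van_hove R L -> is_quenched_limit a b h e L fq -> is_annealed_limit a b h e L fa ->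
  0 < fa ->
  fq <= fa + \int[P]_w ln (planar_weight a (log_mgf b h e) * gam e b h 0 w + 1 -
    planar_weight a (log_mgf b h e)).
Proof.
move=> a0 indep ident em vh hq ha fa0; set l := log_mgf b h e; set p := planar_weight a l.
have d2 : (2 <= 2)%N by [].
have l0 : 0 < l := log_mgf_gt0 d2 indep ident em ha fa0.
have c0 := planar_const_gt0 a0.
have /andP[p0 p4] : 0 < p <= 4^-1 by exact: planar_weight_itv.
have podds : p <= l * planar_pinning a l / 4 by exact: planar_lambda_odds.
have r0 := planar_pinning_gt0 a0 l.
have Q1 : l / 2 <= expR (l / 2) - 1 by rewrite lerBrDl; exact: expR_ge1Dx.
have q0 : 0 < l / 2 by rewrite divr_gt0.
apply: (free_energy_gap d2 indep ident em vh hq ha fa0 (r := planar_pinning a l)).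
- move=> n S k _; apply: pinnedZ_insert_planar => //; first by lra.
  exact: pinning_scale_ge.
- exact: ltW.
- by rewrite (ltW p0); lra.
apply: (le_trans podds).
(* From p <= 1/4; together with the factor l / 2 this is the origin of the 4 in
   [planar_lambda_odds]. *)
have h1 : 2^-1 <= 1 - p by lra.
apply: le_trans (ler_wpM2l (ltW (mulr_gt0 q0 r0)) h1).
by rewrite le_eqVlt; apply/orP; left; apply/eqP; field.
Qed.

Theorem theorem2p5 (R : realType) (a : R) (a_gt0 : 0 < a) :
  exists (C1 C2 l0 : R) (lam : R -> R),
  [/\ 0 < C1, 0 < C2, 0 < l0 < 1,
      (forall l : R, 0 < l ->
         0 < lam l < 1 /\ lam l / `|ln (lam l)| <= 1) &
      (forall l : R, 0 < l < l0 ->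
         lam l = C2 * l / Num.sqrt `|ln l|) ] /\
  forall (d : nat) (b h : R)
    (disp : measure_display) (T : measurableType disp) (P : probability T R)
    (e : site d -> {RV P >-> R}),
    (2 <= d)%N -> 0 < b ->
    mutually_independent e ->
    identically_distributed e ->
    (forall x, 'E_P[e x] = 0)%E ->
    (forall x, 'V_P[e x] = 1)%E ->
    (forall x, ('E_P[fun w => expR (b * e x w + h)%R] < +oo)%E) ->
    forall (L : nat -> {fset site d}) (fq fa : R),
    van_hove R L ->
    is_quenched_limit a b h e L fq ->
    is_annealed_limit a b h e L fa ->
    0 < fa ->
    [/\ fq < fa,
        (3 <= d)%N ->
        let l := log_mgf b h e in
        let p := C1 * l / (1 + C1 * l) in
        ((fq - fa)%:E <= 'E_P[fun w => ln (p * tilt b h e w + 1 - p)%R])%E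
      & d = 2%N ->
        let l := log_mgf b h e in
        let p := lam l / `|ln (lam l)| in
        ((fq - fa)%:E <= 'E_P[fun w => ln (p * tilt b h e w + 1 - p)%R])%E].
Proof.
exists (spatial_constant a), (planar_constant a), (planar_cutoff a), (planar_lambda a).
split.
  split; [exact: spatial_constant_gt0|exact: planar_constant_gt0|exact: planar_cutoff_itv| |].
    move=> l l0; have /andP[x0 x4] := planar_lambda_itv a_gt0 l0.
    have /andP[p0 p4] := planar_weight_itv a_gt0 l0.
    by split; [rewrite x0 (le_lt_trans x4)// invf_lt1 ?ltr0n// ltr1n | apply: (le_trans p4); rewrite invf_le1 ?ltr0n// ler1n].
  by move=> l /andP[_ lc]; rewrite /planar_lambda lc.
move=> d b h disp T P e d2 b0 indep ident mean0 var1 em L fq fa vh hq ha fa0.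
have l0 := log_mgf_gt0 d2 indep ident em ha fa0.
have expE p : 0 < p < 1 -> fq <= fa + \int[P]_w ln (p * gam e b h 0 w + 1 - p) ->
  fq < fa /\ ((fq - fa)%:E <= 'E_P[fun w => ln (p * tilt b h e w + 1 - p)%R])%E.
  move=> p01 le; have := phi_lt0 b0 ident mean0 var1 em p01.
  split; first lra.
  have [p0 p1] := andP p01; have p01' : 0 <= p < 1 by rewrite (ltW p0).
  rewrite unlock -Rintegral_EFin ?lee_fin; first by rewrite lerBlDl.
  exact: (integrable_ln_mixture ident em 0 p01').
have spatial := spatial_gap d2 a_gt0 indep ident em vh hq ha fa0.
have planar : d = 2%N -> fq <= fa + \int[P]_w
    ln (planar_weight a (log_mgf b h e) * gam e b h 0 w + 1 - planar_weight a (log_mgf b h e)).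
  (* The types of the disorder and of the boxes mention d, so both are generalised before d is
     replaced by 2. *)
  move=> d2'; move: e L indep ident em vh hq ha {d2 l0 spatial expE mean0 var1}.
  rewrite d2' => e L indep ident em vh hq ha.
  exact: (planar_gap a_gt0 indep ident em vh hq ha fa0).
have pw : 0 < planar_weight a (log_mgf b h e) < 1.
  by have /andP[-> p4] := planar_weight_itv a_gt0 l0; lra.
have sw := spatial_weight_itv d2 a_gt0 indep ident em ha fa0.
split=> [|d3|d2'].
- have [d3|d3] := leqP 3 d; first exact: (expE _ sw (spatial d3)).1.
  by apply: (expE _ pw (planar _)).1; apply/eqP; rewrite eqn_leq -ltnS d3.
- exact: (expE _ sw (spatial d3)).2.
- exact: (expE _ pw (planar d2')).2.
Qed.
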